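(* If $m,n\geq 2$ and $n\leq 2m-1$, then the canonical homomorphism $\Psi_{n}:\pi_n(\mathbb{E}_m)\to \check{\pi}_{n}(\mathbb{E}_m)$ is a split epimorphism.
   Context: For $m\geq 2$, $\mathbb{E}_m$ is the shrinking wedge of countably many $m$-spheres $S^m_1,S^m_2,\dots$: the one-point union $\bigvee_{j\in\mathbb{N}}S^m_j$ with wedgepoint $b_0$, where $U$ is open iff $U\cap S^m_j$ is open in $S^m_j$ for every $j$ and, if $b_0\in U$, then $S^m_j\subseteq U$ for all but finitely many $j$. Let $X_{\leq k}=\bigvee_{j=1}^{k}S^m_j$, let $b_{k+1,k}:X_{\leq k+1}\to X_{\leq k}$ collapse the $(k+1)$-st sphere to the wedgepoint, and let $b_k:\mathbb{E}_m\to X_{\leq k}$ collapse $\bigcup_{j>k}S^m_j$ to the wedgepoint. The Čech homotopy group is $\check{\pi}_n(\mathbb{E}_m)=\varprojlim_k(\pi_n(X_{\leq k}),(b_{k+1,k})_\#)$ and $\Psi_n:\pi_n(\mathbb{E}_m)\to\check{\pi}_n(\mathbb{E}_m)$ is $\Psi_n([f])=([b_k\circ f])_{k\in\mathbb{N}}$. *)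

(* Defs.v *)
From HB Require Import structures.
From mathcomp Require Import all_boot all_order all_algebra.
From mathcomp Require Import all_classical all_reals all_analysis.
Set Implicit Arguments. Unset Strict Implicit. Unset Printing Implicit Defensive.
Import Order.TTheory GRing.Theory Num.Theory.
Import numFieldNormedType.Exports.
Local Open Scope classical_set_scope.
Local Open Scope ring_scope.

Definition sphere (R : realType) (m : nat) : set 'rV[R]_(m.+1) :=
  [set v | \sum_(i < m.+1) (v ord0 i) ^+ 2 = 1].
Definition sphere_pt (R : realType) (m : nat) : 'rV[R]_(m.+1) := delta_mx ord0 ord0.
Arguments sphere {R m}.
Arguments sphere_pt {R m}.

(* ---------- carrier of the one-point union of countably many copies S^m_j ----
   None = the wedge point b0 ; Some (j, v) = the point v (v <> base point) of
   the j-th sphere.  Pairs with v not on the sphere are junk and never used. *)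
Definition wpt (R : realType) (m : nat) := option (nat * 'rV[R]_(m.+1)).
Definition b0 {R : realType} {m : nat} : wpt R m := None.

Definition wincl (R : realType) (m : nat) (j : nat) (v : 'rV[R]_(m.+1)) : wpt R m :=
  if v == sphere_pt then None else Some (j, v).

Definition wset (R : realType) (m : nat) (J : set nat) : set (wpt R m) :=
  [set x | match x with
           | None => True
           | Some (j, v) => J j /\ sphere v /\ v <> sphere_pt
           end].

Definition wopen (R : realType) (m : nat) (J : set nat) (U : set (wpt R m)) : Prop :=
  (forall j, J j -> exists V : set 'rV[R]_(m.+1),
       open V /\ @sphere R m `&` (wincl j @^-1` U) = @sphere R m `&` V) /\
  (U b0 -> finite_set [set j | J j /\ ~ (forall v, sphere v -> U (wincl j v))]).

Definition Eidx : set nat := [set j | (1 <= j)%N].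
Definition Xidx (k : nat) : set nat := [set j | (1 <= j <= k)%N].

Definition wcont (R : realType) (m : nat) (J : set nat) (T : topologicalType)
    (D : set T) (f : T -> wpt R m) : Prop :=
  (forall t, D t -> @wset R m J (f t)) /\
  (forall U, @wopen R m J U -> exists V : set T, open V /\ D `&` (f @^-1` U) = D `&` V).

(* collapse b_k : E_m -> X_{<=k}  (its restriction to X_{<=k+1} is b_{k+1,k}) *)
Definition bcol (R : realType) (m : nat) (k : nat) (x : wpt R m) : wpt R m :=
  match x with
  | None => None
  | Some (j, v) => if (j <= k)%N then Some (j, v) else None
  end.

Definition cube (R : realType) (n : nat) : set 'rV[R]_n :=
  [set v | forall i, 0 <= v ord0 i <= 1].
Arguments cube {R n}.
Definition bdry (R : realType) (n : nat) : set 'rV[R]_n :=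
  [set v | cube v /\ exists i, v ord0 i = 0 \/ v ord0 i = 1].
Arguments bdry {R n}.
Definition cyl (R : realType) (n : nat) : set (R * 'rV[R]_n) :=
  [set p | 0 <= p.1 <= 1 /\ cube p.2].
Arguments cyl {R n}.

Definition nmap (R : realType) (m n : nat) (J : set nat) (f : 'rV[R]_n -> wpt R m) : Prop :=
  wcont J (@cube R n) f /\ (forall v, bdry v -> f v = b0).

Definition htpy (R : realType) (m n : nat) (J : set nat) (f g : 'rV[R]_n -> wpt R m) : Prop :=
  exists H : R * 'rV[R]_n -> wpt R m,
    wcont J (@cyl R n) H /\
    (forall v, cube v -> H (0, v) = f v /\ H (1, v) = g v) /\
    (forall t v, 0 <= t <= 1 -> bdry v -> H (t, v) = b0).

Definition concat (R : realType) (m n : nat) (f g : 'rV[R]_n.+1 -> wpt R m)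
    : 'rV[R]_n.+1 -> wpt R m :=
  fun v => if v ord0 ord0 <= 2^-1
           then f (\row_i (if i == ord0 then 2 * v ord0 ord0 else v ord0 i))
           else g (\row_i (if i == ord0 then 2 * v ord0 ord0 - 1 else v ord0 i)).

(* elements of the Cech homotopy group  lim_k pi_n(X_{<=k}), given by
   representatives g k of compatible classes ([g_k])_{k >= 1} *)
Definition cech_elt (R : realType) (m n : nat) (g : nat -> 'rV[R]_n -> wpt R m) : Prop :=
  (forall k, (1 <= k)%N -> nmap (Xidx k) (g k)) /\
  (forall k, (1 <= k)%N -> htpy (Xidx k) (bcol k \o g k.+1) (g k)).

(* Main.v *)
(* A map into a wedge of m-spheres is a family of maps into R^(m+1) minus 0
   with disjoint supports, so that collapsing spheres, forming infinite sums and
   renaming spheres are operations on indices.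

   The key fact is that for n <= 2m - 1 a class a in pi_n of a finite wedge all
   of whose projections to single spheres vanish is an integral combination of
   the Whitehead products [iota_i, iota_j], and is zero if n < 2m - 1.  To see
   it, replace nullhomotopies F_j of the projections by pullbacks along
   staircase functions, one for each of the m + 1 target coordinates of each
   F_j, that climb in pairwise disjoint zones of the unit interval.  The pullback
   of F_j can differ from the base point only where m of the n + 1 coordinates
   lie in prescribed zones, so two of them can collide only if n + 1 = 2m, and
   then only in isolated cells.  Sweeping the nullhomotopies over such a cell
   changes the class by an integral multiple of one [iota_i, iota_j].

   A compatible family g is therefore determined by its projections g_i to the
   spheres and by integers c_ij, and
     sigma g = sum_i (g_i + [iota_i, sum_(j > i) c_ij iota_j])
   is a preimage.  The c_ij are only defined modulo the order N of
   [iota_1, iota_2], but [iota_i, N z] = 0 for every z by naturality, so sigma g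
   does not depend on them and sigma is additive. *)

(* At n = 2m - 1 a class sees all pairs of spheres, and infinitely many pair terms have to be
   realised by one continuous map. Grouping them by the smaller index i resolves this: the i-th
   summand meets only spheres of index at least i, so each sphere is met by finitely many summands,
   and the infinite sum over j is formed in pi_m, before the bracket is taken. That a staircase
   pullback rests at the base point off the prescribed zones is forced by a penalty. The last m
   coordinates of F_j are shifted by a small eta so as not to vanish at any of finitely many lattice
   points, and a large multiple of the sum of their absolute values is added to the zeroth
   coordinate. As soon as one of the m staircases stands at a lattice point the zeroth coordinate is
   nonnegative, and the half space of such vectors is collapsed to the base point. A collision of
   two pullbacks therefore involves 2m distinct labels, each of which occupies a coordinate of its
   own. *)
Require Import Defs.
From HB Require Import structures.
From mathcomp Require Import all_boot all_order all_algebra fingroup perm.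
From mathcomp Require Import all_classical all_reals all_analysis.
From mathcomp Require Import zify ring lra.
Import Order.TTheory GRing.Theory Num.Theory.
Import numFieldNormedType.Exports.
Local Open Scope classical_set_scope.
Local Open Scope ring_scope.
Set Implicit Arguments. Unset Strict Implicit. Unset Printing Implicit Defensive.

(** * Continuity of explicitly given functions *)

Section Continuity.
Context {R : realType} {T : topologicalType}.
Implicit Types f g : T -> R.

Lemma ctsc (U : topologicalType) (a : U) : continuous (fun _ : T => a).
Proof. exact: cst_continuous. Qed.

Lemma ctsN f : continuous f -> continuous (fun t => - f t).
Proof. by move=> cf x; apply: continuousN; exact: cf. Qed.

Lemma ctsD f g : continuous f -> continuous g -> continuous (fun t => f t + g t).
Proof. by move=> cf cg x; apply: continuousD; [exact: cf|exact: cg]. Qed.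

Lemma ctsM f g : continuous f -> continuous g -> continuous (fun t => f t * g t).
Proof. by move=> cf cg x; apply: continuousM; [exact: cf|exact: cg]. Qed.

Lemma ctsV f : (forall t, f t != 0) -> continuous f -> continuous (fun t => (f t)^-1).
Proof. by move=> f0 cf x; apply: continuousV; [exact: f0|exact: cf]. Qed.

Lemma ctsmax f g : continuous f -> continuous g ->
  continuous (fun t => Num.max (f t) (g t)).
Proof. by move=> cf cg x; apply: continuous_max; [exact: cf|exact: cg]. Qed.

Lemma ctsmin f g : continuous f -> continuous g ->
  continuous (fun t => Num.min (f t) (g t)).
Proof. by move=> cf cg x; apply: continuous_min; [exact: cf|exact: cg]. Qed.

Lemma ctsabs f : continuous f -> continuous (fun t => `|f t|).
Proof. by move=> cf x; apply: cvg_norm; exact: cf. Qed.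

Lemma cts_sum (I : Type) (r : seq I) (P : pred I) (F : I -> T -> R) :
  (forall i, P i -> continuous (F i)) ->
  continuous (fun t => \sum_(i <- r | P i) F i t).
Proof.
move=> cF; elim: r => [|i r IH].
  by under eq_fun do rewrite big_nil; exact: ctsc.
under eq_fun do rewrite big_cons.
by case Pi: (P i) => //; apply: ctsD => //; exact: cF.
Qed.

Lemma cts_row n (F : T -> 'rV[R]_n) :
  (forall k, continuous (fun t => F t ord0 k)) -> continuous F.
Proof.
move=> cF t A [P MP sPA].
have : nbhs t [set y | forall k, P ord0 k (F y ord0 k)].
  by apply: filter_forall => k; apply: cF; exact: MP.
by apply: filterS => y Py; apply: sPA => i j; rewrite ord1.
Qed.

Lemma cts_mkrow n (f : T -> 'I_n -> R) :
  (forall k, continuous (fun t => f t k)) -> continuous (fun t => \row_k f t k).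
Proof.
move=> cf; apply: cts_row => k.
by have -> : (fun t => (\row_k f t k) ord0 k) = f^~ k by apply/funext => t; rewrite mxE.
Qed.

Lemma cts_coord n (F : T -> 'rV[R]_n) k :
  continuous F -> continuous (fun t => F t ord0 k).
Proof.
move=> cF x; apply: (@continuous_comp _ _ _ F (fun v => v ord0 k)).
  exact: cF.
exact: coord_continuous.
Qed.

Lemma cts_comp (U W : topologicalType) (f : U -> W) (g : T -> U) :
  continuous f -> continuous g -> continuous (fun t => f (g t)).
Proof. by move=> cf cg x; apply: (@continuous_comp _ _ _ g f); [exact: cg|exact: cf]. Qed.

Lemma cts_pair (U W : topologicalType) (f : T -> U) (g : T -> W) :
  continuous f -> continuous g -> continuous (fun t => (f t, g t)).
Proof. by move=> cf cg x; apply: cvg_pair; [exact: cf|exact: cg]. Qed.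

Lemma cts_if (U : topologicalType) (c : T -> R) (f g : T -> U) :
  continuous c -> continuous f -> continuous g ->
  (forall t, c t = 0 -> f t = g t) ->
  continuous (fun t => if c t <= 0 then f t else g t).
Proof.
move=> cc cf cg fg t A; case: (ltgtP (c t) 0) => [ct|ct|ct] nA.
- have near_t : nbhs t (c @^-1` [set z | z < 0]) by apply: cc; exact: lt_nbhsl.
  have fA : nbhs t (f @^-1` A) by exact: cf.
  by apply: filterS2 near_t fA => y /= cy; rewrite ltW.
- have near_t : nbhs t (c @^-1` [set z | 0 < z]) by apply: cc; exact: lt_nbhsr.
  have gA : nbhs t (g @^-1` A) by exact: cg.
  by apply: filterS2 near_t gA => y /= cy; rewrite leNgt cy.
- have fA : nbhs t (f @^-1` A) by exact: cf.
  have gA : nbhs t (g @^-1` A) by apply: cg; rewrite -fg.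
  by apply: filterS2 fA gA => y /=; case: ifP.
Qed.

End Continuity.

Lemma cts_id (T : topologicalType) : continuous (fun t : T => t).
Proof. by move=> x. Qed.

Lemma cts_fst (T U : topologicalType) : continuous (fun p : T * U => p.1).
Proof. by move=> x; exact: cvg_fst. Qed.

Lemma cts_snd (T U : topologicalType) : continuous (fun p : T * U => p.2).
Proof. by move=> x; exact: cvg_snd. Qed.

Lemma ctsfst (S T U : topologicalType) (f : S -> T * U) :
  continuous f -> continuous (fun t => (f t).1).
Proof. by move=> cf; exact: (cts_comp (@cts_fst T U) cf). Qed.

Lemma ctssnd (S T U : topologicalType) (f : S -> T * U) :
  continuous f -> continuous (fun t => (f t).2).
Proof. by move=> cf; exact: (cts_comp (@cts_snd T U) cf). Qed.

Ltac cts_ext f := idtac.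

Ltac cts :=
  match goal with
  | H : continuous ?f |- continuous ?f => exact H
  | |- continuous ?f => lazymatch f with
    | (fun _ => ?c) => exact: ctsc
    | (fun t => t) => exact: cts_id
    | @fst _ _ => exact: cts_fst
    | @snd _ _ => exact: cts_snd
    | (fun t => @?a t + @?b t) => apply: (@ctsD _ _ a b); cbv beta; cts
    | (fun t => - @?a t) => apply: (@ctsN _ _ a); cbv beta; cts
    | (fun t => @?a t * @?b t) => apply: (@ctsM _ _ a b); cbv beta; cts
    | (fun t => Num.max (@?a t) (@?b t)) => apply: (@ctsmax _ _ a b); cbv beta; cts
    | (fun t => Num.min (@?a t) (@?b t)) => apply: (@ctsmin _ _ a b); cbv beta; cts
    | (fun t => `|@?a t|) => apply: (@ctsabs _ _ a); cbv beta; cts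
    | (fun t => (@?a t, @?b t)) => apply: (@cts_pair _ _ _ a b); cbv beta; cts
    | (fun t => (@?a t).1) => apply: (@ctsfst _ _ _ a); cbv beta; cts
    | (fun t => (@?a t).2) => apply: (@ctssnd _ _ _ a); cbv beta; cts
    | (fun t => fun_of_matrix (@?a t) _ ?k) => apply: (@cts_coord _ _ _ a k); cbv beta; cts
    | _ => cts_ext f
    end
  | _ => idtac
  end.

Ltac cts_ext f ::= lazymatch f with
  | (fun t => \big[_/_]_(i <- _ | _) _) => apply: cts_sum => ? ?; cts
  | (fun t => ?h (@?a t)) => match goal with
     H : continuous h |- _ => apply: (@cts_comp _ _ _ h a); [exact H|cbv beta; cts] end
  | _ => idtac
  end.

(** * Maps into a wedge of spheres as families of disjointly supported maps *)

Section Maps.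
Context {R : realType} {m : nat}.
Local Notation V := 'rV[R]_m.+1.
Local Notation e0 := (sphere_pt : V).

(* A map into a wedge of spheres is recorded by its components, one for each
   sphere.  The sphere is thickened to the homotopy equivalent V minus 0. *)
Definition smap (T : topologicalType) (Z : set T) (F : T -> nat -> V) : Prop :=
  [/\ forall j, continuous (fun t => F t j), forall t j, F t j != 0,
      forall t i j, i != j -> F t i = e0 \/ F t j = e0 &
      forall t, Z t -> forall j, F t j = e0].

(** Maps live on all of R^n and are constant outside the open cube. Reparametrisations and
    homotopies may then leave the cube; they only have to send this complement into itself. *)
Definition cubeout n : set 'rV[R]_n := [set x | exists i, ~~ (0 < x ord0 i < 1)].
Definition cylout n : set (R * 'rV[R]_n) := [set p | cubeout p.2].

Definition hom n (F G : 'rV[R]_n -> nat -> V) : Prop :=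
  exists H : R * 'rV[R]_n -> nat -> V,
    [/\ smap (@cylout n) H, forall x j, H (0, x) j = F x j & forall x j, H (1, x) j = G x j].

Definition basemap (T : Type) : T -> nat -> V := fun _ _ => e0.

(** Union of two disjointly supported maps: where one of them is [e0] the formula returns the other.
    Being a formula without cases, it is continuous for free. *)
Definition sup (T : Type) (F G : T -> nat -> V) : T -> nat -> V :=
  fun t j => F t j + G t j - e0.

Lemma e0_neq0 : e0 != 0.
Proof.
apply/eqP => /rowP /(_ ord0); rewrite !mxE eqxx /= => /eqP.
by rewrite oner_eq0.
Qed.

Section General.
Context {T : topologicalType}.
Implicit Types (Z : set T) (F G : T -> nat -> V).

Lemma smap_base Z : smap Z (@basemap T).
Proof.
split=> // [j|t j|t i j _]; [exact: ctsc|exact: e0_neq0|by left].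
Qed.

Lemma smap_comp (T' : topologicalType) Z (Z' : set T') F (phi : T' -> T) :
  smap Z F -> continuous phi -> (forall t, Z' t -> Z (phi t)) ->
  smap Z' (fun t => F (phi t)).
Proof.
move=> [cF nF dF zF] cphi ZZ; split=> [j|t j|t i j|t /ZZ /zF //].
- by apply: (cts_comp (cF j)).
- exact: nF.
- exact: dF.
Qed.

Lemma ctsVD (f g : T -> V) : continuous f -> continuous g ->
  continuous (fun t => f t + g t).
Proof. by move=> cf cg x; apply: continuousD; [exact: cf|exact: cg]. Qed.

Lemma ctsVZ (s : T -> R) (f : T -> V) : continuous s -> continuous f ->
  continuous (fun t => s t *: f t).
Proof. by move=> cs cf x; apply: continuousZ; [exact: cs|exact: cf]. Qed.

Lemma smap_sup Z F G : smap Z F -> smap Z G ->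
  (forall t, (forall j, F t j = e0) \/ (forall j, G t j = e0)) ->
  smap Z (sup F G).
Proof.
move=> [cF nF dF zF] [cG nG dG zG] FG; split=> [j|t j|t i j ij|t Zt j].
- by apply: ctsVD; [exact: ctsVD|exact: ctsc].
- by rewrite /sup; case: (FG t) => ->; rewrite ?addrK // addrAC subrr add0r.
- rewrite /sup; case: (FG t) => Ft; rewrite !Ft.
    by rewrite ![e0 + _]addrC !addrK; exact: dG.
  by rewrite !addrK; exact: dF.
- by rewrite /sup zF // zG // addrK.
Qed.

Lemma smap_if Z F G (c : T -> R) : continuous c -> smap Z F -> smap Z G ->
  (forall t, c t = 0 -> forall j, F t j = G t j) ->
  smap Z (fun t => if c t <= 0 then F t else G t).
Proof.
move=> cc [cF nF dF zF] [cG nG dG zG] FG; split=> [j|t j|t i j|t Zt j].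
- have -> : (fun t => (if c t <= 0 then F t else G t) j) =
            (fun t => if c t <= 0 then F t j else G t j).
    by apply/funext => t; case: ifP.
  by apply: cts_if => // t /FG.
- by case: ifP.
- by case: ifP => _; [exact: dF|exact: dG].
- by case: ifP => _; [exact: zF|exact: zG].
Qed.

End General.

Section Hom.
Context {n : nat}.
Implicit Types F G H : 'rV[R]_n -> nat -> V.
Local Notation smapn := (smap (@cubeout n)).

Lemma cts_slice (s : R) : continuous (fun x : 'rV[R]_n => (s, x)).
Proof. by apply: cts_pair; [exact: ctsc|exact: cts_id]. Qed.

Lemma hom_smapl F G : hom F G -> smapn F.
Proof.
move=> [H [sH H0 _]]; have -> : F = fun x => H (0, x).
  by apply/funext => x; apply/funext => j; rewrite H0.
by apply: (smap_comp sH) => //; exact: cts_slice.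
Qed.

Lemma hom_smapr F G : hom F G -> smapn G.
Proof.
move=> [H [sH _ H1]]; have -> : G = fun x => H (1, x).
  by apply/funext => x; apply/funext => j; rewrite H1.
by apply: (smap_comp sH) => //; exact: cts_slice.
Qed.

Lemma hom_refl F : smapn F -> hom F F.
Proof.
by move=> sF; exists (fun p => F p.2); split=> //; apply: (smap_comp sF) => //; cts.
Qed.

Lemma hom_eq F G : smapn F -> (forall x j, F x j = G x j) -> hom F G.
Proof.
move=> sF FG; have <- : F = G by apply/funext => x; apply/funext => j.
exact: hom_refl.
Qed.

Lemma hom_sym F G : hom F G -> hom G F.
Proof.
move=> [H [sH H0 H1]]; exists (fun p => H (1 - p.1, p.2)); split=> [|x j|x j].
- by apply: (smap_comp sH) => //; cts.
- by rewrite /= subr0.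
- by rewrite /= subrr.
Qed.

Lemma hom_trans G F H : hom F G -> hom G H -> hom F H.
Proof.
move=> [P [sP P0 P1]] [Q [sQ Q0 Q1]].
exists (fun p => if 2 * p.1 - 1 <= 0 then P (2 * p.1, p.2) else Q (2 * p.1 - 1, p.2)).
split=> [|x j|x j].
- pose c (p : R * 'rV[R]_n) := 2 * p.1 - 1.
  have cc : continuous c by rewrite /c; cts.
  apply: (smap_if cc).
  + by apply: (smap_comp sP) => //; cts.
  + by apply: (smap_comp sQ) => //; cts.
  + move=> [s x]; rewrite /c /= => s0 j; have -> : 2 * s = 1 by lra.
    by rewrite subrr P1 Q0.
- by rewrite /= mulr0 add0r lerN10.
- rewrite /= ifF; last by apply/negbTE; rewrite -ltNge; lra.
  by have -> : 2 * 1 - 1 = 1 :> R by lra.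
Qed.

(** Many homotopies below fix a map [K] and only move the point at which it is read. *)
Lemma hom_path k (Z : set 'rV[R]_k) (K : 'rV[R]_k -> nat -> V)
    (phi : R * 'rV[R]_n -> 'rV[R]_k) F G :
  smap Z K -> continuous phi -> (forall s x, cubeout x -> Z (phi (s, x))) ->
  (forall x j, K (phi (0, x)) j = F x j) -> (forall x j, K (phi (1, x)) j = G x j) ->
  hom F G.
Proof.
move=> sK cphi Zphi phi0 phi1; exists (fun p => K (phi p)); split=> //.
by apply: (smap_comp sK) => // -[s x]; exact: Zphi.
Qed.

Lemma hom_map (th : (nat -> V) -> nat -> V) F G :
  (forall (T : topologicalType) (Z : set T) K, smap Z K -> smap Z (fun t => th (K t))) ->
  hom F G -> hom (fun x => th (F x)) (fun x => th (G x)).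
Proof.
move=> sth [H [sH H0 H1]]; exists (fun p => th (H p)); split=> [|x j|x j].
- exact: sth.
- by congr (th _ _); apply/funext => i.
- by congr (th _ _); apply/funext => i.
Qed.

End Hom.

Section Update.
Context {n : nat}.
Implicit Types (x : 'rV[R]_n) (k l : 'I_n).

Definition upd x k (r : R) : 'rV[R]_n := \row_i (if i == k then r else x ord0 i).

Lemma updE x k r : upd x k r ord0 k = r.
Proof. by rewrite mxE eqxx. Qed.

Lemma updN x k r l : l != k -> upd x k r ord0 l = x ord0 l.
Proof. by move=> lk; rewrite mxE (negbTE lk). Qed.

Lemma upd_id x k : upd x k (x ord0 k) = x.
Proof. by apply/rowP => i; rewrite mxE; case: eqP => [->|]. Qed.

Lemma upd_upd x k r s : upd (upd x k r) k s = upd x k s.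
Proof. by apply/rowP => i; rewrite !mxE; case: eqP. Qed.

Lemma updC x k l r s : k != l -> upd (upd x k r) l s = upd (upd x l s) k r.
Proof.
move=> kl; apply/rowP => i; rewrite !mxE.
by case: (eqVneq i k) => [->|//]; rewrite (negbTE kl).
Qed.

Lemma cts_upd (T : topologicalType) (f : T -> 'rV[R]_n) k (r : T -> R) :
  continuous f -> continuous r -> continuous (fun t => upd (f t) k (r t)).
Proof.
move=> cf cr; apply: cts_row => i.
have -> : (fun t => upd (f t) k (r t) ord0 i) =
          (fun t => if i == k then r t else f t ord0 i).
  by apply/funext => t; rewrite mxE.
by case: (i == k) => //; cts.
Qed.

Lemma cubeout_upd x k r : ~~ (0 < r < 1) -> cubeout (upd x k r).
Proof. by move=> r01; exists k; rewrite updE. Qed.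

Lemma cubeoutP x k r : cubeout x ->
  (~~ (0 < x ord0 k < 1) -> ~~ (0 < r < 1)) -> cubeout (upd x k r).
Proof.
move=> [i xi] xr; have [ik|ik] := eqVneq i k.
  by apply: cubeout_upd; apply: xr; rewrite -ik.
by exists i; rewrite updN.
Qed.

Lemma smap_upd (F : 'rV[R]_n -> nat -> V) x k r j : smap (@cubeout n) F ->
  ~~ (0 < r < 1) -> F (upd x k r) j = e0.
Proof. by move=> [_ _ _ zF] r01; apply: zF; exact: cubeout_upd. Qed.

End Update.

End Maps.
Arguments basemap {R m T}.

Ltac cts_ext f ::= lazymatch f with
  | (fun t => upd (@?a t) ?k (@?r t)) => apply: (@cts_upd _ _ _ a k r); cbv beta; cts
  | (fun t => \big[_/_]_(i <- _ | _) _) => apply: cts_sum => ? ?; cts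
  | (fun t => ?h (@?a t)) => match goal with
     H : continuous h |- _ => apply: (@cts_comp _ _ _ h a); [exact H|cbv beta; cts] end
  | _ => idtac
  end.
Ltac out01 := apply/negP => /andP [? ?]; lra.
Ltac vring := apply/rowP => ?; rewrite !mxE; ring.

(** * The homotopy groups of the wedge *)

Section Concat.
Context {R : realType} {m n : nat}.
Local Notation V := 'rV[R]_m.+1.
Local Notation e0 := (sphere_pt : V).
Local Notation smapn := (smap (@cubeout R n)).
Implicit Types (F G H : 'rV[R]_n -> nat -> V) (k l : 'I_n).

(** No case distinction at 1/2 occurs: beyond its own half each of the two maps already is [e0]. *)
Definition conc k F G : 'rV[R]_n -> nat -> V :=
  sup (fun x => F (upd x k (2 * x ord0 k))) (fun x => G (upd x k (2 * x ord0 k - 1))).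

Lemma conc_disj k F G x : smapn F -> smapn G ->
  (forall j, F (upd x k (2 * x ord0 k)) j = e0) \/
  (forall j, G (upd x k (2 * x ord0 k - 1)) j = e0).
Proof.
move=> sF sG; case: (lerP (x ord0 k) 2^-1) => xk; [right|left] => j.
  by apply: (smap_upd _ _ _ sG); out01.
by apply: (smap_upd _ _ _ sF); out01.
Qed.

Lemma smap_conc k F G : smapn F -> smapn G -> smapn (conc k F G).
Proof.
move=> sF sG; apply: smap_sup.
- apply: (smap_comp sF) => [|x xo]; first by cts.
  by apply: cubeoutP xo _ => xk; apply/negP => /andP[? ?]; move/negP: xk; apply; lra.
- apply: (smap_comp sG) => [|x xo]; first by cts.
  by apply: cubeoutP xo _ => xk; apply/negP => /andP[? ?]; move/negP: xk; apply; lra.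
- by move=> x; exact: conc_disj.
Qed.

Lemma hom_conc k F F' G G' : hom F F' -> hom G G' -> hom (conc k F G) (conc k F' G').
Proof.
move=> [P [sP P0 P1]] [Q [sQ Q0 Q1]].
exists (sup (fun p => P (p.1, upd p.2 k (2 * p.2 ord0 k)))
            (fun p => Q (p.1, upd p.2 k (2 * p.2 ord0 k - 1)))).
split=> [|x j|x j]; last 2 first.
- by rewrite /sup /= P0 Q0.
- by rewrite /sup /= P1 Q1.
apply: smap_sup => [||[s x]].
- apply: (smap_comp sP) => [|[s x] xo]; first by cts.
  by apply: cubeoutP xo _ => xk; apply/negP => /andP[? ?]; move/negP: xk; apply; lra.
- apply: (smap_comp sQ) => [|[s x] xo]; first by cts.
  by apply: cubeoutP xo _ => xk; apply/negP => /andP[? ?]; move/negP: xk; apply; lra.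
- case: (lerP (x ord0 k) 2^-1) => xk; [right|left] => j /=.
    by case: sQ => _ _ _; apply => /=; apply: cubeout_upd; out01.
  by case: sP => _ _ _; apply => /=; apply: cubeout_upd; out01.
Qed.

(** Interpolate linearly: the conditions on a reparametrisation are convex, so the exterior of the
    cube stays in the exterior. *)
Lemma hom_reparam k (phi psi : R -> R) F : smapn F ->
  continuous phi -> continuous psi ->
  (forall r, r <= 0 -> phi r <= 0) -> (forall r, 1 <= r -> 1 <= phi r) ->
  (forall r, r <= 0 -> psi r <= 0) -> (forall r, 1 <= r -> 1 <= psi r) ->
  hom (fun x => F (upd x k (phi (x ord0 k)))) (fun x => F (upd x k (psi (x ord0 k)))).
Proof.
move=> sF cphi cpsi phi0 phi1 psi0 psi1.
apply: (hom_path (phi := fun p : R * 'rV[R]_n => upd p.2 k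
  ((1 - Num.min (Num.max p.1 0) 1) * phi (p.2 ord0 k) +
   Num.min (Num.max p.1 0) 1 * psi (p.2 ord0 k))) sF).
- by cts.
- move=> s x xo /=; set r := Num.min _ _.
  have r01 : 0 <= r <= 1.
    by rewrite /r le_min ge_min lexx orbT le_max lexx orbT ler01.
  apply: cubeoutP xo _ => xk; apply/negP => /andP[a b].
  have [xk0|xk1] : x ord0 k <= 0 \/ 1 <= x ord0 k.
    by case: (lerP (x ord0 k) 0) xk => [|_]; [left|rewrite /= -leNgt; right].
  + by have := phi0 _ xk0; have := psi0 _ xk0; nra.
  + by have := phi1 _ xk1; have := psi1 _ xk1; nra.
- by move=> x j; rewrite /= maxxx min_l ?ler01 // subr0 mul1r mul0r addr0.
- by move=> x j; rewrite /= max_l ?ler01 // minxx subrr mul1r mul0r add0r.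
Qed.

Lemma hom_reparam_id k (phi : R -> R) F : smapn F -> continuous phi ->
  (forall r, r <= 0 -> phi r <= 0) -> (forall r, 1 <= r -> 1 <= phi r) ->
  hom (fun x => F (upd x k (phi (x ord0 k)))) F.
Proof.
move=> sF cphi phi0 phi1.
have := hom_reparam k sF cphi (@cts_id R) phi0 phi1 (fun _ => id) (fun _ => id).
by congr hom; apply/funext => x; rewrite upd_id.
Qed.

Lemma conc_base k F : smapn F -> hom (conc k F basemap) F.
Proof.
move=> sF; have := @hom_reparam_id k (fun r => 2 * r) F sF.
have -> : conc k F basemap = fun x => F (upd x k (2 * x ord0 k)).
  by apply/funext => x; apply/funext => j; rewrite /conc /sup addrK.
by apply; [cts|move=> *; lra|move=> *; lra].
Qed.

Lemma base_conc k F : smapn F -> hom (conc k basemap F) F.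
Proof.
move=> sF; have := @hom_reparam_id k (fun r => 2 * r - 1) F sF.
have -> : conc k basemap F = fun x => F (upd x k (2 * x ord0 k - 1)).
  by apply/funext => x; apply/funext => j; rewrite /conc /sup addrC addKr.
by apply; [cts|move=> *; lra|move=> *; lra].
Qed.

Lemma concA k F G H : smapn F -> smapn G -> smapn H ->
  hom (conc k (conc k F G) H) (conc k F (conc k G H)).
Proof.
move=> sF sG sH.
(* Sends 0, 1/4, 1/2, 1 to 0, 1/2, 3/4, 1. The slopes 2, 1, 1/2 decrease, so this piecewise linear
   map is the minimum of its pieces. *)
pose rho (r : R) := Num.min (Num.min (2 * r) (r + 4^-1)) (2^-1 * r + 2^-1).
have rhoE r : [\/ [/\ r <= 4^-1 & rho r = 2 * r],
    [/\ 4^-1 <= r, r <= 2^-1 & rho r = r + 4^-1] |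
    [/\ 2^-1 <= r & rho r = 2^-1 * r + 2^-1]].
  rewrite /rho; case: (lerP r 4^-1) => r1; first by constructor 1; split=> //; rewrite (@min_l _ _ (2 * r)) ?min_l; lra.
  case: (lerP r 2^-1) => r2.
    by constructor 2; split; [lra| |rewrite (@min_r _ _ (2 * r)) ?min_l; lra].
  by constructor 3; split; [lra|rewrite (@min_r _ _ (2 * r)) ?min_r; lra].
have sQ := smap_conc k sF (smap_conc k sG sH).
have := @hom_reparam_id k rho _ sQ.
have -> : (fun x => conc k F (conc k G H) (upd x k (rho (x ord0 k)))) =
          conc k (conc k F G) H.
  apply/funext => x; apply/funext => j; rewrite /conc /sup !updE !upd_upd.
  set r := x ord0 k.
  have F0 s : s <= 0 \/ 1 <= s -> F (upd x k s) j = e0.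
    by move=> s01; apply: (smap_upd _ _ _ sF); case: s01 => ?; out01.
  have G0 s : s <= 0 \/ 1 <= s -> G (upd x k s) j = e0.
    by move=> s01; apply: (smap_upd _ _ _ sG); case: s01 => ?; out01.
  have H0 s : s <= 0 \/ 1 <= s -> H (upd x k s) j = e0.
    by move=> s01; apply: (smap_upd _ _ _ sH); case: s01 => ?; out01.
  case: (rhoE r) => [[r1 ->]|[r1 r2 ->]|[r1 ->]].
  - rewrite (G0 (2 * (2 * (2 * r) - 1))) ?(H0 (2 * (2 * (2 * r) - 1) - 1))
      ?(G0 (2 * (2 * r) - 1)) ?(H0 (2 * r - 1)); try by left; lra.
    by vring.
  - rewrite (F0 (2 * (r + 4^-1))) ?(H0 (2 * (2 * (r + 4^-1) - 1) - 1))
      ?(F0 (2 * (2 * r))) ?(H0 (2 * r - 1)); try by [left; lra|right; lra].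
    have -> : 2 * (2 * (r + 4^-1) - 1) = 2 * (2 * r) - 1 by field.
    by vring.
  - rewrite (F0 (2 * (2^-1 * r + 2^-1))) ?(G0 (2 * (2 * (2^-1 * r + 2^-1) - 1)))
      ?(F0 (2 * (2 * r))) ?(G0 (2 * (2 * r) - 1)); try by right; lra.
    have -> : 2 * (2 * (2^-1 * r + 2^-1) - 1) - 1 = 2 * r - 1 by field.
    by vring.
by apply; [rewrite /rho; cts|move=> r; case: (rhoE r) => -[]; lra..].
Qed.

Definition refl k (F : 'rV[R]_n -> nat -> V) : 'rV[R]_n -> nat -> V :=
  fun x => F (upd x k (1 - x ord0 k)).

Lemma cubeout_refl k (x : 'rV[R]_n) : cubeout x -> cubeout (upd x k (1 - x ord0 k)).
Proof.
move=> xo; apply: cubeoutP xo _ => xk.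
by apply/negP => /andP[? ?]; move/negP: xk; apply; lra.
Qed.

Lemma smap_refl k F : smapn F -> smapn (refl k F).
Proof. by move=> sF; apply: (smap_comp sF); [cts|exact: cubeout_refl]. Qed.

Lemma conc_refl k F : smapn F -> hom (conc k F (refl k F)) basemap.
Proof.
move=> sF.
(* A tent of height 1 in direction [k], lowered until it lies below 0. *)
apply: (hom_path (phi := fun p : R * 'rV[R]_n => upd p.2 k
  (1 - `|2 * p.2 ord0 k - 1| - Num.max p.1 0)) sF).
- by cts.
- move=> s x xo /=; have s0 : 0 <= Num.max s 0 by rewrite le_max lexx orbT.
  apply: cubeoutP xo _ => xk; apply/negP => /andP[a b].
  move/negP: xk; apply; have := ler_norm (2 * x ord0 k - 1).
  by have := ler_norm (- (2 * x ord0 k - 1)); rewrite normrN; lra.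
- move=> x j; rewrite /= maxxx subr0 /conc /sup /refl !updE !upd_upd.
  have F0 s : s <= 0 \/ 1 <= s -> F (upd x k s) j = e0.
    by move=> s01; apply: (smap_upd _ _ _ sF); case: s01 => ?; out01.
  case: (lerP (x ord0 k) 2^-1) => xk.
    rewrite (F0 (1 - (2 * x ord0 k - 1))) ?addrK; last by right; lra.
    by rewrite ler0_norm; [congr (F (upd x k _) j); ring|lra].
  rewrite (F0 (2 * x ord0 k)); last by right; lra.
  rewrite addrAC subrr add0r ger0_norm; last by lra.
  by [].
- move=> x j; rewrite /= max_l ?ler01 //; apply: (smap_upd _ _ _ sF).
  by have := normr_ge0 (2 * x ord0 k - 1) => ?; out01.
Qed.

Lemma conc_interchange k l F G F' G' x j : k != l ->
  conc k (conc l F G) (conc l F' G') x j = conc l (conc k F F') (conc k G G') x j.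
Proof.
move=> kl; have lk : l != k by rewrite eq_sym.
by rewrite /conc /sup !(updN _ _ kl) !(updN _ _ lk) !(@updC _ _ _ k l) //; vring.
Qed.

(** Eckmann-Hilton: pad both maps with the unit, interchange the two directions, and remove the
    units. [concC] does the same with the padding placed crosswise. *)
Lemma hom_conc_dir k l F G : k != l -> smapn F -> smapn G ->
  hom (conc k F G) (conc l F G).
Proof.
move=> kl sF sG; have sb := smap_base (@cubeout R n).
apply: (@hom_trans _ _ _ (conc k (conc l F basemap) (conc l basemap G))).
  by apply: hom_conc; apply: hom_sym; [exact: conc_base|exact: base_conc].
apply: (@hom_trans _ _ _ (conc l (conc k F basemap) (conc k basemap G))).
  apply: hom_eq => [|x j]; last exact: conc_interchange.
  by apply: smap_conc; exact: smap_conc.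
by apply: hom_conc; [exact: conc_base|exact: base_conc].
Qed.

Lemma concC k l F G : k != l -> smapn F -> smapn G ->
  hom (conc k F G) (conc k G F).
Proof.
move=> kl sF sG; have sb := smap_base (@cubeout R n).
apply: (@hom_trans _ _ _ (conc k (conc l basemap F) (conc l G basemap))).
  by apply: hom_conc; apply: hom_sym; [exact: base_conc|exact: conc_base].
apply: (@hom_trans _ _ _ (conc l (conc k basemap G) (conc k F basemap))).
  apply: hom_eq => [|x j]; last exact: conc_interchange.
  by apply: smap_conc; exact: smap_conc.
apply: (@hom_trans _ _ _ (conc l G F)).
  by apply: hom_conc; [exact: base_conc|exact: conc_base].
by apply: hom_conc_dir; rewrite 1?eq_sym.
Qed.

End Concat.

Section Pi.
Context {R : realType} {m n : nat}.
Local Notation V := 'rV[R]_m.+1.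
Local Notation map := ('rV[R]_n.+2 -> nat -> V).
Local Notation smapn := (smap (@cubeout R n.+2)).
Implicit Types (F G H : map).

Definition Pi_pred (C : set map) : Prop := exists2 F, smapn F & C = hom F.
(** [Pi R m n] stands for degree n + 2, so that two directions exist and the group is commutative.
    Its wedge has a sphere for every natural number; the group of a finite wedge appears as the
    image of a projection [pr]. *)
Definition Pi := {C : set map | Pi_pred C}.

HB.instance Definition _ := gen_eqMixin Pi.
HB.instance Definition _ := gen_choiceMixin Pi.

Lemma Pi_base : Pi_pred (hom (@basemap R m 'rV[R]_n.+2)).
Proof. by exists basemap => //; exact: smap_base. Qed.

(** Total, with the class of the base map as default for families that are not [smap]. *)
Definition cls F : Pi :=
  match pselect (smapn F) with
  | left sF => exist _ (hom F) (ex_intro2 _ _ F sF erefl)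
  | right _ => exist _ _ Pi_base
  end.

Lemma clsP F G : smapn F -> smapn G -> (cls F = cls G) <-> hom F G.
Proof.
move=> sF sG; rewrite /cls; case: pselect => // a; case: pselect => // b; split.
  by move=> /(congr1 sval) /= ->; exact: hom_refl.
move=> FG; apply: eq_exist => /=; apply/seteqP; split=> H.
  by apply: hom_trans; exact: hom_sym.
exact: hom_trans.
Qed.

Lemma cls_hom F G : hom F G -> cls F = cls G.
Proof. by move=> FG; apply/clsP => //; [exact: hom_smapl FG|exact: hom_smapr FG]. Qed.

Lemma Pi_ex (a : Pi) : exists F, smapn F /\ cls F = a.
Proof.
case: a => C [F sF CE]; exists F; split=> //; rewrite /cls; case: pselect => // sF'.
exact: eq_exist.
Qed.

Definition rep (a : Pi) : map := sval (cid (Pi_ex a)).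

Lemma smap_rep a : smapn (rep a).
Proof. by rewrite /rep; case: cid => F []. Qed.

Lemma cls_rep a : cls (rep a) = a.
Proof. by rewrite /rep; case: cid => F []. Qed.

Lemma rep_cls F : smapn F -> hom (rep (cls F)) F.
Proof. by move=> sF; apply/clsP; rewrite ?cls_rep //; exact: smap_rep. Qed.

Definition Pi_add (a b : Pi) : Pi := cls (conc ord0 (rep a) (rep b)).
Definition Pi_opp (a : Pi) : Pi := cls (refl ord0 (rep a)).
Definition Pi_zero : Pi := cls basemap.

Local Notation k1 := (Ordinal (isT : 1 < n.+2)%N).

Lemma Pi_addE F G : smapn F -> smapn G -> Pi_add (cls F) (cls G) = cls (conc ord0 F G).
Proof. by move=> sF sG; apply: cls_hom; apply: hom_conc; exact: rep_cls. Qed.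

Lemma Pi_addA : associative Pi_add.
Proof.
move=> a b c; rewrite -(cls_rep a) -(cls_rep b) -(cls_rep c).
have [[sa sb] sc] := (smap_rep a, smap_rep b, smap_rep c).
rewrite !Pi_addE //; try exact: smap_conc.
by apply: cls_hom; apply: hom_sym; exact: concA.
Qed.

Lemma Pi_addC : commutative Pi_add.
Proof.
move=> a b; rewrite -(cls_rep a) -(cls_rep b) !Pi_addE; try exact: smap_rep.
by apply: cls_hom; apply: (@concC _ _ _ ord0 k1) => //; exact: smap_rep.
Qed.

Lemma Pi_add0 : left_id Pi_zero Pi_add.
Proof.
move=> a; rewrite -(cls_rep a) Pi_addE; [|exact: smap_base|exact: smap_rep].
by apply: cls_hom; apply: base_conc; exact: smap_rep.
Qed.

Lemma Pi_addN : left_inverse Pi_zero Pi_opp Pi_add.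
Proof.
move=> a; rewrite Pi_addC -{1}(cls_rep a) Pi_addE; try exact: smap_rep.
  by apply: cls_hom; apply: conc_refl; exact: smap_rep.
by apply: smap_refl; exact: smap_rep.
Qed.

HB.instance Definition _ := GRing.isZmodule.Build Pi Pi_addA Pi_addC Pi_add0 Pi_addN.

Lemma cls_base : cls basemap = 0.
Proof. by []. Qed.

Lemma cls_conc k F G : smapn F -> smapn G -> cls (conc k F G) = cls F + cls G.
Proof.
move=> sF sG; rewrite [RHS]Pi_addE //; have [->//|k0] := eqVneq k ord0.
by apply: cls_hom; exact: hom_conc_dir.
Qed.

Lemma cls_refl k F : smapn F -> cls (refl k F) = - cls F.
Proof.
move=> sF; have sr := smap_refl k sF; apply/eqP; rewrite -addr_eq0 addrC -(cls_conc k) //.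
by apply/eqP; apply: cls_hom; exact: conc_refl.
Qed.

End Pi.
Arguments Pi : clear implicits.

Section TargetMaps.
Context {R : realType} {m : nat}.
Local Notation V := 'rV[R]_m.+1.
Local Notation e0 := (sphere_pt : V).

(** A based map of wedges, seen through its effect on maps from every domain. Quantifying over all
    domains makes it act on homotopies as well. *)
Definition tmap (th : (nat -> V) -> nat -> V) : Prop :=
  forall (T : topologicalType) (Z : set T) K, smap Z K -> smap Z (fun t => th (K t)).

Lemma tmap_base th : tmap th -> forall j, th (fun _ => e0) j = e0.
Proof.
by move=> /(_ _ setT _ (smap_base (T := R) setT)) [_ _ _ /(_ 0 I)].
Qed.

Definition coll (J : pred nat) (v : nat -> V) : nat -> V :=
  fun j => if J j then v j else e0.

Lemma tmap_coll J : tmap (coll J).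
Proof.
move=> T Z K [cK nK dK zK]; rewrite /coll; split=> [j|t j|t i j ij|t Zt j].
- by case: (J j) => //; exact: ctsc.
- by case: (J j) => //; exact: e0_neq0.
- by case: (J i); case: (J j); [exact: dK|right|left|left].
- by case: (J j) => //; exact: zK.
Qed.

Lemma tmap_sup th (T : Type) (F G : T -> nat -> V) t j : tmap th ->
  (forall j, F t j = e0) \/ (forall j, G t j = e0) ->
  th (sup F G t) j = sup (fun t => th (F t)) (fun t => th (G t)) t j.
Proof.
move=> /tmap_base tb FG; rewrite /sup; case: FG => E.
  have -> : F t = fun _ => e0 by apply/funext.
  by rewrite tb addrC addKr; congr (th _ _); apply/funext => i; rewrite addrC addKr.
have -> : G t = fun _ => e0 by apply/funext.
by rewrite tb addrK; congr (th _ _); apply/funext => i; rewrite addrK.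
Qed.

Section Pmap.
Context {n : nat}.
Local Notation Pi := (Pi R m n).
Local Notation smapn := (smap (@cubeout R n.+2)).
Implicit Types (a b : Pi) (J : pred nat).

Definition pmap th a : Pi := cls (fun x => th (rep a x)).

Lemma pmap_cls th F : tmap th -> smapn F -> pmap th (cls F) = cls (fun x => th (F x)).
Proof. by move=> tth sF; apply: cls_hom; apply: hom_map => //; exact: rep_cls. Qed.

Lemma pmapD th a b : tmap th -> pmap th (a + b) = pmap th a + pmap th b.
Proof.
move=> tth; have [sa sb] := (smap_rep a, smap_rep b).
rewrite -{1}(cls_rep a) -{1}(cls_rep b) -(cls_conc ord0) // pmap_cls //; last exact: smap_conc.
rewrite -(cls_conc ord0); try exact: tth.
apply: cls_hom; apply: hom_eq => [|x j]; first by apply: tth; exact: smap_conc.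
by apply: (tmap_sup _ tth); exact: conc_disj.
Qed.

Lemma pmap0 th : tmap th -> pmap th 0 = 0 :> Pi.
Proof. by move=> tth; apply: (addrI (pmap th 0)); rewrite -pmapD // !addr0. Qed.

Lemma pmapN th a : tmap th -> pmap th (- a) = - pmap th a.
Proof. by move=> tth; apply/eqP; rewrite -addr_eq0 -pmapD // addNr pmap0. Qed.

Lemma pmapMz th a (z : int) : tmap th -> pmap th (a *~ z) = pmap th a *~ z.
Proof.
move=> tth; have pM k : pmap th (a *+ k) = pmap th a *+ k.
  by elim: k => [|k IH]; rewrite ?pmap0 // !mulrS pmapD // IH.
by case: z => k; rewrite ?NegzE ?mulrNz ?pmapN // -!pmulrn pM.
Qed.

Lemma pmap_sum th (I : Type) (r : seq I) (P : pred I) (A : I -> Pi) : tmap th ->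
  pmap th (\sum_(i <- r | P i) A i) = \sum_(i <- r | P i) pmap th (A i).
Proof.
by move=> tth; elim/big_rec2: _ => [|i x y _ <-]; rewrite ?pmap0 // pmapD.
Qed.

Definition pr J a := pmap (coll J) a.

Lemma prD J a b : pr J (a + b) = pr J a + pr J b.
Proof. by apply: pmapD; exact: tmap_coll. Qed.

Lemma pr0 J : pr J 0 = 0.
Proof. by apply: pmap0; exact: tmap_coll. Qed.

Lemma prN J a : pr J (- a) = - pr J a.
Proof. by apply: pmapN; exact: tmap_coll. Qed.

Lemma prMz J a z : pr J (a *~ z) = pr J a *~ z.
Proof. by apply: pmapMz; exact: tmap_coll. Qed.

Lemma pr_sum J (I : Type) (r : seq I) (P : pred I) (A : I -> Pi) :
  pr J (\sum_(i <- r | P i) A i) = \sum_(i <- r | P i) pr J (A i).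
Proof. by apply: pmap_sum; exact: tmap_coll. Qed.

Lemma pr_cls J F : smapn F -> pr J (cls F) = cls (fun x => coll J (F x)).
Proof. by apply: pmap_cls; exact: tmap_coll. Qed.

Lemma cls_eq F G : smapn F -> (forall x j, F x j = G x j) -> cls F = cls G :> Pi.
Proof. by move=> sF FG; apply: cls_hom; exact: hom_eq. Qed.

Lemma pr_pr J J' a : pr J (pr J' a) = pr (fun j => J j && J' j) a.
Proof.
have sa : smapn (fun x => coll J' (rep a x)) by apply: tmap_coll; exact: smap_rep.
rewrite [pr J' a]/pr /pmap pr_cls //; apply: cls_eq => [|x j]; first exact: tmap_coll.
by rewrite /coll /=; case: (J j); case: (J' j).
Qed.

Lemma eq_pr J J' a : J =1 J' -> pr J a = pr J' a.
Proof. by move=> /funext ->. Qed.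

Lemma pr_F J a : (forall j, ~~ J j) -> pr J a = 0.
Proof.
move=> JF; rewrite -cls_base; apply: cls_eq => [|x j]; last by rewrite /coll (negbTE (JF j)).
by apply: tmap_coll; exact: smap_rep.
Qed.

End Pmap.
End TargetMaps.

(** * Infinite sums *)

Section InfiniteSup.
Context {R : realType} {m : nat} {T : topologicalType}.
Local Notation V := 'rV[R]_m.+1.
Local Notation e0 := (sphere_pt : V).

(** In component [j] only the terms with i <= j are added. For a receding family this omits nothing,
    and continuity becomes a matter of finite sums; this is how the shrinking topology of the wedge
    enters. *)
Definition infsup (W : nat -> T -> nat -> V) : T -> nat -> V :=
  fun t j => e0 + \sum_(i < j.+1) (W i t j - e0).

Definition pw_disj (W : nat -> T -> nat -> V) : Prop :=
  forall t i i', (i < i')%N -> (forall j, W i t j = e0) \/ (forall j, W i' t j = e0).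

Definition receding (W : nat -> T -> nat -> V) : Prop :=
  forall i t j, (j < i)%N -> W i t j = e0.

Lemma infsupE W i0 t j : receding W ->
  (forall i, i != i0 -> forall j, W i t j = e0) -> infsup W t j = W i0 t j.
Proof.
move=> rW W0; rewrite /infsup; case: (ltnP j i0) => ji.
  rewrite big1 ?addr0 ?rW // => i _; rewrite W0 ?subrr //.
  by rewrite neq_ltn (leq_trans (ltn_ord i)).
rewrite (bigD1 (Ordinal (ji : (i0 < j.+1)%N))) //= big1 ?addr0; last first.
  by move=> i; rewrite -val_eqE /= => ii; rewrite W0 ?subrr.
by rewrite addrC subrK.
Qed.

Lemma pw_disjP W t : pw_disj W -> exists i0, forall i, i != i0 -> forall j, W i t j = e0.
Proof.
move=> dW; have [[i0 Wi0]|] := pselect (exists i0, ~ (forall j, W i0 t j = e0)).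
  by exists i0 => i; rewrite neq_ltn => /orP[] /(dW t) [].
by move=> /forallNP W0; exists 0%N => i _; have /contrapT := W0 i.
Qed.

Lemma smap_infsup (Z : set T) W : (forall i, smap Z (W i)) -> receding W -> pw_disj W ->
  smap Z (infsup W).
Proof.
move=> sW rW dW; split=> [j|t j|t i j ij|t Zt j].
- apply: ctsVD; first exact: ctsc.
  have cW i : continuous (fun t => W i t j - e0).
    by apply: ctsVD; [case: (sW i)|exact: ctsc].
  elim: (j.+1) => [|p IH]; first by under eq_fun do rewrite big_ord0; exact: ctsc.
  by under eq_fun do rewrite big_ord_recr; exact: ctsVD.
- have [i0 Wi0] := pw_disjP t dW; rewrite (infsupE _ rW Wi0).
  by case: (sW i0).
- have [i0 Wi0] := pw_disjP t dW; rewrite !(infsupE _ rW Wi0).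
  by case: (sW i0) => _ _ + _; apply.
- have [i0 Wi0] := pw_disjP t dW; rewrite (infsupE _ rW Wi0).
  by case: (sW i0) => _ _ _; apply.
Qed.

End InfiniteSup.

Section InfiniteSum.
Context {R : realType} {m n : nat}.
Local Notation V := 'rV[R]_m.+1.
Local Notation e0 := (sphere_pt : V).
Local Notation map := ('rV[R]_n.+2 -> nat -> V).
Local Notation smapn := (smap (@cubeout R n.+2)).
Local Notation Pi := (Pi R m n).
Local Notation k1 := (Ordinal (isT : 1 < n.+2)%N).
Implicit Types (z : nat -> map).

(** Affine, from [1 - 2^-i, 1 - 2^-(i+1)] onto [0, 1]: consecutive intervals that exhaust the unit
    interval. *)
Definition slab i (r : R) : R := 2 ^+ i.+1 * (r - 1) + 2.

Lemma slabS i r : slab i.+1 r = slab i (2 * r - 1).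
Proof. by rewrite /slab exprSr; ring. Qed.

Lemma slab_lt i i' r : (i < i')%N -> 0 < slab i' r -> 1 < slab i r.
Proof.
have slab1 p : 0 < slab p.+1 r -> 1 < slab p r.
  by rewrite /slab exprS; set y := 2 ^+ p.+1; lra.
by elim: i' => // i' IH; rewrite ltnS leq_eqVlt => /orP[/eqP ->|/IH {}IH] /slab1 // /(lt_trans ltr01).
Qed.

Lemma slab_out i r : ~~ (0 < r < 1) -> ~~ (0 < slab i r < 1).
Proof.
move=> r01; apply/negP => /andP[a b]; move/negP: r01; apply; apply/andP.
have p1 : 1 <= 2 ^+ i :> R by rewrite exprn_ege1 // ler1n.
move: a b; rewrite /slab exprS; set y := 2 ^+ i in p1 * => a b.
by split; nra.
Qed.

Lemma cts_slab i : continuous (slab i).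
Proof. by rewrite /slab; cts. Qed.

(** The terms follow each other in direction 1, which leaves direction 0 free for the group
    operation; the two commute by [Sinf_conc]. *)
Definition Sinf z : map := infsup (fun i x => z i (upd x k1 (slab i (x ord0 k1)))).

Lemma slab_disj z : (forall i, smapn (z i)) ->
  pw_disj (fun i x => z i (upd x k1 (slab i (x ord0 k1)))).
Proof.
move=> sz x i i' ii; case: (lerP (slab i' (x ord0 k1)) 0) => s0; [right|left] => j.
  by apply: (smap_upd _ _ _ (sz _)); out01.
by have := slab_lt ii s0 => s1; apply: (smap_upd _ _ _ (sz _)); out01.
Qed.

Lemma smap_Sinf z : (forall i, smapn (z i)) -> receding z -> smapn (Sinf z).
Proof.
move=> sz rz; apply: smap_infsup => [i|i x j ji|]; last exact: slab_disj.
- apply: (smap_comp (sz i)) => [|x xo]; first by have ? := @cts_slab i; cts.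
  by apply: cubeoutP xo _; exact: slab_out.
- exact: rz.
Qed.

Lemma hom_Sinf z z' : receding z -> receding z' -> (forall i, hom (z i) (z' i)) ->
  hom (Sinf z) (Sinf z').
Proof.
move=> rz rz' /choice [H HH].
(* The homotopy chosen for term [i] may visit spheres of index below [i]. Collapsing these makes the
   family of homotopies receding, and at both ends the sum reads no such component. *)
pose H' i p := coll (fun j => i <= j)%N (H i p).
have sH i : smap (@cylout R n.+2) (H' i) by apply: tmap_coll; case: (HH i).
exists (infsup (fun i p => H' i (p.1, upd p.2 k1 (slab i (p.2 ord0 k1))))).
split=> [|x j|x j].
- apply: smap_infsup => [i|i [s x] j ji|[s x] i i' ii].
  + apply: (smap_comp (sH i)) => [|[s x] xo]; first by have ? := @cts_slab i; cts.
    by apply: cubeoutP xo _; exact: slab_out.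
  + by rewrite /H' /coll leqNgt ji.
  + case: (lerP (slab i' (x ord0 k1)) 0) => s0; [right|left] => j.
      by case: (sH i') => _ _ _; apply => /=; apply: cubeout_upd; out01.
    have := slab_lt ii s0 => s1.
    by case: (sH i) => _ _ _; apply => /=; apply: cubeout_upd; out01.
- rewrite /Sinf /infsup; congr (_ + _); apply: eq_bigr => i _; congr (_ - _).
  by rewrite /H' /coll -ltnS ltn_ord; case: (HH i).
- rewrite /Sinf /infsup; congr (_ + _); apply: eq_bigr => i _; congr (_ - _).
  by rewrite /H' /coll -ltnS ltn_ord; case: (HH i).
Qed.

Lemma Sinf_conc z z' x j :
  Sinf (fun i => conc ord0 (z i) (z' i)) x j = conc ord0 (Sinf z) (Sinf z') x j.
Proof.
rewrite /Sinf /conc /sup /infsup.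
have k01 : k1 != ord0 by [].
have k10 : ord0 != k1 by [].
set A := \sum_(i < j.+1) (z i _ j - e0); set B := \sum_(i < j.+1) (z' i _ j - e0).
transitivity (e0 + (A + B)); last by move: A B => A B; vring.
rewrite /A /B -big_split /=; congr (_ + _); apply: eq_bigr => i _.
by rewrite !(updN _ _ k01) !(@updC _ _ _ k1 ord0) // !(updN _ _ k10); vring.
Qed.

Lemma Sinf_peel z x j : receding z ->
  Sinf z x j = conc k1 (z 0%N) (Sinf (fun i => z i.+1)) x j.
Proof.
move=> rz; rewrite /Sinf /conc /sup /infsup big_ord_recl big_ord_recr /=.
rewrite [z j.+1 _ _]rz // subrr addr0 updE.
have -> : slab 0 (x ord0 k1) = 2 * x ord0 k1 by rewrite /slab expr1; ring.
set B := (X in _ = _ + (e0 + X) - e0).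
rewrite (_ : \sum_(i < j) _ = B); first by move: B => B; vring.
by apply: eq_bigr => i _; rewrite upd_upd slabS.
Qed.

(** Collapsing the spheres below [i] in term [i] makes the family receding for arbitrary [c], so
    that [csum] is defined and additive on all sequences. *)
Definition csum (c : nat -> Pi) : Pi :=
  cls (Sinf (fun i x => coll (fun j => i <= j)%N (rep (c i) x))).

Lemma receding_coll (f : nat -> map) :
  receding (fun i x => coll (fun j => i <= j)%N (f i x)).
Proof. by move=> i x j ji; rewrite /coll leqNgt ji. Qed.

Lemma smap_coll J (F : map) : smapn F -> smapn (fun x => coll J (F x)).
Proof. exact: tmap_coll. Qed.

Lemma csumD (c c' : nat -> Pi) : csum (fun i => c i + c' i) = csum c + csum c'.
Proof.
have s0 i : smapn (rep (c i)) by exact: smap_rep.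
have s1 i : smapn (rep (c' i)) by exact: smap_rep.
rewrite /csum -(cls_conc ord0); try by apply: smap_Sinf;
  [move=> i; exact/smap_coll/smap_rep|exact: receding_coll].
apply: cls_hom; apply: (@hom_trans _ _ _ (Sinf (fun i => conc ord0
   (fun x => coll (fun j => i <= j)%N (rep (c i) x))
   (fun x => coll (fun j => i <= j)%N (rep (c' i) x))))).
  apply: hom_Sinf => [||i]; first exact: receding_coll.
    by move=> i x j ji; rewrite /conc /sup /coll leqNgt ji addrK.
  apply: (@hom_trans _ _ _ (fun x => coll (fun j => i <= j)%N
    (conc ord0 (rep (c i)) (rep (c' i)) x))).
    apply: hom_map; first exact: tmap_coll.
    by apply/clsP; rewrite ?cls_rep ?cls_conc ?cls_rep //; [exact: smap_rep|exact: smap_conc].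
  apply: hom_eq => [|x j]; first by apply: smap_coll; exact: smap_conc.
  by apply: (tmap_sup _ (tmap_coll _)); exact: conc_disj.
apply: hom_eq => [|x j]; last exact: Sinf_conc.
apply: smap_Sinf => [i|i x j ji]; first by apply: smap_conc; exact: smap_coll.
by rewrite /conc /sup /coll leqNgt ji addrK.
Qed.

Lemma csumMz (c : nat -> Pi) (z : int) : csum (fun i => c i *~ z) = csum c *~ z.
Proof.
have c0 : csum (fun _ => 0) = 0.
  apply: (addrI (csum (fun _ => 0))); by rewrite -csumD !addr0.
have cN d : csum (fun i => - d i) = - csum d.
  apply/eqP; rewrite -addr_eq0 -csumD -[X in _ == X]c0; apply/eqP; congr csum.
  by apply/funext => i; rewrite addNr.
have cM d k : csum (fun i => d i *+ k) = csum d *+ k.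
  elim: k => [|k IH]; first by rewrite mulr0n -[RHS]c0.
  by under eq_fun do rewrite mulrS; rewrite csumD IH mulrS.
case: z => k; first by under eq_fun do rewrite -pmulrn; rewrite cM pmulrn.
by under eq_fun do rewrite NegzE mulrNz -pmulrn; rewrite cN cM NegzE mulrNz pmulrn.
Qed.

Lemma cls_Sinf_split z p : (forall i, smapn (z i)) -> receding z ->
  cls (Sinf z) = \sum_(i < p) cls (z i) + cls (Sinf (fun i => z (p + i)%N)).
Proof.
elim: p z => [|p IH] z sz rz; first by rewrite big_ord0 add0r.
have rz' : receding (fun i => z i.+1) by move=> i x j ji; apply: rz; exact: ltnW.
rewrite big_ord_recl -addrA.
have := IH (fun i => z i.+1) (fun i => sz _) rz'.
have -> : (fun i => z (p + i).+1) = (fun i => z (p.+1 + i)%N) by [].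
move=> /= <-; rewrite -(cls_conc k1) //; last exact: smap_Sinf.
by apply: cls_eq => [|x j]; [exact: smap_Sinf|exact: Sinf_peel].
Qed.

(** Peel off k + 1 terms; the remaining infinite sum meets only spheres above [k] and is
    collapsed. *)
Lemma pr_csum k (c : nat -> Pi) :
  pr (fun j => j <= k)%N (csum c) = \sum_(i < k.+1) pr (fun j => i <= j <= k)%N (c i).
Proof.
have sz i : smapn (fun x => coll (fun j => i <= j)%N (rep (c i) x)).
  by apply: smap_coll; exact: smap_rep.
rewrite /csum (@cls_Sinf_split _ k.+1) //; last exact: receding_coll.
set F := Sinf _; have sF : smapn F.
  by apply: smap_Sinf => // i x j ji; rewrite /coll ifF //; apply/negbTE; lia.
rewrite prD; have -> : pr (fun j => j <= k)%N (cls F) = 0.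
  rewrite pr_cls // -cls_base; apply: cls_eq => [|x j]; first exact: smap_coll.
  rewrite /coll; case: ifP => // jk; rewrite /F /Sinf /infsup big1 ?addr0 // => i _.
  by rewrite /coll ifF ?subrr //; apply/negbTE; lia.
rewrite addr0 pr_sum; apply: eq_bigr => i _.
rewrite -[in RHS](cls_rep (c i)) !pr_cls //; try exact: smap_rep.
apply: cls_eq => [|x j]; first exact: smap_coll.
by rewrite /coll /=; case: (j <= k)%N; case: (i <= j)%N.
Qed.

End InfiniteSum.

(** * Coordinate permutations act by signs *)

Section Permutations.
Context {R : realType} {m n : nat}.
Local Notation V := 'rV[R]_m.+1.
Local Notation e0 := (sphere_pt : V).
Local Notation map := ('rV[R]_n.+2 -> nat -> V).
Local Notation smapn := (smap (@cubeout R n.+2)).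
Local Notation Pi := (Pi R m n).
Implicit Types (F : map) (k l : 'I_n.+2) (s : {perm 'I_n.+2}).

Definition permx s (x : 'rV[R]_n.+2) : 'rV[R]_n.+2 := \row_i x ord0 (s i).

Lemma cts_permx s : continuous (permx s).
Proof.
apply: cts_row => i.
have -> : (fun x => permx s x ord0 i) = fun x : 'rV[R]_n.+2 => x ord0 (s i).
  by apply/funext => x; rewrite mxE.
by cts.
Qed.

Lemma cubeout_permx s x : cubeout x -> cubeout (permx s x).
Proof. by move=> [i xi]; exists ((s^-1)%g i); rewrite mxE permKV. Qed.

Lemma smap_permx s F : smapn F -> smapn (fun x => F (permx s x)).
Proof. by move=> sF; apply: (smap_comp sF); [exact: cts_permx|exact: cubeout_permx]. Qed.

(** A quarter turn in the plane of [k] and [l] about the centre of the cube, joined to the identity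
    by a segment of matrices. *)
Lemma hom_rot k l F : k != l -> smapn F -> hom (fun x => refl l F (permx (tperm k l) x)) F.
Proof.
move=> kl sF; have lk : l != k by rewrite eq_sym.
(* The matrices on the segment scale squared lengths by (1 - r)^2 + r^2 >= 1/2. A point that is
   exterior in this plane has squared distance at least 1/4 from the centre and ends at squared
   distance at least 1/8, so one coordinate is off by 1/4, and the doubling in [sc] puts it outside
   the unit interval. *)
pose sc (G : map) : map := fun x => G (upd (upd x k (2 * x ord0 k - 2^-1)) l (2 * x ord0 l - 2^-1)).
have hom_sc G : smapn G -> hom (sc G) G.
  move=> sG; pose psi (r : R) := 2 * r - 2^-1.
  have cpsi : continuous psi by rewrite /psi; cts.
  have psi0 r : r <= 0 -> psi r <= 0 by rewrite /psi => ?; lra.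
  have psi1 r : 1 <= r -> 1 <= psi r by rewrite /psi => ?; lra.
  have sG' : smapn (fun x => G (upd x l (psi (x ord0 l)))).
    exact: hom_smapl (hom_reparam_id l sG cpsi psi0 psi1).
  have h1 := hom_reparam_id k sG' cpsi psi0 psi1.
  apply: hom_trans (hom_reparam_id l sG cpsi psi0 psi1).
  apply: hom_trans h1; apply: hom_eq => [|x j]; last by rewrite /sc (updN _ _ lk).
  apply: (smap_comp sG) => [|x xo]; first by cts.
  have step (y : 'rV[R]_n.+2) i : cubeout y -> cubeout (upd y i (2 * y ord0 i - 2^-1)).
    move=> yo; apply: cubeoutP yo _ => yi.
    by apply/negP => /andP[? ?]; move/negP: yi; apply; lra.
  by have := step _ l (step _ k xo); rewrite (updN _ _ lk).
set G := (fun x => refl l F (permx (tperm k l) x)).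
have sG : smapn G by apply: smap_permx; exact: smap_refl.
apply: hom_trans (hom_sc _ sF); apply: hom_trans (hom_sym (hom_sc _ sG)) _.
apply: hom_sym.
pose c (s : R) := Num.min (Num.max s 0) 1.
apply: (hom_path (phi := fun p : R * 'rV[R]_n.+2 =>
  upd (upd p.2 k (2^-1 + 2 * ((1 - c p.1) * (p.2 ord0 k - 2^-1) + c p.1 * (p.2 ord0 l - 2^-1))))
   l (2^-1 + 2 * ((1 - c p.1) * (p.2 ord0 l - 2^-1) + - (c p.1 * (p.2 ord0 k - 2^-1))))) sF).
- by rewrite /c; cts.
- move=> s x xo /=; set r := c s.
  have r01 : 0 <= r <= 1.
    by rewrite /r /c le_min ge_min lexx orbT le_max lexx orbT ler01.
  set X := x ord0 k - 2^-1; set Y := x ord0 l - 2^-1.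
  set P := (1 - r) * X + r * Y; set Q := (1 - r) * Y + - (r * X).
  have PQ : P ^+ 2 + Q ^+ 2 = ((1 - r) ^+ 2 + r ^+ 2) * (X ^+ 2 + Y ^+ 2).
    by rewrite /P /Q; ring.
  have rr : 2^-1 <= (1 - r) ^+ 2 + r ^+ 2 by have := sqr_ge0 (r - 2^-1); lra.
  have [i xi] := xo; have [ikl|] := boolP ((i == k) || (i == l)); last first.
    by rewrite negb_or => /andP[ik il]; exists i; rewrite !updN.
  have XY : 4^-1 <= X ^+ 2 + Y ^+ 2.
    have sq (z : R) : ~~ (0 < z < 1) -> 4^-1 <= (z - 2^-1) ^+ 2.
      rewrite negb_and -!leNgt => /orP[] ?; nra.
    case/orP: ikl => /eqP E; move: xi; rewrite E => /sq.
      by rewrite -/X; have := sqr_ge0 Y; lra.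
    by rewrite -/Y; have := sqr_ge0 X; lra.
  have PQ8 : 8^-1 <= P ^+ 2 + Q ^+ 2 by rewrite PQ; nra.
  have [P4|P4] := boolP (0 < 2^-1 + 2 * P < 1); last by exists k; rewrite updN // updE.
  exists l; rewrite updE; apply/negP => Q4.
  have P2 : P ^+ 2 < 16^-1 by case/andP: P4 => ? ?; nra.
  have Q2 : Q ^+ 2 < 16^-1 by case/andP: Q4 => ? ?; nra.
  by lra.
- move=> x j /=; rewrite /c maxxx min_l ?ler01 // /sc.
  by congr (F (upd (upd x k _) l _) j); field.
- move=> x j /=; rewrite /c max_l ?ler01 // minxx /sc /G /refl.
  congr (F _ j); apply/rowP => i; rewrite !mxE /= ?mxE.
  have [E|il] := eqVneq i l; first by rewrite tpermR (negbTE kl) eqxx; field.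
  have [E|ik] := eqVneq i k; first by rewrite E tpermL eqxx ?(negbTE kl); field.
  by rewrite tpermD ?(negbTE il) ?(negbTE ik) // eq_sym.
Qed.

Lemma cls_tperm k l F : k != l -> smapn F ->
  cls (fun x => F (permx (tperm k l) x)) = - cls F :> Pi.
Proof.
move=> kl sF; rewrite -(cls_refl l) // -(cls_hom (hom_rot kl (smap_refl l sF))).
apply: cls_eq => [|x j]; first exact: smap_permx.
by rewrite /refl !updE upd_upd subKr upd_id.
Qed.

(** [b] is the parity of [s]. It is chosen before [F], which makes the signs in the Whitehead
    products universal. *)
Lemma cls_permx s : exists b : bool, forall F, smapn F ->
  cls (fun x => F (permx s x)) = cls F *~ (-1) ^+ b :> Pi.
Proof.
have [ts -> _] := prod_tpermP s; elim: ts => [|[k l] ts [b IH]].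
  exists false => F sF; rewrite big_nil expr0 mulr1z; apply: cls_eq => [|x j].
    exact: smap_permx.
  by congr (F _ j); apply/rowP => i; rewrite mxE perm1.
rewrite big_cons /=; set t := (\prod_(j <- ts) _)%g in IH *.
have permM F x j : F (permx (tperm k l * t)%g x) j = F (permx (tperm k l) (permx t x)) j.
  by congr (F _ j); apply/rowP => i; rewrite !mxE permM.
have [->|kl] := eqVneq k l.
  exists b => F sF; rewrite -IH //; apply: cls_eq => [|x j]; first exact: smap_permx.
  by congr (F _ j); apply/rowP => i; rewrite !mxE tperm1 mul1g.
exists (~~ b) => F sF; rewrite (_ : (-1) ^+ (~~ b) = - (-1) ^+ b); last by case: b {IH}.
rewrite mulrNz -mulNrz -(cls_tperm kl sF) -IH; last exact: smap_permx.
by apply: cls_eq => [|x j]; [exact: smap_permx|exact: permM].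
Qed.

Lemma hom_box F (lo hi : 'I_n.+2 -> R) :
  (forall i, 0 <= lo i) -> (forall i, lo i <= hi i) -> (forall i, hi i <= 1) ->
  smap [set x : 'rV[R]_n.+2 | exists i, ~~ (lo i < x ord0 i < hi i)] F ->
  hom F (fun x => F (\row_i (lo i + (hi i - lo i) * x ord0 i))).
Proof.
move=> lo0 lohi hi1 sF.
pose c (s : R) := Num.min (Num.max s 0) 1.
apply: (hom_path (phi := fun p : R * 'rV[R]_n.+2 =>
  \row_i ((1 - c p.1) * p.2 ord0 i + c p.1 * (lo i + (hi i - lo i) * p.2 ord0 i))) sF).
- by apply: cts_mkrow => i; rewrite /c; cts.
- move=> s x [i xi]; exists i; rewrite mxE /=; set r := c s.
  have r01 : 0 <= r <= 1.
    by rewrite /r /c le_min ge_min lexx orbT le_max lexx orbT ler01.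
  have := lo0 i; have := lohi i; have := hi1 i.
  move: xi; rewrite !negb_and -!leNgt => /orP[] x0 h1 h2 h3; apply/orP; [left|right].
    have a1 : (1 - r) * x ord0 i <= 0 by nra.
    have a2 : (hi i - lo i) * x ord0 i <= 0 by nra.
    by nra.
  have a1 : 1 - r <= (1 - r) * x ord0 i by nra.
  have a2 : hi i - lo i <= (hi i - lo i) * x ord0 i by nra.
  by nra.
- move=> x j; congr (F _ j); apply/rowP => i; rewrite mxE /= /c maxxx min_l ?ler01 //.
  by rewrite subr0 mul1r mul0r addr0.
- move=> x j; congr (F _ j); apply/rowP => i; rewrite !mxE /= /c max_l ?ler01 // minxx.
  by rewrite subrr mul1r mul0r add0r.
Qed.

End Permutations.

(** * Whitehead products *)

Section Clamp.
Context {R : realType}.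
Implicit Types r s : R.

Definition cl r : R := Num.min (Num.max r 0) 1.

Lemma cts_cl : continuous cl.
Proof. by rewrite /cl; cts. Qed.

Variant cl_spec r : R -> Prop :=
  | ClLow of r <= 0 : cl_spec r 0
  | ClMid of 0 < r & r < 1 : cl_spec r r
  | ClHigh of 1 <= r : cl_spec r 1.

Lemma clP r : cl_spec r (cl r).
Proof.
rewrite /cl; case: (lerP r 0) => r0; first by rewrite min_l ?ler01 //; constructor.
by case: (lerP 1 r) => r1; constructor; rewrite ?(ltW r1).
Qed.

Lemma cl01 r : 0 <= cl r <= 1.
Proof. by case: clP => ?; lra. Qed.

Lemma cl_low r : r <= 0 -> cl r = 0.
Proof. by case: clP => //; lra. Qed.

Lemma cl_high r : 1 <= r -> cl r = 1.
Proof. by case: clP => //; lra. Qed.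

Lemma cl_id r : 0 <= r <= 1 -> cl r = r.
Proof. by case: clP => //; lra. Qed.

Lemma cl1B r : cl (1 - r) = 1 - cl r.
Proof. by case: (clP r) => ?; case: clP => ?; lra. Qed.

Definition inI r := 0 < r < 1.

(* The clockwise loop based at (-1/2, -1/2) around the unit square. *)
Definition gam1 r : R := - 2^-1 + 2 * (cl (4 * r - 1) - cl (4 * r - 3)).
Definition gam2 r : R := - 2^-1 + 2 * (cl (4 * r) - cl (4 * r - 2)).

Lemma gam1B r : gam1 (1 - r) = gam2 r.
Proof.
rewrite /gam1 /gam2; have -> : 4 * (1 - r) - 1 = 1 - (4 * r - 2) by ring.
have -> : 4 * (1 - r) - 3 = 1 - 4 * r by ring.
by rewrite !cl1B; ring.
Qed.

Lemma gam2B r : gam2 (1 - r) = gam1 r.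
Proof. by rewrite -gam1B subKr. Qed.

Lemma cts_gam1 : continuous gam1.
Proof. by have ? := cts_cl; rewrite /gam1; cts. Qed.

Lemma cts_gam2 : continuous gam2.
Proof. by have ? := cts_cl; rewrite /gam2; cts. Qed.

Lemma gam_out r : ~~ inI r -> gam1 r = - 2^-1 /\ gam2 r = - 2^-1.
Proof.
rewrite /inI negb_and -!leNgt => /orP[] r0; rewrite /gam1 /gam2.
  by rewrite !cl_low; [split; lra|lra..].
by rewrite !cl_high; [split; lra|lra..].
Qed.

Lemma gam_square r : ~ (inI (gam1 r) /\ inI (gam2 r)).
Proof.
rewrite /inI /gam1 /gam2; have [h|h] := lerP r 4^-1.
  by rewrite (cl_low (_ : 4 * r - 1 <= 0)) ?(cl_low (_ : 4 * r - 3 <= 0)); lra.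
have [h'|h'] := lerP r 2^-1.
  by rewrite (cl_high (_ : 1 <= 4 * r)) ?(cl_low (_ : 4 * r - 2 <= 0)); lra.
have [h''|h''] := lerP r (3 * 4^-1).
  by rewrite (cl_high (_ : 1 <= 4 * r - 1)) ?(cl_low (_ : 4 * r - 3 <= 0)); lra.
by rewrite (cl_high (_ : 1 <= 4 * r)) ?(cl_high (_ : 1 <= 4 * r - 2)); lra.
Qed.

End Clamp.

Lemma cts_prod (R : realType) (T : topologicalType) (I : Type) (r : seq I) (P : pred I)
    (F : I -> T -> R) :
  (forall i, continuous (F i)) -> continuous (fun t => \prod_(i <- r | P i) F i t).
Proof.
move=> cF; elim: r => [|i r IH].
  by under eq_fun do rewrite big_nil; exact: ctsc.
under eq_fun do rewrite big_cons.
by case Pi: (P i) => //; apply: ctsM.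
Qed.

Section Consv.
Context {R : realType} {p : nat}.

Definition consv (a : R) (y : 'I_p -> R) : 'rV[R]_p.+1 :=
  \row_k (if unlift ord0 k is Some l then y l else a).

Lemma consv0 a y : consv a y ord0 ord0 = a.
Proof. by rewrite mxE unlift_none. Qed.

Lemma consvS a y l : consv a y ord0 (lift ord0 l) = y l.
Proof. by rewrite mxE liftK. Qed.

Lemma consv_eta (x : 'rV[R]_p.+1) :
  consv (x ord0 ord0) (fun l => x ord0 (lift ord0 l)) = x.
Proof.
apply/rowP => k; case: (unliftP ord0 k) => [l|] ->; first by rewrite consvS.
by rewrite consv0.
Qed.

Lemma cts_consv (T : topologicalType) (a : T -> R) (y : T -> 'I_p -> R) :
  continuous a -> (forall l, continuous (fun t => y t l)) ->
  continuous (fun t => consv (a t) (y t)).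
Proof.
move=> ca cy; apply: cts_mkrow => k.
by case: (unliftP ord0 k) => [l|] E; rewrite ?liftK ?unlift_none.
Qed.

Lemma cubeout_consv (a : R) (y : 'I_p -> R) :
  ~ (inI a /\ forall l, inI (y l)) -> cubeout (consv a y).
Proof.
move=> ay; have [Ia|] := boolP (inI a); last by exists ord0; rewrite consv0.
have [l yl] : exists l, ~ inI (y l) by apply/existsNP => yl; apply: ay.
by exists (lift ord0 l); rewrite consvS; apply/negP.
Qed.

End Consv.

Section Whitehead.
Context {R : realType} {m q : nat}.
Local Notation V := 'rV[R]_m.+1.
Local Notation e0 := (sphere_pt : V).
Local Notation n := (q + q.+1)%N.
Local Notation N := (n.+2).
Local Notation smapN := (smap (@cubeout R N)).
Local Notation smapq := (smap (@cubeout R q.+2)).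
Local Notation map := ('rV[R]_q.+2 -> nat -> V).
Implicit Types (u v : map) (x : 'rV[R]_N).

(** Degree n + 2 = 2(q + 2) - 1: besides coordinate 0, the loop parameter, there are two blocks of q
    + 1 coordinates, one for each factor. The remaining coordinate of each factor is supplied by the
    loop. *)
Definition ix (l : 'I_q.+1) : 'I_N := lift ord0 (lshift q.+1 l).
Definition iy (l : 'I_q.+1) : 'I_N := lift ord0 (rshift q.+1 l).

Lemma ixyP (P : 'I_N -> Prop) :
  P ord0 -> (forall l, P (ix l)) -> (forall l, P (iy l)) -> forall k, P k.
Proof.
move=> P0 Px Py k; case: (unliftP ord0 k) => [l|] -> //.
case: (splitP (l : 'I_(q.+1 + q.+1))) => l' El.
  by have -> : lift ord0 l = ix l' by apply: val_inj; rewrite /= El.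
by have -> : lift ord0 l = iy l' by apply: val_inj; rewrite /= El.
Qed.

Lemma ix_neq_iy l l' : ix l != iy l'.
Proof.
by apply/eqP => /(congr1 val) /=; rewrite /bump /=; have := ltn_ord l; lia.
Qed.

Lemma iy_inj : injective iy.
Proof. by move=> l l' /lift_inj /(congr1 val) /= /addnI /val_inj. Qed.

Definition upart u (a : R) x : nat -> V := u (consv a (fun l => 2 * x ord0 (ix l) - 2^-1)).
Definition vpart v (b : R) x : nat -> V := v (consv b (fun l => 2 * x ord0 (iy l) - 2^-1)).

(** The sphere of dimension 2p - 1 as the boundary of a product of two p-cubes: over [core] the
    first coordinates (k1, k2) of the two factors are meant to run around the unit square, where at
    most one factor is away from the base point. *)
Definition Wgen (k1 k2 : 'rV[R]_N -> R) u v : 'rV[R]_N -> nat -> V :=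
  sup (fun x => upart u (k1 x) x) (fun x => vpart v (k2 x) x).

(** Here every 2x - 1/2 read by the factors lies in the open unit interval; elsewhere one of the two
    factors is at the base point. *)
Definition core x := forall k : 'I_N, k != ord0 -> 4^-1 < x ord0 k < 3 * 4^-1.

Lemma uvpart_disj u v a b x : smapq u -> smapq v -> (core x -> ~ (inI a /\ inI b)) ->
  (forall j, upart u a x j = e0) \/ (forall j, vpart v b x j = e0).
Proof.
move=> [_ _ _ zu] [_ _ _ zv] ab.
have [[Ia Ix]|nu] := pselect (inI a /\ forall l, inI (2 * x ord0 (ix l) - 2^-1)); last first.
  by left => j; apply: zu; exact: cubeout_consv.
right => j; apply: zv; apply: cubeout_consv => -[Ib Iy]; apply: ab => //.
apply: ixyP => // l _; last by have := Iy l; rewrite /inI; lra.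
by have := Ix l; rewrite /inI; lra.
Qed.

Lemma upart_e0 u a x : smapq u -> ~~ inI a -> forall j, upart u a x j = e0.
Proof.
by move=> [_ _ _ zu] /negP Ia j; apply: zu; apply: cubeout_consv => -[].
Qed.

Lemma vpart_e0 v b x : smapq v -> ~~ inI b -> forall j, vpart v b x j = e0.
Proof.
by move=> [_ _ _ zv] /negP Ib j; apply: zv; apply: cubeout_consv => -[].
Qed.

Lemma smap_Wpar (T : topologicalType) (Z : set T) (y : T -> 'rV[R]_N) (a b : T -> R)
    (U W : T -> map) :
  continuous y -> continuous a -> continuous b ->
  (forall t, Z t -> ~~ inI (a t) /\ ~~ inI (b t)) ->
  (forall t, core (y t) -> ~ (inI (a t) /\ inI (b t))) ->
  (forall t, smapq (U t)) -> (forall t, smapq (W t)) ->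
  smap [set p : T * 'rV[R]_q.+2 | cubeout p.2] (fun p => U p.1 p.2) ->
  smap [set p : T * 'rV[R]_q.+2 | cubeout p.2] (fun p => W p.1 p.2) ->
  smap Z (sup (fun t => upart (U t) (a t) (y t)) (fun t => vpart (W t) (b t) (y t))).
Proof.
move=> cy ca cb Zab cab sU sW sU' sW'; apply: smap_sup => [||t].
- apply: (smap_comp sU' (phi := fun t => (t, consv (a t) (fun l => 2 * y t ord0 (ix l) - 2^-1)))).
    by apply: cts_pair; [exact: cts_id|apply: cts_consv => // l; cts].
  by move=> t /Zab[/negP at_ _]; apply: cubeout_consv => -[].
- apply: (smap_comp sW' (phi := fun t => (t, consv (b t) (fun l => 2 * y t ord0 (iy l) - 2^-1)))).
    by apply: cts_pair; [exact: cts_id|apply: cts_consv => // l; cts].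
  by move=> t /Zab[_ /negP at_]; apply: cubeout_consv => -[].
- by apply: uvpart_disj; [exact: sU|exact: sW|exact: cab].
Qed.

(* The two factors are never active simultaneously on the core as long as the
   curve (k1, k2) avoids the open unit square there. *)
Definition admissible (k1 k2 : 'rV[R]_N -> R) :=
  [/\ continuous k1, continuous k2,
      forall x, cubeout x -> k1 x <= 0 /\ k2 x <= 0 &
      forall x, core x -> ~ (inI (k1 x) /\ inI (k2 x))].

Lemma inI_le0 (r : R) : r <= 0 -> ~~ inI r.
Proof. by move=> r0; rewrite /inI ltNge r0. Qed.

Lemma smap_Wgen k1 k2 u v : admissible k1 k2 -> smapq u -> smapq v -> smapN (Wgen k1 k2 u v).
Proof.
move=> [c1 c2 k0 k12] su sv.
apply: (@smap_Wpar _ _ (fun x => x) k1 k2 (fun _ => u) (fun _ => v)) => //.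
- exact: cts_id.
- by move=> x /k0[/inI_le0 ? /inI_le0 ?].
- by apply: (smap_comp su) => //; cts.
- by apply: (smap_comp sv) => //; cts.
Qed.

Lemma hom_Wgen_map k1 k2 u u' v v' : admissible k1 k2 -> hom u u' -> hom v v' ->
  hom (Wgen k1 k2 u v) (Wgen k1 k2 u' v').
Proof.
move=> [c1 c2 k0 k12] [H [sH H0 H1]] [K [sK K0 K1]].
exists (sup (fun p : R * 'rV[R]_N => upart (fun z => H (p.1, z)) (k1 p.2) p.2)
            (fun p : R * 'rV[R]_N => vpart (fun z => K (p.1, z)) (k2 p.2) p.2)); split=> [|x j|x j].
- apply: (@smap_Wpar _ _ snd (fun p => k1 p.2) (fun p => k2 p.2)
    (fun (p : R * 'rV[R]_N) (z : 'rV[R]_q.+2) => H (p.1, z))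
    (fun (p : R * 'rV[R]_N) (z : 'rV[R]_q.+2) => K (p.1, z))); try by cts.
  + by move=> [s x] /= /k0[/inI_le0 ? /inI_le0 ?].
  + by move=> [s x]; exact: k12.
  + by move=> p; apply: (smap_comp sH) => //; exact: cts_slice.
  + by move=> p; apply: (smap_comp sK) => //; exact: cts_slice.
  + by apply: (smap_comp sH) => //; cts.
  + by apply: (smap_comp sK) => //; cts.
- by rewrite /Wgen /sup /upart /vpart H0 K0.
- by rewrite /Wgen /sup /upart /vpart H1 K1.
Qed.

(** The hypothesis puts both curves, at each point of the core, on one common side of the unit
    square. Such a half plane is convex, so the segment between the curves misses the open
    square. *)
Lemma hom_Wgen k1 k2 k1' k2' u v : admissible k1 k2 -> admissible k1' k2' ->
  smapq u -> smapq v ->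
  (forall x, core x -> [\/ k1 x <= 0 /\ k1' x <= 0, 1 <= k1 x /\ 1 <= k1' x,
    k2 x <= 0 /\ k2' x <= 0 | 1 <= k2 x /\ 1 <= k2' x]) ->
  hom (Wgen k1 k2 u v) (Wgen k1' k2' u v).
Proof.
move=> [c1 c2 k0 k12] [c1' c2' k0' k12'] su sv kk.
have ? := @cts_cl R.
pose a (p : R * 'rV[R]_N) := (1 - cl p.1) * k1 p.2 + cl p.1 * k1' p.2.
pose b (p : R * 'rV[R]_N) := (1 - cl p.1) * k2 p.2 + cl p.1 * k2' p.2.
exists (sup (fun p => upart u (a p) p.2) (fun p => vpart v (b p) p.2)); split=> [|x j|x j].
- apply: (@smap_Wpar _ _ snd a b (fun _ => u) (fun _ => v)) => //; try by rewrite ?/a ?/b; cts.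
  + move=> [s x] /= xo; have := k0 x xo; have := k0' x xo; have := cl01 s.
    by move=> ? ? ?; split; apply: inI_le0; rewrite ?/a ?/b /=; nra.
  + move=> [s x] /= /kk; have := cl01 s; rewrite /a /b /inI /=; set r := cl s => r01.
    case=> -[? ?] [/andP[? ?] /andP[? ?]]; nra.
  + by apply: (smap_comp su) => //; cts.
  + by apply: (smap_comp sv) => //; cts.
- by rewrite /Wgen /sup /a /b /= cl_low // subr0 !mul1r !mul0r !addr0.
- by rewrite /Wgen /sup /a /b /= cl_high // subrr !mul1r !mul0r !add0r.
Qed.

(** Cutoff in all coordinates but the first: 1 where they lie in [1/8, 7/8], in particular on the
    core, and 0 on the faces. It contracts the loop [gam] to its base point (-1/2, -1/2) towards the
    boundary. *)
Definition lam x : R := \prod_(k | k != ord0) cl (8 * Num.min (x ord0 k) (1 - x ord0 k)).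

Lemma cts_lam : continuous lam.
Proof. by have ? := @cts_cl R; apply: cts_prod => k; cts. Qed.

Lemma lam01 x : 0 <= lam x <= 1.
Proof.
apply/andP; split; first by apply: prodr_ge0 => k _; case/andP: (cl01 (8 * Num.min (x ord0 k) (1 - x ord0 k))).
by apply: prodr_ile1 => k _; exact: cl01.
Qed.

Lemma lam1 x : (forall k, k != ord0 -> 8^-1 <= x ord0 k <= 7 * 8^-1) -> lam x = 1.
Proof.
move=> xk; apply: big1 => k /xk ?; rewrite cl_high //.
have : 8^-1 <= Num.min (x ord0 k) (1 - x ord0 k).
  by rewrite le_min; apply/andP; split; lra.
by move: (Num.min _ _) => y; lra.
Qed.

Lemma lam0 x k : k != ord0 -> ~~ inI (x ord0 k) -> lam x = 0.
Proof.
move=> k0 xk; rewrite /lam (bigD1 k) //= cl_low ?mul0r //.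
have : Num.min (x ord0 k) (1 - x ord0 k) <= 0; last by move: (Num.min _ _) => y; lra.
by rewrite ge_min; move: xk; rewrite /inI negb_and -!leNgt subr_le0.
Qed.

Definition kap1 x : R := - 2^-1 + lam x * (gam1 (x ord0 ord0) + 2^-1).
Definition kap2 x : R := - 2^-1 + lam x * (gam2 (x ord0 ord0) + 2^-1).

Lemma core_lam x : core x -> lam x = 1.
Proof. by move=> cx; apply: lam1 => k /cx; lra. Qed.

Lemma admissible_kap : admissible kap1 kap2.
Proof.
have ? := @cts_gam1 R; have ? := @cts_gam2 R; have ? := cts_lam.
split; [by rewrite /kap1; cts|by rewrite /kap2; cts| |].
- move=> x [k xk]; rewrite /kap1 /kap2; have [k0|k0] := eqVneq k ord0.
    by move: xk; rewrite k0 => /gam_out[-> ->]; lra.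
  by rewrite (lam0 k0 xk); lra.
- move=> x /core_lam lx; rewrite /kap1 /kap2 lx !mul1r ![- _ + (_ + _)]addrC !addrK.
  exact: gam_square.
Qed.

Definition wmap u v := Wgen kap1 kap2 u v.

Lemma smap_wmap u v : smapq u -> smapq v -> smapN (wmap u v).
Proof. by apply: smap_Wgen; exact: admissible_kap. Qed.

Definition wh (a b : Pi R m q) : Pi R m n := cls (wmap (rep a) (rep b)).

Lemma wh_cls u v : smapq u -> smapq v -> wh (cls u) (cls v) = cls (wmap u v).
Proof.
by move=> su sv; apply: cls_hom; apply: hom_Wgen_map;
  [exact: admissible_kap|exact: rep_cls|exact: rep_cls].
Qed.

Lemma pmap_wh th a b : tmap th -> pmap th (wh a b) = wh (pmap th a) (pmap th b).
Proof.
move=> tth; have [sa sb] := (smap_rep a, smap_rep b).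
have [sa' sb'] : smapq (fun z => th (rep a z)) /\ smapq (fun z => th (rep b z)).
  by split; exact: tth.
rewrite /wh pmap_cls //; last exact: smap_wmap.
rewrite -/(wh _ _) wh_cls //; apply: cls_eq => [|x j].
  by apply: tth; exact: smap_wmap.
apply: (tmap_sup _ tth); apply: uvpart_disj => //.
by case: admissible_kap => _ _ _; apply.
Qed.

Definition swapf (k : 'I_N) : 'I_N :=
  if unlift ord0 k is Some l then
    match fintype.split (l : 'I_(q.+1 + q.+1)) with inl l' => iy l' | inr l' => ix l' end
  else ord0.

Lemma swapf_ix l : swapf (ix l) = iy l.
Proof. by rewrite /swapf /ix liftK (unsplitK (inl l)). Qed.

Lemma swapf_iy l : swapf (iy l) = ix l.
Proof. by rewrite /swapf /iy liftK (unsplitK (inr l)). Qed.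

Lemma swapf0 : swapf ord0 = ord0.
Proof. by rewrite /swapf unlift_none. Qed.

Lemma swapfK : involutive swapf.
Proof. by apply: ixyP => [|l|l]; rewrite ?swapf0 // ?swapf_ix ?swapf_iy // swapf_ix. Qed.

Definition swap_perm : {perm 'I_N} := perm (inv_inj swapfK).

(** Exchanging the two coordinate blocks and reversing the loop parameter exchanges the factors,
    since r -> 1 - r interchanges [gam1] and [gam2]. The sign [s] is quantified before the
    classes. *)
Lemma wh_antisym : exists s : int, forall a b, wh b a = wh a b *~ s.
Proof.
have [e He] := @cls_permx R m n swap_perm.
exists (- (-1) ^+ e) => a b; have [sa sb] := (smap_rep a, smap_rep b).
have sw := smap_wmap sa sb.
rewrite mulrNz -mulNrz /wh -(cls_refl ord0) // -He; last exact: smap_refl.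
apply: cls_eq => [|x j]; first exact: smap_wmap.
rewrite /refl; set y := upd _ _ _.
have y0 : y ord0 ord0 = 1 - x ord0 ord0.
  by rewrite /y updE mxE permE swapf0.
have yx l : y ord0 (ix l) = x ord0 (iy l) by rewrite /y updN // mxE permE swapf_ix.
have yy l : y ord0 (iy l) = x ord0 (ix l) by rewrite /y updN // mxE permE swapf_iy.
have ly : lam y = lam x.
  rewrite /lam [RHS](reindex_inj (@perm_inj _ swap_perm)) /=.
  apply: eq_big => [k|k k0].
    by elim/ixyP: k => [|l|l]; rewrite permE ?swapf0 ?swapf_ix ?swapf_iy.
  by rewrite /y updN // mxE.
have E1 : upart (rep b) (kap1 x) x = vpart (rep b) (kap2 y) y.
  rewrite /upart /vpart /kap1 /kap2 y0 ly gam2B; congr (rep b (consv _ _)).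
  by apply/funext => l; rewrite yy.
have E2 : vpart (rep a) (kap2 x) x = upart (rep a) (kap1 y) y.
  rewrite /upart /vpart /kap1 /kap2 y0 ly gam1B; congr (rep a (consv _ _)).
  by apply/funext => l; rewrite yx.
by rewrite /wmap /Wgen /sup E1 E2 [X in X - _ = _]addrC.
Qed.

End Whitehead.

(** * Additivity of the Whitehead product in the second factor *)

Section WhiteheadBilinear.
Context {R : realType} {m q : nat}.
Local Notation V := 'rV[R]_m.+1.
Local Notation e0 := (sphere_pt : V).
Local Notation n := (q + q.+1)%N.
Local Notation N := (n.+2).
Local Notation smapN := (smap (@cubeout R N)).
Local Notation smapq := (smap (@cubeout R q.+2)).
Implicit Types (u v : 'rV[R]_q.+2 -> nat -> V) (x : 'rV[R]_N).

Local Notation kY := (@iy q ord0).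
Local Notation kv := (lift ord0 ord0 : 'I_q.+2).

(** The direction [kv] of the concatenation is not the first coordinate of the factor, which the
    loop occupies; it is read from the domain coordinate [kY]. *)
Lemma wmap_conc u v1 v2 : smapq u -> smapq v1 -> smapq v2 ->
  hom (wmap u (conc kv v1 v2)) (conc kY (wmap u v1) (wmap u v2)).
Proof.
move=> su sv1 sv2.
have [zu z1 z2] : [/\ forall w, cubeout w -> forall j, u w j = e0,
    forall w, cubeout w -> forall j, v1 w j = e0 &
    forall w, cubeout w -> forall j, v2 w j = e0].
  by case: su sv1 sv2 => _ _ _ ? [_ _ _ ?] [_ _ _ ?].
pose x1 x := upd x kY (2 * x ord0 kY).
pose x2 x := upd x kY (2 * x ord0 kY - 1).
(* Up to time 1/2 the supports of [v1] and [v2] are moved to the places they have on the right;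
   afterwards the cutoff [lam] is exchanged for the sum of the cutoffs of the two halves. Wherever
   [u] and one of the two could both be active, this mixture equals 1 at every time, so the loop
   still avoids the open square. *)
pose Lam (p : R * 'rV[R]_N) :=
  (1 - cl (2 * p.1 - 1)) * lam p.2 + cl (2 * p.1 - 1) * (lam (x1 p.2) + lam (x2 p.2)).
pose c1 p := - 2^-1 + Lam p * (gam1 (p.2 ord0 ord0) + 2^-1).
pose c2 p := - 2^-1 + Lam p * (gam2 (p.2 ord0 ord0) + 2^-1).
pose base (p : R * 'rV[R]_N) := consv (c2 p) (fun l => 2 * p.2 ord0 (iy l) - 2^-1).
pose vv1 (p : R * 'rV[R]_N) := upd (base p) kv (4 * p.2 ord0 kY - 1 + cl (2 * p.1) * 2^-1).
pose vv2 (p : R * 'rV[R]_N) := upd (base p) kv (4 * p.2 ord0 kY - 2 - cl (2 * p.1) * 2^-1).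
have ? := @cts_cl R; have ? := @cts_lam R q; have ? := @cts_gam1 R; have ? := @cts_gam2 R.
have cLam : continuous Lam by rewrite /Lam /x1 /x2; cts.
have cc1 : continuous c1 by rewrite /c1; cts.
have cc2 : continuous c2 by rewrite /c2; cts.
have cbase : continuous base by apply: cts_consv => // l; cts.
have cv1 : continuous vv1 by rewrite /vv1; cts.
have cv2 : continuous vv2 by rewrite /vv2; cts.
have lam_out x : forall k, k != ord0 -> ~~ inI (x ord0 k) ->
    [/\ lam x = 0, lam (x1 x) = 0 & lam (x2 x) = 0].
  move=> k k0 xk; split; first exact: lam0 k0 xk.
    apply: (lam0 k0); rewrite /x1; have [E|E] := eqVneq k kY; last by rewrite updN.
    by rewrite E updE; move: xk; rewrite E /inI; apply: contraNN => /andP[? ?]; lra.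
  apply: (lam0 k0); rewrite /x2; have [E|E] := eqVneq k kY; last by rewrite updN.
  by rewrite E updE; move: xk; rewrite E /inI; apply: contraNN => /andP[? ?]; lra.
have c_out s x : cubeout x -> c1 (s, x) = - 2^-1 /\ c2 (s, x) = - 2^-1.
  move=> [k xk]; rewrite /c1 /c2 /=; have [E|k0] := eqVneq k ord0.
    by move: xk; rewrite E => /gam_out[-> ->]; rewrite ![- _ + 2^-1]addrC subrr !mulr0 !addr0.
  by have [l0 l1 l2] := lam_out x k k0 xk; rewrite /Lam /= l0 l1 l2 !addr0 !mulr0 addr0 !mul0r !addr0.
have half_out : ~~ inI (- 2^-1 : R) by apply/negP => /andP[]; lra.
have base0 p : base p ord0 ord0 = c2 p by rewrite /base consv0.
have out_v1 p : ~ [/\ inI (c2 p), inI (4 * p.2 ord0 kY - 1 + cl (2 * p.1) * 2^-1) &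
     forall l, l != ord0 -> inI (2 * p.2 ord0 (iy l) - 2^-1)] -> cubeout (vv1 p).
  move=> np; have [I0|I0] := boolP (inI (c2 p)); last first.
    by exists ord0; rewrite /vv1 updN // base0.
  have [I1|I1] := boolP (inI (4 * p.2 ord0 kY - 1 + cl (2 * p.1) * 2^-1)); last first.
    by exists kv; rewrite /vv1 updE.
  have [l [l0 lI]] : exists l, l != ord0 /\ ~ inI (2 * p.2 ord0 (iy l) - 2^-1).
    apply: contrapT => nl; apply: np; split=> // l l0.
    by apply: contrapT => lI; apply: nl; exists l.
  exists (lift ord0 l); rewrite /vv1 updN ?(inj_eq (@lift_inj _ _)) // /base consvS.
  exact/negP.
have out_v2 p : ~ [/\ inI (c2 p), inI (4 * p.2 ord0 kY - 2 - cl (2 * p.1) * 2^-1) &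
     forall l, l != ord0 -> inI (2 * p.2 ord0 (iy l) - 2^-1)] -> cubeout (vv2 p).
  move=> np; have [I0|I0] := boolP (inI (c2 p)); last first.
    by exists ord0; rewrite /vv2 updN // base0.
  have [I1|I1] := boolP (inI (4 * p.2 ord0 kY - 2 - cl (2 * p.1) * 2^-1)); last first.
    by exists kv; rewrite /vv2 updE.
  have [l [l0 lI]] : exists l, l != ord0 /\ ~ inI (2 * p.2 ord0 (iy l) - 2^-1).
    apply: contrapT => nl; apply: np; split=> // l l0.
    by apply: contrapT => lI; apply: nl; exists l.
  exists (lift ord0 l); rewrite /vv2 updN ?(inj_eq (@lift_inj _ _)) // /base consvS.
  exact/negP.
have core_x x : (forall l, inI (2 * x ord0 (ix l) - 2^-1)) ->
    (forall l, l != ord0 -> inI (2 * x ord0 (iy l) - 2^-1)) ->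
    forall k, k != ord0 -> k != kY -> 4^-1 < x ord0 k < 3 * 4^-1.
  move=> Ix Iy; apply: ixyP => // l _ lY; first by have := Ix l; rewrite /inI; lra.
  have l0 : l != ord0 by apply: contraNneq lY => ->.
  by have := Iy l l0; rewrite /inI; lra.
have lam_eq1 x y : (forall k, k != ord0 -> k != kY -> 4^-1 < x ord0 k < 3 * 4^-1) ->
    8^-1 <= y <= 7 * 8^-1 -> lam (upd x kY y) = 1.
  move=> xk yI; apply: lam1 => k k0; have [->|kY'] := eqVneq k kY; first by rewrite updE.
  by rewrite updN //; have := xk k k0 kY'; lra.
have kY0 : kY != ord0 by [].
have lam_eq0 x y : ~~ inI y -> lam (upd x kY y) = 0.
  by move=> yI; apply: (lam0 kY0); rewrite updE.
exists (sup (fun p => upart u (c1 p) p.2) (sup (fun p => v1 (vv1 p)) (fun p => v2 (vv2 p)))).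
split=> [|x j|x j].
- apply: smap_sup => [||[s x]].
  + apply: (smap_comp su (phi := fun p : R * 'rV[R]_N =>
      consv (c1 p) (fun l => 2 * p.2 ord0 (ix l) - 2^-1))).
      by apply: cts_consv => // l; cts.
    move=> [s x] xo; apply: cubeout_consv => -[+ _]; rewrite (c_out s x xo).1.
    exact/negP.
  + apply: smap_sup => [||[s x]].
    * apply: (smap_comp sv1) => // -[s x] xo; apply: out_v1 => -[+ _ _].
      by rewrite (c_out s x xo).2; exact/negP.
    * apply: (smap_comp sv2) => // -[s x] xo; apply: out_v2 => -[+ _ _].
      by rewrite (c_out s x xo).2; exact/negP.
    * have := cl01 (2 * s) => s01; have [yk|yk] := lerP (x ord0 kY) 2^-1.
        right=> j; apply: z2; apply: out_v2 => -[_ /andP[+ _] _] /=; lra.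
      left=> j; apply: z1; apply: out_v1 => -[_ /andP[_ +] _] /=; lra.
  + have [[I1 Ix]|nu] := pselect (inI (c1 (s, x)) /\ forall l, inI (2 * x ord0 (ix l) - 2^-1));
      last by left => j; apply: zu; exact: cubeout_consv.
    right=> j; have Lam1 : ~ (inI (c1 (s, x)) /\ inI (c2 (s, x)) /\ Lam (s, x) = 1).
      rewrite /c1 /c2 => -[+ [+ L1]]; rewrite L1 !mul1r ![- _ + (_ + _)]addrC !addrK => ? ?.
      by apply: (@gam_square R (x ord0 ord0)).
    have s01 := cl01 (2 * s).
    have sE : cl (2 * s - 1) = 0 \/ cl (2 * s) = 1.
      by case: (lerP (2 * s) 1) => ?; [left; apply: cl_low|right; apply: cl_high]; lra.
    rewrite /sup z1 ?z2 ?addrK //.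
      apply: out_v2 => -[I2 /= /andP[y0 y1] Iy]; apply: Lam1; split=> //; split=> //.
      have xk := core_x x Ix Iy.
      rewrite /Lam /= -{1}(upd_id x kY) lam_eq1 //; last by lra.
      case: sE => [->|sE]; first by ring.
      rewrite /x1 lam_eq0; last by apply/negP => /andP[]; lra.
      by rewrite /x2 lam_eq1 //; [ring|lra].
    apply: out_v1 => -[I2 /= /andP[y0 y1] Iy]; apply: Lam1; split=> //; split=> //.
    have xk := core_x x Ix Iy.
    rewrite /Lam /= -{1}(upd_id x kY) lam_eq1 //; last by lra.
    case: sE => [->|sE]; first by ring.
    rewrite /x2 lam_eq0; last by apply/negP => /andP[]; lra.
    by rewrite /x1 lam_eq1 //; [ring|lra].
- have cE : c1 (0, x) = kap1 x /\ c2 (0, x) = kap2 x.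
    rewrite /c1 /c2 /Lam /kap1 /kap2 /= cl_low; last by lra.
    by rewrite subr0 mul1r mul0r addr0.
  rewrite /wmap /Wgen /sup /vpart /conc /sup /vv1 /vv2 /base cE.1 cE.2 /= consvS.
  rewrite mulr0 cl_low // mul0r addr0 subr0.
  have -> : 2 * (2 * x ord0 kY - 2^-1) = 4 * x ord0 kY - 1 by field.
  by have -> : 4 * x ord0 kY - 1 - 1 = 4 * x ord0 kY - 2 by ring.
- have cE1 : cl (2 * 1 - 1) = 1 :> R by apply: cl_high; lra.
  have LE : Lam (1, x) = lam (x1 x) + lam (x2 x).
    by rewrite /Lam /= cE1 subrr mul0r add0r mul1r.
  have x1u a : upart u a (x1 x) = upart u a x.
    rewrite /upart /x1; congr (u (consv _ _)); apply/funext => l.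
    by rewrite updN // ix_neq_iy.
  have x2u a : upart u a (x2 x) = upart u a x.
    rewrite /upart /x2; congr (u (consv _ _)); apply/funext => l.
    by rewrite updN // ix_neq_iy.
  have updy v a y : vpart v a (upd x kY y) =
      v (upd (consv a (fun l => 2 * x ord0 (iy l) - 2^-1)) kv (2 * y - 2^-1)).
    rewrite /vpart; congr v; apply/rowP => k.
    case: (unliftP ord0 k) => [l|] ->; last by rewrite updN // !consv0.
    rewrite consvS; have [->|l0] := eqVneq l ord0; first by rewrite !updE.
    rewrite updN; last by apply: contraNneq l0 => /iy_inj ->.
    by rewrite updN ?consvS //; apply: contraNneq l0 => /lift_inj ->.
  have x10 k : k != kY -> x1 x ord0 k = x ord0 k by move=> ?; rewrite /x1 updN.
  have x20 k : k != kY -> x2 x ord0 k = x ord0 k by move=> ?; rewrite /x2 updN.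
  have a1 : cl (2 * 1) = 1 :> R by apply: cl_high; lra.
  rewrite /conc -/(x1 x) -/(x2 x) /wmap /Wgen /sup /kap1 /kap2 x1u x2u !updy x10 // x20 //.
  rewrite /vv1 /vv2 /base /c1 /c2 LE /= a1.
  have -> : 4 * x ord0 kY - 1 + 1 * 2^-1 = 2 * (2 * x ord0 kY) - 2^-1 by field.
  have -> : 4 * x ord0 kY - 2 - 1 * 2^-1 = 2 * (2 * x ord0 kY - 1) - 2^-1 by field.
  have u0 j' : upart u (- 2^-1) x j' = e0 by exact: upart_e0.
  have [yk|yk] := lerP (x ord0 kY) 2^-1.
    have l2 : lam (x2 x) = 0 by apply: lam_eq0; apply/negP => /andP[]; lra.
    rewrite l2 addr0 mul0r addr0 u0.
    have v20 a : v2 (upd a kv (2 * (2 * x ord0 kY - 1) - 2^-1)) j = e0.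
      by apply: z2; apply: cubeout_upd; apply/negP => /andP[]; lra.
    by rewrite !v20; vring.
  have l1 : lam (x1 x) = 0 by apply: lam_eq0; apply/negP => /andP[]; lra.
  rewrite l1 add0r mul0r addr0 u0.
  have v10 a : v1 (upd a kv (2 * (2 * x ord0 kY) - 2^-1)) j = e0.
    by apply: z1; apply: cubeout_upd; apply/negP => /andP[]; lra.
  by rewrite !v10; vring.
Qed.

Implicit Types a b : Pi R m q.

Lemma whDr a b b' : wh a (b + b') = wh a b + wh a b'.
Proof.
have [[sa sb] sb'] := (smap_rep a, smap_rep b, smap_rep b').
rewrite -{1}(cls_rep a) -{1}(cls_rep b) -{1}(cls_rep b') -(cls_conc kv) // wh_cls //;
  last exact: smap_conc.
rewrite /wh -(cls_conc kY); try exact: smap_wmap.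
by apply: cls_hom; exact: wmap_conc.
Qed.

Lemma wh0r a : wh a 0 = 0.
Proof. by apply: (addrI (wh a 0)); rewrite -whDr !addr0. Qed.

Lemma whNr a b : wh a (- b) = - wh a b.
Proof. by apply/eqP; rewrite -addr_eq0 -whDr addNr wh0r. Qed.

Lemma whMzr a b (z : int) : wh a (b *~ z) = wh a b *~ z.
Proof.
have whM k : wh a (b *+ k) = wh a b *+ k.
  by elim: k => [|k IH]; rewrite ?wh0r // !mulrS whDr IH.
by case: z => k; rewrite ?NegzE ?mulrNz ?whNr // -!pmulrn whM.
Qed.

Lemma wh0l b : wh 0 b = 0.
Proof. by have [s ->] := @wh_antisym R m q; rewrite wh0r mul0rz. Qed.

End WhiteheadBilinear.

(** * Fuzzy maps, generators and substitutions *)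

Section Strictify.
Context {R : realType} {p : nat}.
Local Notation V := 'rV[R]_p.+1.
Local Notation e0 := (sphere_pt : V).
Implicit Types v w : V.

Definition nmt v : R := \sum_(l < p) `|v ord0 (lift ord0 l)|.
Definition nm v : R := `|v ord0 ord0| + nmt v.
(** Collapses the half space v0 >= 0 to [e0]; for v0 < 0 and a = -v0 / [nm v] the value has head 1 -
    2a and tail a times that of [v]. On V minus 0 it is homotopic to the identity relative to [e0],
    so a map need only be controlled up to that half space. *)
Definition stc v : V :=
  consv (1 + 2 * (Num.min (v ord0 ord0) 0 / nm v))
        (fun l => - (Num.min (v ord0 ord0) 0 / nm v) * v ord0 (lift ord0 l)).

Lemma e0E : e0 = consv 1 (fun _ => 0).
Proof.
apply/rowP => k; rewrite mxE eqxx /=; case: (unliftP ord0 k) => [l|] ->.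
  by rewrite consvS.
by rewrite consv0 eqxx.
Qed.

Lemma e00 : e0 ord0 ord0 = 1.
Proof. by rewrite e0E consv0. Qed.

Lemma nmt_ge0 v : 0 <= nmt v.
Proof. by apply: sumr_ge0 => l _; exact: normr_ge0. Qed.

Lemma nmt_eq0 v : nmt v = 0 -> forall l, v ord0 (lift ord0 l) = 0.
Proof.
by move=> /psumr_eq0P H l; apply/normr0_eq0; apply: H => // i _; exact: normr_ge0.
Qed.

Lemma row_neq0P v : reflect (v ord0 ord0 <> 0 \/ exists l, v ord0 (lift ord0 l) <> 0) (v != 0).
Proof.
apply: (iffP idP) => [v0|H].
  apply: contrapT => /not_orP[/contrapT a /forallNP b]; move/eqP: v0; apply.
  apply/rowP => k; rewrite mxE; case: (unliftP ord0 k) => [l|] -> //.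
  exact: contrapT (b l).
by apply/eqP => v0; case: H => [|[l]]; rewrite v0 mxE.
Qed.

Lemma nm_gt0 v : v != 0 -> 0 < nm v.
Proof.
move=> v0; rewrite lt_neqAle addr_ge0 ?normr_ge0 ?nmt_ge0 // andbT eq_sym.
apply/eqP => /eqP; rewrite paddr_eq0 ?normr_ge0 ?nmt_ge0 // normr_eq0 => /andP[/eqP a /eqP b].
by case/row_neq0P: v0 => // -[l]; rewrite nmt_eq0.
Qed.

Lemma stc_e0 v : 0 <= v ord0 ord0 -> stc v = e0.
Proof.
move=> v0; rewrite /stc min_r // mul0r oppr0 mulr0 addr0 e0E.
by congr consv; apply/funext => l; rewrite mul0r.
Qed.

Lemma stc_neq0 v : v != 0 -> stc v != 0.
Proof.
move=> v0; have [v1|v1] := lerP 0 (v ord0 ord0).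
  by rewrite stc_e0 //; exact: e0_neq0.
have n0 := nm_gt0 v0; apply/row_neq0P; rewrite /stc consv0 min_l ?(ltW v1) //.
have [nt|nt] := eqVneq (nmt v) 0.
  left; rewrite /nm nt addr0 ltr0_norm // invrN mulrN divff ?lt_eqF //; lra.
right; have [l vl] : exists l, v ord0 (lift ord0 l) <> 0.
  by apply/existsNP => H; move/eqP: nt; apply; apply: big1 => l _; rewrite H normr0.
exists l; rewrite consvS; apply/eqP; rewrite mulf_neq0 ?oppr_eq0 ?mulf_neq0 ?invr_neq0 //.
- by rewrite lt_eqF.
- by rewrite gt_eqF.
- exact/eqP.
Qed.

(** For v0 < 0 a nonzero tail is only multiplied by positive numbers, and without tail both ends lie
    on the negative axis. For v0 >= 0 the other end is [e0], and the head is positive as soon as s >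
    0. *)
Lemma stc_mix_neq0 v s : v != 0 -> 0 <= s <= 1 -> (1 - s) *: v + s *: stc v != 0.
Proof.
move=> v0 s01; have n0 := nm_gt0 v0.
have [v1|v1] := lerP 0 (v ord0 ord0).
  rewrite stc_e0 //; apply/row_neq0P; rewrite !mxE eqxx /= mulr1.
  have [s0|s0] := eqVneq s 0.
    rewrite s0 subr0 mul1r addr0; case/row_neq0P: v0 => [|[l vl]]; [by left|right].
    by exists l; rewrite !mxE mul1r mul0r addr0.
  have s1 : 0 < s by rewrite lt_neqAle eq_sym s0; case/andP: s01.
  by left => E; nra.
pose a := - (Num.min (v ord0 ord0) 0 / nm v).
have a0 : 0 < a.
  by rewrite /a min_l ?(ltW v1) // oppr_gt0 pmulr_llt0 // invr_gt0.
have [nt|nt] := eqVneq (nmt v) 0.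
  apply/row_neq0P; left; rewrite !mxE unlift_none min_l ?(ltW v1) //.
  by rewrite /nm nt addr0 ltr0_norm // invrN mulrN divff ?lt_eqF //; nra.
have [l vl] : exists l, v ord0 (lift ord0 l) <> 0.
  by apply/existsNP => H; move/eqP: nt; apply; apply: big1 => l _; rewrite H normr0.
apply/row_neq0P; right; exists l; rewrite !mxE liftK -/a mulrA -mulrDl.
apply/eqP; rewrite mulf_neq0 //; last exact/eqP.
by rewrite gt_eqF //; nra.
Qed.

Section General.
Context {T : topologicalType}.
Implicit Types F : T -> nat -> V.

Lemma cts_nmt (f : T -> V) : continuous f -> continuous (fun t => nmt (f t)).
Proof. by move=> cf; apply: cts_sum => l _; cts. Qed.

Lemma cts_stc (f : T -> V) : (forall t, f t != 0) -> continuous f ->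
  continuous (fun t => stc (f t)).
Proof.
move=> f0 cf; have cn := cts_nmt cf.
have ci : continuous (fun t => (nm (f t))^-1).
  by apply: ctsV => [t|]; [rewrite gt_eqF ?nm_gt0|rewrite /nm; cts].
by apply: cts_consv => [|l]; cts.
Qed.

(* Being in the base region v0 >= 0 replaces being equal to the base point. *)
Definition fmap (Z : set T) F : Prop :=
  [/\ forall j, continuous (fun t => F t j), forall t j, F t j != 0,
      forall t i j, i != j -> 0 <= F t i ord0 ord0 \/ 0 <= F t j ord0 ord0 &
      forall t, Z t -> forall j, 0 <= F t j ord0 ord0].

Lemma smap_stc Z F : fmap Z F -> smap Z (fun t j => stc (F t j)).
Proof.
move=> [cF nF dF zF]; split=> [j|t j|t i j ij|t Zt j].
- exact: cts_stc.
- exact: stc_neq0.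
- by case: (dF t i j ij) => ?; [left|right]; exact: stc_e0.
- by apply: stc_e0; exact: zF.
Qed.

End General.

Lemma hom_stc n (F : 'rV[R]_n -> nat -> V) : smap (@cubeout R n) F ->
  hom F (fun x j => stc (F x j)).
Proof.
move=> [cF nF dF zF]; have ? := @cts_cl R.
have stc0 : stc e0 = e0 by apply: stc_e0; rewrite e00 ler01.
have mix0 s : (1 - s) *: e0 + s *: e0 = e0 by rewrite -scalerDl subrK scale1r.
exists (fun p j => (1 - cl p.1) *: F p.2 j + cl p.1 *: stc (F p.2 j)).
split=> [|x j|x j].
- split=> [j|[s x] j|[s x] i j ij /=|[s x] /= xo j].
  + have cj := cF j; have cs := cts_stc (fun t => nF t j) cj.
    apply: ctsVD; apply: ctsVZ; try by cts.
      by apply: (cts_comp cj); cts.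
    by apply: (cts_comp cs); cts.
  + by apply: stc_mix_neq0; [exact: nF|exact: cl01].
  + by case: (dF x i j ij) => ->; [left|right]; rewrite stc0 mix0.
  + by rewrite zF // stc0 mix0.
- by rewrite /= cl_low // subr0 scale1r scale0r addr0.
- by rewrite /= cl_high // subrr scale1r scale0r add0r.
Qed.

Definition single (T : Type) j (f : T -> V) : T -> nat -> V :=
  fun t i => if i == j then f t else e0.

Lemma smap_single (T : topologicalType) (Z : set T) j (f : T -> V) : continuous f ->
  (forall t, f t != 0) -> (forall t, Z t -> f t = e0) -> smap Z (single j f).
Proof.
move=> cf nf zf; rewrite /single; split=> [i|t i|t i i' ii|t Zt i].
- by case: (i == j) => //; exact: ctsc.
- by case: (i == j) => //; exact: e0_neq0.
- by case: (eqVneq i j) ii => [->|]; [rewrite eq_sym => /negbTE ->; right|left].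
- by case: (i == j) => //; exact: zf.
Qed.

End Strictify.

(** * The classes iota_j and maps of wedges prescribed on them *)

Section Generators.
Context {R : realType} {q : nat}.
Local Notation p := (q.+2).
Local Notation V := 'rV[R]_p.+1.
Local Notation e0 := (sphere_pt : V).
Local Notation smapp := (smap (@cubeout R p)).
Implicit Types (x : 'rV[R]_p) (z : 'rV[R]_p -> nat -> V).

Definition cent x : 'I_p -> R := fun l => 2 * x ord0 l - 1.
Definition rho x : R := \sum_l `|cent x l|.
(** The head grows from -1 at the centre of the cube to at least 1 on its boundary, and the tail
    points away from the centre. Modulo the half space of nonnegative head this wraps the cube once
    around the sphere. *)
Definition io0 x : V := consv (2 * rho x - 1) (cent x).
Definition iomap j : 'rV[R]_p -> nat -> V := single j (fun x => stc (io0 x)).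
Definition ioc j : Pi R p q := cls (iomap j).

Lemma nmt_io0 x : nmt (io0 x) = rho x.
Proof. by apply: eq_bigr => l _; rewrite consvS. Qed.

Lemma rho_ge0 x : 0 <= rho x.
Proof. by rewrite -nmt_io0 nmt_ge0. Qed.

Lemma cts_rho : continuous rho.
Proof. by rewrite /rho; apply: cts_sum => l _; rewrite /cent; cts. Qed.

Lemma io0_neq0 x : io0 x != 0.
Proof.
apply/row_neq0P; have [r0|r0] := eqVneq (rho x) 0.
  by left; rewrite consv0 r0; lra.
right; apply/existsNP => H; move/eqP: r0; apply; rewrite -nmt_io0.
by apply: big1 => l _; rewrite H normr0.
Qed.

Lemma cent_out x l : ~~ inI (x ord0 l) -> 1 <= `|cent x l|.
Proof.
by rewrite /inI negb_and -!leNgt /cent => /orP[] ?; [rewrite ler0_norm|rewrite ger0_norm]; lra.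
Qed.

Lemma rho_out x : cubeout x -> 1 <= rho x.
Proof.
move=> [l /cent_out xl]; apply: le_trans xl _; rewrite /rho (bigD1 l) //= lerDl.
by apply: sumr_ge0 => i _; exact: normr_ge0.
Qed.

Lemma cts_io0 : continuous io0.
Proof. by have ? := cts_rho; apply: cts_consv => [|l]; rewrite /cent; cts. Qed.

Lemma smap_iomap j : smapp (iomap j).
Proof.
apply: smap_single => [|x|x /rho_out xo].
- by apply: cts_stc; [exact: io0_neq0|exact: cts_io0].
- by apply: stc_neq0; exact: io0_neq0.
- by apply: stc_e0; rewrite consv0; lra.
Qed.

Lemma pr_ioc (J : pred nat) j : pr J (ioc j) = if J j then ioc j else 0.
Proof.
rewrite pr_cls; last exact: smap_iomap.
case: ifP => Jj; rewrite -?cls_base;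
  (apply: cls_eq => [|x i]; first by apply: smap_coll; exact: smap_iomap);
  by rewrite /coll /iomap /single; case: eqP => [->|_]; rewrite ?Jj // if_same.
Qed.

(** Sphere [i] becomes sphere 1, sphere [j] becomes sphere 2, and the others are collapsed: a
    relation between two generators is transported to the pair 1, 2. *)
Definition ren i j (v : nat -> V) : nat -> V :=
  fun k => if k == 1%N then v i else if k == 2%N then v j else e0.

Lemma tmap_ren i j : i != j -> tmap (ren i j).
Proof.
move=> ij T Z K [cK nK dK zK]; rewrite /ren; split=> [k|t k|t k k' kk|t Zt k].
- by case: (k == 1%N) => //; case: (k == 2%N) => //; exact: ctsc.
- by case: ifP => // _; case: ifP => // _; exact: e0_neq0.
- have [k1|k1] := eqVneq k 1%N; have [k1'|k1'] := eqVneq k' 1%N.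
  + by move: kk; rewrite k1 k1' eqxx.
  + by case: ifP => _; [exact: dK|right].
  + by case: ifP => _; [case: (dK t i j ij); [right|left]|left].
  + have [k2|k2] := eqVneq k 2%N; last by left.
    by have [k2'|k2'] := eqVneq k' 2%N; [move: kk; rewrite k2 k2' eqxx|right].
- by case: ifP => _; [exact: zK|case: ifP => _ //; exact: zK].
Qed.

Lemma ren_ioc1 i j : i != j -> pmap (ren i j) (ioc i) = ioc 1.
Proof.
move=> ij; rewrite pmap_cls; [|exact: tmap_ren|exact: smap_iomap].
apply: cls_eq => [|x k]; first by apply: (tmap_ren ij); exact: smap_iomap.
rewrite /ren /iomap /single eqxx; case: ifP => // _; case: ifP => // _.
by rewrite eq_sym (negbTE ij).
Qed.

Lemma ren_ioc2 i j : i != j -> pmap (ren i j) (ioc j) = ioc 2.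
Proof.
move=> ij; rewrite pmap_cls; [|exact: tmap_ren|exact: smap_iomap].
apply: cls_eq => [|x k]; first by apply: (tmap_ren ij); exact: smap_iomap.
rewrite /ren /iomap /single eqxx (negbTE ij).
by case: eqP => [->|_] //.
Qed.

(** Smaller than 1/p, so that among p numbers one is at least [kap] times the sum of their absolute
    values in size ([big_coord]). *)
Definition kap : R := p.+1%:R^-1.

Lemma kap_gt0 : 0 < kap.
Proof. by rewrite invr_gt0 ltr0n. Qed.

(* The extension over the sphere of a map of (I^p, boundary); it is constant
   outside a cone around -e0. *)
Definition zlvl (v : V) : R := v ord0 ord0 + kap * nmt v.
(** On the cone this is -v0, so [zxi] is a central projection, and on the boundary of the cone it
    already lands outside the open cube. The other terms keep the denominator positive elsewhere. *)
Definition zden (v : V) : R :=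
  Num.max (- v ord0 ord0) (kap * nmt v) + Num.max (v ord0 ord0) 0.
Definition zxi (v : V) : 'rV[R]_p := \row_l (2^-1 + v ord0 (lift ord0 l) / zden v).
Definition zbar z (v : V) : nat -> V := if zlvl v <= 0 then z (zxi v) else fun _ => e0.

Lemma zden_gt0 v : v != 0 -> 0 < zden v.
Proof.
move=> v0; rewrite /zden; have k0 := kap_gt0; have n0 := nmt_ge0 v.
have kn : 0 <= kap * nmt v by rewrite mulr_ge0 // ltW.
have [v1|v1|v1] := ltrgtP (v ord0 ord0) 0.
- by rewrite addr0 lt_max; apply/orP; left; lra.
- rewrite (@lt_le_trans _ _ (v ord0 ord0)) // lerDr.
  by rewrite le_max kn orbT.
- rewrite v1 oppr0 addr0 lt_max ltxx /= mulr_gt0 // lt_neqAle n0 andbT eq_sym.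
  by apply/eqP => /nmt_eq0 H; case/row_neq0P: v0 => // -[l]; rewrite H.
Qed.

Lemma big_coord (y : 'I_p -> R) (d : R) : 0 < d -> kap * (\sum_l `|y l|) = d ->
  exists l, d <= `|y l|.
Proof.
move=> d0 yd; apply: contrapT => /forallNP H.
have : \sum_l `|y l| <= \sum_(l < p) d.
  by apply: ler_sum => l _; move/negP: (H l); rewrite -ltNge => /ltW.
rewrite sumr_const card_ord -mulr_natl => yp.
have : kap * (\sum_l `|y l|) <= kap * (p%:R * d).
  by rewrite ler_wpM2l // ltW // kap_gt0.
rewrite yd mulrA -[leLHS]mul1r ler_pM2r // mulrC /kap ler_pdivlMr ?ltr0n // mul1r ler_nat.
by rewrite ltnn.
Qed.

Lemma cts_zbar (T : topologicalType) (Z : set T) z (f : T -> V) : smapp z ->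
  continuous f -> (forall t, f t != 0) -> (forall t, Z t -> 0 < zlvl (f t)) ->
  smap Z (fun t => zbar z (f t)).
Proof.
move=> sz cf nf zf; have cn := cts_nmt cf.
have cl_ : continuous (fun t => zlvl (f t)) by rewrite /zlvl; cts.
have cd : continuous (fun t => (zden (f t))^-1).
  by apply: ctsV => [t|]; [rewrite gt_eqF ?zden_gt0|rewrite /zden; cts].
have cxi : continuous (fun t => zxi (f t)) by apply: cts_mkrow => l; cts.
have : smap set0 (fun t => zbar z (f t)).
  apply: (smap_if cl_) => [||t t0 j].
  - by apply: (smap_comp sz cxi).
  - exact: smap_base.
  - case: sz => _ _ _; apply; rewrite /basemap.
    have k0 := kap_gt0; have n0 := nmt_ge0 (f t).
    have kn : 0 <= kap * nmt (f t) by rewrite mulr_ge0 // ltW.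
    have dE : kap * nmt (f t) = zden (f t).
      move: t0; rewrite /zlvl /zden => t0.
      have -> : f t ord0 ord0 = - (kap * nmt (f t)) by apply/eqP; rewrite -addr_eq0 t0.
      by rewrite opprK maxxx max_r ?addr0 // oppr_le0.
    have [l fl] := big_coord (zden_gt0 (nf t)) dE.
    exists l; rewrite mxE; set y := f t ord0 _ in fl *.
    have d0 := zden_gt0 (nf t); have : 1 <= `|y / zden (f t)|.
      by rewrite normrM normfV (gtr0_norm d0) ler_pdivlMr // mul1r.
    by rewrite ler_normr => /orP[] ?; apply/negP => /andP[? ?]; lra.
move=> [c1 n1 d1 _]; split=> // t Zt j; rewrite /zbar ifF //.
by apply/negbTE; rewrite -ltNge; exact: zf.
Qed.

(** The map of wedges that takes sphere 1 to sphere [i] and sphere 2 by the extension of [z]. It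
    carries iota_1 to iota_i and iota_2 to an arbitrary class. *)
Definition subst i z (v : nat -> V) : nat -> V :=
  sup (fun v => single i (fun v : nat -> V => v 1%N) v) (fun v => zbar z (v 2%N)) v.

Lemma zlvl_e0 : 0 < zlvl e0.
Proof.
by rewrite /zlvl e00 ltr_pwDl ?ltr01 // mulr_ge0 ?nmt_ge0 // ltW // kap_gt0.
Qed.

Lemma zbar_e0 z : zbar z e0 = fun _ => e0.
Proof. by rewrite /zbar ifF //; apply/negbTE; rewrite -ltNge zlvl_e0. Qed.

Lemma tmap_subst i z : smapp z -> tmap (subst i z).
Proof.
move=> sz T Z K [cK nK dK zK].
apply: (@smap_sup _ _ _ _ (single i (fun t => K t 1%N)) (fun t => zbar z (K t 2%N))).
- by apply: smap_single => // t /zK.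
- by apply: cts_zbar => // t /zK ->; exact: zlvl_e0.
- move=> t; case: (dK t 1%N 2%N isT) => E; [left|right] => j.
    by rewrite /single E if_same.
  by rewrite E zbar_e0.
Qed.

Lemma hom_zbar z : smapp z -> hom (fun x => zbar z (stc (io0 x))) z.
Proof.
move=> sz; have c0 := cts_io0; have c1 := cts_stc io0_neq0 c0.
have ? := @cts_cl R; have ? := cts_rho.
have pos x s : cubeout x -> 0 <= s <= 1 ->
    0 < zlvl ((1 - s) *: io0 x + s *: stc (io0 x)).
  move=> /rho_out xo s01; rewrite stc_e0; last by rewrite consv0; lra.
  rewrite /zlvl !mxE unlift_none eqxx /= mulr1 ltr_pwDl //; first by nra.
  by rewrite mulr_ge0 ?nmt_ge0 // ltW // kap_gt0.
apply: (@hom_trans _ _ _ (fun x => zbar z (io0 x))).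
  exists (fun p => zbar z (cl p.1 *: io0 p.2 + (1 - cl p.1) *: stc (io0 p.2))).
  split=> [|x j|x j].
  - apply: cts_zbar => // [|[s x]|[s x] /= xo].
    + apply: ctsVD; apply: ctsVZ; try by cts.
      by apply: (cts_comp c1); cts.
    + rewrite /= -[X in X *: _ + _](subKr 1); apply: stc_mix_neq0; first exact: io0_neq0.
      by have := cl01 s; lra.
    + rewrite -[X in X *: _ + _](subKr 1); apply: pos => //.
      by have := cl01 s; lra.
  - by rewrite /= cl_low // scale0r add0r subr0 scale1r.
  - by rewrite /= cl_high // scale1r subrr scale0r addr0.
(* On the cone [mu] is the factor of the central projection; beyond it the second term keeps it
   finite while the point stays outside the cube. The last homotopy deforms this factor to the
   constant 1/2, which gives back x. *)
pose mu x := (Num.max (1 - 2 * rho x) (kap * rho x))^-1.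
have k0 := kap_gt0.
have mu_gt0 x : 0 < Num.max (1 - 2 * rho x) (kap * rho x).
  have := rho_ge0 x; rewrite le_eqVlt => /orP[/eqP <-|r0].
    by rewrite mulr0 subr0 lt_max ltr01.
  by rewrite lt_max (mulr_gt0 k0 r0) orbT.
have cmu : continuous mu by apply: ctsV => [x|]; [rewrite gt_eqF|cts].
apply: (hom_path (phi := fun p : R * 'rV[R]_p => \row_l
  (2^-1 + ((1 - cl p.1) * mu p.2 + cl p.1 * 2^-1) * (2 * p.2 ord0 l - 1))) sz).
- by apply: cts_mkrow => l; cts.
- move=> s x xo; have ro := rho_out xo; have s01 := cl01 s.
  have muE : mu x = (kap * rho x)^-1.
    by rewrite /mu max_r //; have := mulr_gt0 k0 (lt_le_trans ltr01 ro); lra.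
  have r0 : 0 < kap * rho x by rewrite mulr_gt0 //; lra.
  have [l1 l1P] := big_coord r0 erefl; have [l2 /cent_out l2P] := xo.
  (* One coordinate has to serve both ends of the interpolation: the larger of a coordinate pushed
     out by [mu] and one that is outside already. *)
  pose l := if `|cent x l1| <= `|cent x l2| then l2 else l1.
  have [la lb] : kap * rho x <= `|cent x l| /\ 1 <= `|cent x l|.
    rewrite /l; case: ifP => [le12|/negbT]; first by split=> //; exact: le_trans le12.
    by rewrite -ltNge => /ltW ?; split=> //; exact: le_trans l2P _.
  have mula : 1 <= mu x * `|cent x l|.
    by rewrite muE mulrC ler_pdivlMr // mul1r.
  exists l; rewrite mxE /= -/(cent x l).
  set nu := (1 - cl s) * mu x + cl s * 2^-1.
  have nu0 : 0 <= nu.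
    have m0 : 0 <= mu x by rewrite muE invr_ge0 ltW.
    by rewrite /nu; nra.
  have : 2^-1 <= `|nu * cent x l|.
    by rewrite normrM (ger0_norm nu0) /nu mulrDl -mulrA; nra.
  by rewrite ler_normr => /orP[] ?; apply/negP => /andP[? ?]; lra.
- move=> x j; rewrite /= cl_low // subr0 mul1r mul0r addr0.
  have r0 := rho_ge0 x; rewrite /zbar; case: ifP => [|/negbT].
    rewrite /zlvl consv0 nmt_io0 => lv.
    congr (z _ j); apply/rowP => l; rewrite !mxE liftK mulrC; congr (_ + _ / _).
    rewrite /zden consv0 nmt_io0 [Num.max (2 * rho x - 1) 0]max_r; last by nra.
    by rewrite addr0 opprB.
  rewrite -ltNge /zlvl consv0 nmt_io0 => lv; case: sz => _ _ _; apply.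
  have muE : mu x = (kap * rho x)^-1 by rewrite /mu max_r //; lra.
  have rp : 0 < rho x by rewrite lt_neqAle r0 andbT; apply/eqP => E; move: lv; rewrite -E; lra.
  have kr : 0 < kap * rho x by rewrite mulr_gt0.
  have [l la] := big_coord kr erefl; exists l; rewrite mxE -/(cent x l).
  have : 1 <= `|mu x * cent x l|.
    by rewrite normrM muE gtr0_norm ?invr_gt0 // mulrC ler_pdivlMr // mul1r.
  by rewrite ler_normr => /orP[] ?; apply/negP => /andP[? ?]; lra.
- move=> x j; rewrite /= cl_high // subrr mul0r add0r mul1r.
  by congr (z _ j); apply/rowP => l; rewrite !mxE; field.
Qed.

Lemma subst_ioc1 i z : smapp z -> pmap (subst i z) (ioc 1) = ioc i.
Proof.
move=> sz; rewrite pmap_cls; [|exact: tmap_subst|exact: smap_iomap].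
apply: cls_eq => [|x k]; first by apply: (tmap_subst i sz); exact: smap_iomap.
by rewrite /subst /sup /iomap /single /= zbar_e0 addrK.
Qed.

Lemma subst_ioc2 i z : smapp z -> pmap (subst i z) (ioc 2) = cls z.
Proof.
move=> sz; rewrite pmap_cls; [|exact: tmap_subst|exact: smap_iomap].
rewrite -(cls_hom (hom_zbar sz)); apply: cls_eq => [|x k].
  by apply: (tmap_subst i sz); exact: smap_iomap.
by rewrite /subst /sup /iomap /single /= if_same addrC addKr.
Qed.

End Generators.

(** * The section of the projection to the inverse limit *)

(** The annihilator of [w] is a principal ideal of the integers; N = 0 stands for infinite order. *)
Lemma int_subgroup (G : zmodType) (w : G) :
  exists N : int, forall d : int, (w *~ d = 0) <-> exists b, d = b * N.
Proof.
have [nz|/forallNP z0] := pselect (exists k : nat, w *+ k.+1 = 0); last first.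
  exists 0 => d; split=> [wd|[b ->]]; last by rewrite mulr0 mulr0z.
  exists 0; rewrite mulr0; case: d wd => [[|k]|k] //; first by move/z0.
  by rewrite NegzE mulrNz => /eqP; rewrite oppr_eq0 => /eqP /z0.
have ex : exists k, [pred k : nat | w *+ k.+1 == 0] k by have [k /eqP ?] := nz; exists k.
pose K := ex_minn ex; have [wK Kmin] : w *+ K.+1 = 0 /\ forall k, w *+ k.+1 = 0 -> (K <= k)%N.
  rewrite /K; case: ex_minnP => k /eqP wk kmin; split=> // l wl.
  by apply: kmin; apply/eqP.
have wKz : w *~ (K.+1 : int) = 0 by rewrite -pmulrn.
exists K.+1 => d; split=> [wd|[b ->]]; last first.
  by rewrite mulrC mulrzA wKz mul0rz.
exists (d %/ K.+1)%Z; have := divz_eq d K.+1; set r := (d %% K.+1)%Z => dE.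
have r0 : 0 <= r by apply: modz_ge0.
have rK : r < K.+1 by apply: ltz_pmod.
have wr : w *~ r = 0.
  have -> : r = d - (d %/ K.+1)%Z * K.+1 by rewrite [X in _ = X - _]dE addrAC subrr add0r.
  by rewrite mulrzBr wd sub0r mulrC mulrzA wKz mul0rz oppr0.
rewrite {1}dE; case: r r0 rK wr {dE} => [[|r]|r] // _; first by rewrite addr0.
by rewrite ltz_nat ltnS => rK /Kmin; rewrite leqNgt rK.
Qed.

Lemma subrACA3 (G : zmodType) (a b c a' b' c' : G) :
  (a + a') - (b + b') - (c + c') = (a - b - c) + (a' - b' - c').
Proof. by rewrite !opprD (addrACA a a') (addrACA (a - b)). Qed.

Lemma subrDA (G : zmodType) (a b c : G) : a - b - c = a - (b + c).
Proof. by rewrite opprD addrA. Qed.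

Lemma sum_split (G : zmodType) k (a : G) (F F' : 'I_k -> G) :
  a - \sum_i F i = \sum_i F' i -> a = \sum_i (F i + F' i).
Proof. by rewrite big_split /= => <-; rewrite addrC subrK. Qed.

Section Splitting.
Context {R : realType} {q n : nat}.
Local Notation p := (q.+2).
Local Notation A := (Pi R p q).
Local Notation B := (Pi R p n).
Local Notation io := (@ioc R q).
(** Instantiated by [wh] in the top degree 2p - 1 and by the zero pairing in lower degrees, so that
    one argument covers the whole range. *)
Variable W : A -> A -> B.
Hypothesis WDr : forall a b b', W a (b + b') = W a b + W a b'.
Hypothesis W0l : forall b, W 0 b = 0.
Hypothesis W_pmap : forall th a b, tmap th -> pmap th (W a b) = W (pmap th a) (pmap th b).
Hypothesis W_gen : forall k (a : B), pr (fun j => j <= k)%N a = a ->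
  (forall j, pr (pred1 j) a = 0) ->
  exists c : nat -> nat -> int,
    a = \sum_(i < k.+1) \sum_(j < k.+1 | (i < j)%N) W (io i) (io j) *~ c i j.

Lemma W0r a : W a 0 = 0.
Proof. by apply: (addrI (W a 0)); rewrite -WDr !addr0. Qed.

Lemma WNr a b : W a (- b) = - W a b.
Proof. by apply/eqP; rewrite -addr_eq0 -WDr addNr W0r. Qed.

Lemma WMzr a b (z : int) : W a (b *~ z) = W a b *~ z.
Proof.
have WM k : W a (b *+ k) = W a b *+ k.
  by elim: k => [|k IH]; rewrite ?W0r // !mulrS WDr IH.
by case: z => k; rewrite ?NegzE ?mulrNz ?WNr // -!pmulrn WM.
Qed.

Lemma W_sumr a (I : Type) (r : seq I) (P : pred I) (F : I -> A) :
  W a (\sum_(i <- r | P i) F i) = \sum_(i <- r | P i) W a (F i).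
Proof. by elim/big_rec2: _ => [|i x y _ <-]; rewrite ?W0r // WDr. Qed.

Lemma pr_W J a b : pr J (W a b) = W (pr J a) (pr J b).
Proof. by apply: W_pmap; exact: tmap_coll. Qed.

Lemma pr_Wio J i j : pr J (W (io i) (io j)) = if J i && J j then W (io i) (io j) else 0.
Proof.
rewrite pr_W !pr_ioc; case: (J i) => /=; last by rewrite W0l.
by case: (J j); rewrite ?W0r.
Qed.

(** The cross effect of [a] in the spheres [i] and [j]. *)
Definition cross i j (a : B) : B := pr (pred2 i j) a - pr (pred1 i) a - pr (pred1 j) a.

Lemma pr_span k (c : nat -> nat -> int) i j : (i < j <= k)%N ->
  pr (pred2 i j) (\sum_(i < k.+1) \sum_(j < k.+1 | (i < j)%N) W (io i) (io j) *~ c i j)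
  = W (io i) (io j) *~ c i j.
Proof.
move=> ijk; have ik : (i < k.+1)%N by lia.
have jk : (j < k.+1)%N by lia.
rewrite pr_sum (bigD1 (Ordinal ik)) //= [X in _ + X]big1 ?addr0; last first.
  move=> i' ii; rewrite pr_sum; apply: big1 => j' ij'; rewrite prMz pr_Wio.
  rewrite -val_eqE /= in ii; rewrite ifF ?mul0rz //=; apply/negbTE/negP.
  by move=> /andP[/orP[/eqP|/eqP] e1 /orP[/eqP|/eqP] e2]; lia.
rewrite pr_sum (bigD1 (Ordinal jk)) /=; last by lia.
rewrite [X in _ + X]big1 ?addr0; last first.
  move=> j' /andP[ij' jj]; rewrite prMz pr_Wio.
  rewrite -val_eqE /= in jj; rewrite ifF ?mul0rz //=; apply/negbTE/negP.
  by move=> /andP[_ /orP[/eqP|/eqP] e2]; lia.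
by rewrite prMz pr_Wio /= !eqxx orbT.
Qed.

Lemma pr1_cross l i j a : i != j -> pr (pred1 l) (cross i j a) = 0.
Proof.
move=> ij; rewrite /cross !(prD, prN) !pr_pr.
have [li|li] := eqVneq l i.
  rewrite (@eq_pr _ _ _ _ (pred1 l)); last by move=> x /=; rewrite li; case: eqP.
  rewrite [X in _ - X - _](@eq_pr _ _ _ _ (pred1 l)); last first.
    by move=> x /=; rewrite li andbb.
  rewrite [X in _ - X](@pr_F _ _ _ _); first by rewrite subrr subr0.
  by move=> x; rewrite li /=; case: eqP => // ->; rewrite ij.
rewrite [X in _ - X - _](@pr_F _ _ _ _); last first.
  by move=> x /=; case: eqP => // ->; rewrite li.
have [lj|lj] := eqVneq l j.
  rewrite (@eq_pr _ _ _ _ (pred1 l)); last by move=> x /=; rewrite lj; case: eqP; rewrite ?orbT.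
  rewrite [X in _ - X](@eq_pr _ _ _ _ (pred1 l)); last by move=> x /=; rewrite lj andbb.
  by rewrite subr0 subrr.
rewrite !(@pr_F _ _ _ _) ?subrr //; move=> x /=; case: eqP => // ->.
  by rewrite lj.
by rewrite (negbTE li) (negbTE lj).
Qed.

Lemma pr_sub (J P : pred nat) (a : B) : (forall l, P l -> J l) -> pr J (pr P a) = pr P a.
Proof.
by move=> PJ; rewrite pr_pr; apply: eq_pr => l /=; case E: (P l); rewrite ?andbF // PJ.
Qed.

Lemma pr_subr (J P : pred nat) (a : B) : (forall l, P l -> J l) -> pr P (pr J a) = pr P a.
Proof.
by move=> PJ; rewrite pr_pr; apply: eq_pr => l /=; case E: (P l) => //; rewrite PJ.
Qed.

Lemma pr_cross (J : pred nat) i j a : J i -> J j -> pr J (cross i j a) = cross i j a.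
Proof.
by move=> Ji Jj; rewrite /cross !(prD, prN) !pr_sub // => l /= => [/eqP ->|/eqP ->|/orP[]/eqP ->].
Qed.

Lemma cross_pr (J : pred nat) i j a : J i -> J j -> cross i j (pr J a) = cross i j a.
Proof.
by move=> Ji Jj; rewrite /cross !pr_subr // => l /= => [/eqP ->|/eqP ->|/orP[]/eqP ->].
Qed.

Lemma crossD i j a b : cross i j (a + b) = cross i j a + cross i j b.
Proof. by rewrite /cross !prD; exact: subrACA3. Qed.

Lemma cross_W i j a : (i < j)%N -> exists c : int, cross i j a = W (io i) (io j) *~ c.
Proof.
move=> ij; have [||c E] := @W_gen j (cross i j a).
- by apply: pr_cross => //; exact: ltnW.
- by move=> l; apply: pr1_cross; rewrite neq_ltn ij.
exists (c i j); rewrite -(@pr_span j) ?ij ?leqnn // -E.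
by rewrite pr_cross //= eqxx ?orbT.
Qed.

(** An arbitrary choice, determined only modulo the order of [W (io i) (io j)] and hence not
    additive in [a]. *)
Definition coef i j (a : B) : int :=
  if pselect (i < j)%N is left ij then sval (cid (cross_W a ij)) else 0.

Lemma coefP i j a : (i < j)%N -> cross i j a = W (io i) (io j) *~ coef i j a.
Proof. by move=> ij; rewrite /coef; case: pselect => // ij'; case: cid. Qed.

Lemma decomposition k a : pr (fun j => j <= k)%N a = a ->
  a = \sum_(i < k.+1) (pr (pred1 (i : nat)) a + \sum_(j < k.+1 | (i < j)%N) cross i j a).
Proof.
move=> ak; pose s := \sum_(i < k.+1) pr (pred1 (i : nat)) a.
have prs (l : nat) : (l <= k)%N -> pr (pred1 l) s = pr (pred1 l) a.
  move=> lk; rewrite /s pr_sum (bigD1 (Ordinal (lk : (l < k.+1)%N))) //= big1 ?addr0.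
    by rewrite pr_pr; apply: eq_pr => x /=; rewrite andbb.
  move=> i; rewrite -val_eqE /= => il; rewrite pr_pr; apply: pr_F => x /=.
  by case: eqP => // ->; rewrite eq_sym (negbTE il).
have [||c E] := @W_gen k (a - s).
- rewrite prD prN ak; congr (_ - _); rewrite /s pr_sum; apply: eq_bigr => i _.
  rewrite pr_pr; apply: eq_pr => x /=; case: eqP => [->|]; rewrite ?andbF //.
  by rewrite -ltnS ltn_ord.
- move=> l; rewrite prD prN; have [lk|lk] := leqP l k; first by rewrite prs // subrr.
  rewrite -ak pr_pr pr_F; last by move=> x /=; case: eqP => // ->; rewrite leqNgt lk.
  rewrite /s pr_sum big1 ?subr0 // => i _; rewrite pr_pr pr_F // => x /=.
  by case: eqP => // ->; apply/eqP; have := ltn_ord i; lia.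
apply: sum_split; rewrite -/s E; apply: eq_bigr => i _; apply: eq_bigr => j ij.
have ijk : (i < j <= k)%N by rewrite ij -ltnS ltn_ord.
have sE : pr (pred2 (i : nat) j) s = pr (pred1 (i : nat)) a + pr (pred1 (j : nat)) a; last first.
  by rewrite -(pr_span c ijk) -E prD prN sE -subrDA.
rewrite /s pr_sum.
have ji : j != i by rewrite -val_eqE /= neq_ltn ij orbT.
rewrite (bigD1 i) //= (bigD1 j) //= big1 ?addr0.
  by rewrite !pr_sub // => x /= /eqP ->; rewrite eqxx ?orbT.
move=> l /andP[]; rewrite -!val_eqE /= => li lj; rewrite pr_pr pr_F // => x /=.
by case: (x =P l :> nat) => [->|]; rewrite ?andbF // (negbTE li) (negbTE lj).
Qed.

Definition tailsum i (d : nat -> int) : A :=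
  csum (fun j => if (i < j)%N then io j *~ d j else 0).

Lemma tailsumD i d d' : tailsum i (fun j => d j + d' j) = tailsum i d + tailsum i d'.
Proof.
rewrite /tailsum -csumD; congr csum; apply/funext => j.
by case: ifP => _; rewrite ?addr0 // mulrzDr.
Qed.

Lemma tailsumMz i d z : tailsum i (fun j => d j * z) = tailsum i d *~ z.
Proof.
rewrite /tailsum -csumMz; congr csum; apply/funext => j.
by case: ifP => _; rewrite ?mul0rz // mulrzA.
Qed.

(** [W] is only finitely additive, so the vanishing of each term does not suffice. Renaming spheres
    shows that every [d j] annihilates W(iota_1, iota_2) and is a multiple of [N]; the factor [N]
    leaves the infinite sum, and substitution kills the result. *)
Lemma W_tailsum0 i d : (forall j, (i < j)%N -> W (io i) (io j) *~ d j = 0) ->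
  W (io i) (tailsum i d) = 0.
Proof.
move=> d0; have [N NP] := int_subgroup (W (io 1) (io 2)).
have /choice[b bP] : forall j, exists b, (i < j)%N -> d j = b * N.
  move=> j; case: (ltnP i j) => ij; last by exists 0.
  have [] := NP (d j) => + _; case; last by move=> b ->; exists b.
  have ni : i != j by rewrite neq_ltn ij.
  by rewrite -(ren_ioc1 ni) -(ren_ioc2 ni) -W_pmap ?pmapMz -?pmapMz ?d0 ?pmap0 //;
    exact: tmap_ren.
have -> : tailsum i d = tailsum i b *~ N.
  rewrite -tailsumMz /tailsum; congr csum; apply/funext => j.
  by case: ifP => // /bP ->.
set z := rep (tailsum i b); have sz : smap (@cubeout R p) z by exact: smap_rep.
rewrite WMzr -(cls_rep (tailsum i b)) -/z -(subst_ioc2 i sz) -(subst_ioc1 i sz).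
rewrite -W_pmap -?pmapMz; try exact: tmap_subst.
rewrite (_ : W (io 1) (io 2) *~ N = 0) ?pmap0 //; first exact: tmap_subst.
by apply/NP; exists 1; rewrite mul1r.
Qed.

(** Spheres are numbered from 1, whence the value at 0. The coefficient of a pair i < j is read from
    [g j], the first member of the family that contains both spheres. *)
Definition term (g : nat -> B) i : B :=
  if i == 0%N then 0
  else pr (pred1 i) (g i) + W (io i) (tailsum i (fun j => coef i j (g j))).

Definition section (g : nat -> B) : B := csum (term g).

Lemma sectionD g g' : section (fun k => g k + g' k) = section g + section g'.
Proof.
rewrite /section -csumD; congr csum; apply/funext => i; rewrite /term.
case: (i == 0%N); first exact/esym/addr0.
(* The failure of [coef] to be additive; [W_tailsum0] makes it invisible. *)
pose c j := coef i j (g j + g' j) - (coef i j (g j) + coef i j (g' j)).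
have E : tailsum i (fun j => coef i j (g j + g' j)) = tailsum i c +
    (tailsum i (fun j => coef i j (g j)) + tailsum i (fun j => coef i j (g' j))).
  by rewrite -!tailsumD; congr tailsum; apply/funext => j; rewrite /c subrK.
have W0c : W (io i) (tailsum i c) = 0.
  by apply: W_tailsum0 => j ij; rewrite /c mulrzBr mulrzDr -!coefP // crossD subrr.
rewrite E prD WDr (WDr _ (tailsum i _)) W0c add0r; exact: addrACA.
Qed.

Local Notation Xp k := (fun j : nat => (0 < j <= k)%N).

(** Truncation to [k] spheres makes all sums finite and, since every [g j] with j <= k is a
    projection of [g k], produces the terms of [decomposition] for [g k]. *)
Lemma pr_section g k : (0 < k)%N -> (forall k, (0 < k)%N -> pr (Xp k) (g k) = g k) ->
  (forall k, (0 < k)%N -> pr (Xp k) (g k.+1) = g k) ->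
  pr (Xp k) (section g) = g k.
Proof.
move=> k0 gX gS.
have gle l : (0 < l <= k)%N -> pr (Xp l) (g k) = g l.
  move=> /andP[l0]; elim: k k0 => [|k' IH] _; first by rewrite leqn0 => /eqP l'; move: l0; rewrite l'.
  rewrite leq_eqVlt => /orP[/eqP ->|lk]; first exact: gX.
  have k'0 : (0 < k')%N by lia.
  rewrite -(IH k'0) // -(gS k' k'0) pr_pr; apply: eq_pr => x.
  by apply/idP/idP; lia.
have gk : pr (fun j => j <= k)%N (g k) = g k.
  by rewrite -{1}(gX k k0) pr_pr -[RHS]gX //; apply: eq_pr => x; apply/idP/idP; lia.
rewrite (@eq_pr _ _ _ _ (fun j => (0 < j <= k)%N && (j <= k)%N)); last first.
  by move=> x; apply/idP/idP; lia.
rewrite -pr_pr /section pr_csum pr_sum [RHS](decomposition gk).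
apply: eq_bigr => i _; have ik : (i <= k)%N by rewrite -ltnS ltn_ord.
rewrite pr_pr /term; case: (eqVneq (i : nat) 0%N) => [i0|i0].
  rewrite pr0 -(gX k k0) pr_pr pr_F; last by move=> x /=; rewrite i0; case: eqP => // ->.
  rewrite add0r big1 // => j ij; have jk := ltn_ord j.
  rewrite /cross !pr_pr [X in _ - X - _]pr_F; last by move=> x /=; rewrite i0; case: eqP => // ->.
  rewrite subr0; apply/eqP; rewrite subr_eq0; apply/eqP; apply: eq_pr => x /=.
  by rewrite i0; case: (x =P 0%N) => [->|]; rewrite /= ?andbF.
have {}i0 : (0 < i)%N by rewrite lt0n.
rewrite prD pr_pr pr_W; apply: f_equal2.
  have := gle i; rewrite i0 ik => <- //; rewrite pr_pr; apply: eq_pr => x /=.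
  by case: eqP => [->|]; rewrite ?andbF // i0 ik leqnn.
rewrite pr_ioc i0 ik leqnn /=.
have -> : pr (fun j => (0 < j <= k)%N && (i <= j <= k)%N) (tailsum i (fun j => coef i j (g j))) =
    \sum_(j < k.+1 | (i < j)%N) io j *~ coef i j (g j).
  rewrite (@eq_pr _ _ _ _ (fun j => (i <= j)%N && (j <= k)%N)); last first.
    by move=> x; apply/idP/idP; lia.
  rewrite -pr_pr /tailsum pr_csum pr_sum [RHS]big_mkcond; apply: eq_bigr => j _.
  case: ifP => ij; last by rewrite !pr0.
  by rewrite pr_pr prMz pr_ioc ifT //; have := ltn_ord j; lia.
rewrite W_sumr; apply: eq_bigr => j ij; have jk := ltn_ord j.
rewrite WMzr -coefP //; have <- : pr (Xp j) (g k) = g j by apply: gle; lia.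
by apply: cross_pr; lia.
Qed.

End Splitting.

(** * The difference of two maps that differ only inside a box *)

Section Difference.
Context {R : realType} {m n : nat}.
Local Notation V := 'rV[R]_m.+1.
Local Notation e0 := (sphere_pt : V).
Local Notation N := (n.+2).
Local Notation smapN := (smap (@cubeout R N)).
Implicit Types (x : 'rV[R]_N) (k : 'I_N).

Lemma smap_diff (T : topologicalType) (Z : set T) (P Q : T -> nat -> V) :
  smap Z P -> smap Z Q ->
  (forall t, (forall j, Q t j = e0) \/ (forall j, P t j = Q t j)) ->
  smap Z (fun t j => P t j - Q t j + e0).
Proof.
move=> [cP nP dP zP] [cQ nQ dQ zQ] PQ.
have E t : (forall j, P t j - Q t j + e0 = P t j) \/ (forall j, P t j - Q t j + e0 = e0).
  case: (PQ t) => H; [left|right] => j; first by rewrite H subrK.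
  by rewrite H subrr add0r.
split=> [j|t j|t i j ij|t Zt j].
- apply: ctsVD; last exact: ctsc.
  apply: ctsVD => // t; apply: continuousN; exact: cQ.
- by case: (E t) => ->; [exact: nP|exact: e0_neq0].
- by case: (E t) => H; rewrite !H; [exact: dP|left].
- by rewrite zP // zQ // subrr add0r.
Qed.

(** In direction [k] the box reaches from [q0] to [q1], over the product of the intervals from [lo]
    to [hi] in the other directions; [g] and [g'] differ only inside it, where [th] is 1. On its
    bottom face, and below it over the corner [lo], the map [g] is at the base point. *)
Variables (g g' : 'rV[R]_N -> nat -> V) (k : 'I_N) (lo hi : 'I_N -> R) (q0 q1 : R)
  (th : 'rV[R]_N -> R).
Hypothesis sg : smapN g.
Hypothesis sg' : smapN g'.
Hypothesis q01 : [/\ 0 <= q0, q0 < q1 & q1 <= 1].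
Hypothesis lohi : forall l, l != k -> [/\ 0 <= lo l, lo l < hi l & hi l < 1].
Hypothesis cth : continuous th.
Hypothesis th01 : forall x, 0 <= th x <= 1.
Hypothesis th_upd : forall x r, th (upd x k r) = th x.
Hypothesis th_out : forall x l, l != k -> ~~ (lo l < x ord0 l < hi l) -> th x = 0.
Hypothesis gg' : forall x j, [\/ x ord0 k <= q0, q1 <= x ord0 k | th x < 1] -> g x j = g' x j.
Hypothesis g_bot : forall x j, x ord0 k = q0 ->
  (forall l, l != k -> lo l <= x ord0 l <= hi l) -> g x j = e0.
Hypothesis g_corner : forall x j, x ord0 k <= q0 ->
  (forall l, l != k -> x ord0 l = lo l) -> g x j = e0.

Let tent (t : R) : R := 1 - `|2 * t - 1|.
Let lev x : R := q0 + (q1 - q0) * th x.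
Let pick (t : R) : 'rV[R]_N -> nat -> V := if 2 * t - 1 <= 0 then g else g'.

Let tent_out t : ~~ inI t -> tent t <= 0.
Proof.
rewrite /inI /tent negb_and -!leNgt => /orP[] t0.
  by rewrite ler0_norm; lra.
by rewrite ger0_norm; lra.
Qed.

Let tent_le1 t : tent t <= 1.
Proof. by rewrite /tent; have := normr_ge0 (2 * t - 1); lra. Qed.

Let lev_bounds x : q0 <= lev x <= q1.
Proof. by case: q01 => a b c; rewrite /lev; have := th01 x; nra. Qed.

Let cubeout_tent x (y : 'rV[R]_N) r : cubeout x -> (forall l, l != k -> ~~ inI (x ord0 l) -> ~~ inI (y ord0 l)) ->
  r <= tent (x ord0 k) -> cubeout (upd y k r).
Proof.
move=> [l xl] xy rt; have [E|lk] := eqVneq l k.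
  exists k; rewrite updE; apply: inI_le0; apply: le_trans rt _.
  by apply: tent_out; rewrite -E.
by exists l; rewrite updN //; exact: xy.
Qed.

Let smap_pick (T : topologicalType) (Z : set T) (t : T -> R) (y : T -> 'rV[R]_N) :
  continuous t -> continuous y -> (forall s, Z s -> cubeout (y s)) ->
  (forall s, 2 * t s - 1 = 0 -> [\/ y s ord0 k <= q0, q1 <= y s ord0 k | th (y s) < 1]) ->
  smap Z (fun s => pick (t s) (y s)).
Proof.
move=> ct cy Zy ty; have cc : continuous (fun s => 2 * t s - 1) by cts.
have -> : (fun s => pick (t s) (y s)) =
    (fun s => if 2 * t s - 1 <= 0 then g (y s) else g' (y s)).
  by apply/funext => s; rewrite /pick; case: ifP.
apply: (smap_if cc).
- by apply: (smap_comp sg).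
- by apply: (smap_comp sg').
- by move=> s /ty + j; exact: gg'.
Qed.

(** [P] goes up along [g] and returns along [g'], turning at height [lev] instead of the top; above
    that height the two maps agree. [low] is the same excursion stopped at the bottom of the box,
    and [mid] is what [P] adds to it. *)
Let P x := pick (x ord0 k) (upd x k (Num.min (tent (x ord0 k)) (lev x))).
Let low x := g (upd x k (Num.min (tent (x ord0 k)) q0)).
Let mid x j := P x j - low x j + e0.

Let sP : smapN P.
Proof.
apply: smap_pick; rewrite /tent /lev; try by cts.
- move=> x xo; apply: (cubeout_tent xo) => //; by rewrite ge_min lexx.
- move=> x x0; rewrite x0 normr0 subr0 th_upd updE.
  have := lev_bounds x; rewrite /lev => /andP[a b]; case: q01 => c d e.
  rewrite min_r; last by apply: le_trans b e.
  have [t1|t1] := ltP (th x) 1; first by constructor 3.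
  by constructor 2; have := th01 x; nra.
Qed.

Let slow : smapN low.
Proof.
apply: (smap_comp sg); first by rewrite /tent; cts.
by move=> x xo; apply: (cubeout_tent xo) => //; rewrite ge_min lexx.
Qed.

Let cases x : [\/ tent (x ord0 k) <= q0, th x = 0 | q0 < tent (x ord0 k) /\ 0 < th x].
Proof.
have [a|a] := leP (tent (x ord0 k)) q0; first by constructor 1.
have [b|b] := eqVneq (th x) 0; first by constructor 2.
by constructor 3; split=> //; rewrite lt_neqAle eq_sym b; case/andP: (th01 x).
Qed.

Let inbox x : 0 < th x -> forall l, l != k -> lo l < x ord0 l < hi l.
Proof.
by move=> t0 l lk; apply: contrapT => /negP /(th_out lk) E; rewrite E ltxx in t0.
Qed.

Let low_e0 x j : q0 < tent (x ord0 k) -> 0 < th x -> low x j = e0.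
Proof.
move=> a /inbox xb; apply: g_bot => [|l lk].
  by rewrite updE min_r // ltW.
by rewrite updN //; have := xb l lk; lra.
Qed.

Let P_low x j : tent (x ord0 k) <= q0 \/ th x = 0 -> P x j = low x j.
Proof.
move=> H; have [/andP[a b] [c d e]] := (lev_bounds x, q01).
have E : Num.min (tent (x ord0 k)) (lev x) = Num.min (tent (x ord0 k)) q0.
  case: H => H; last by rewrite /lev H mulr0 addr0.
  by rewrite !min_l // (le_trans H).
rewrite /P /low E /pick; case: ifP => // _; rewrite gg' //.
by constructor 1; rewrite updE ge_min lexx orbT.
Qed.

Let low_or x : (forall j, low x j = e0) \/ (forall j, P x j = low x j).
Proof.
case: (cases x) => [a|a|[a b]]; [right|right|left] => j.
- by apply: P_low; left.
- by apply: P_low; right.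
- exact: low_e0.
Qed.

Let smid : smapN mid.
Proof. exact: smap_diff low_or. Qed.

Let mid_e0 x j : tent (x ord0 k) <= q0 \/ th x = 0 -> mid x j = e0.
Proof. by move=> H; rewrite /mid P_low // subrr add0r. Qed.

Let mid_P x j : q0 < tent (x ord0 k) -> 0 < th x -> mid x j = P x j.
Proof. by move=> a b; rewrite /mid low_e0 // subrK. Qed.

Let hom_P : hom (conc k g (refl k g')) P.
Proof.
exists (fun p : R * 'rV[R]_N => pick (p.2 ord0 k) (upd p.2 k (Num.min (tent (p.2 ord0 k))
  ((1 - cl p.1) + cl p.1 * lev p.2)))).
have ? := @cts_cl R; split=> [|x j|x j].
- apply: smap_pick; rewrite /tent /lev; try by cts.
  + move=> [s x] xo; apply: (cubeout_tent (x := x)) => //; by rewrite ge_min lexx.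
  + move=> [s x] /= x0; rewrite x0 normr0 subr0 th_upd updE.
    have := lev_bounds x; rewrite /lev => /andP[a b]; case: q01 => c d e.
    have := cl01 s => s01; rewrite min_r; last by nra.
    have [t1|t1] := ltP (th x) 1; first by constructor 3.
    by constructor 2; have := th01 x; nra.
- rewrite /= cl_low // subr0 mul0r addr0 min_l // /pick /conc /sup /refl updE upd_upd.
  have [xk|xk] := lerP (2 * x ord0 k - 1) 0.
    rewrite (smap_upd _ _ _ sg'); last by out01.
    by rewrite addrK /tent ler0_norm //; congr (g (upd x k _) j); ring.
  rewrite (smap_upd _ _ _ sg); last by out01.
  by rewrite addrC addKr /tent gtr0_norm.
- by rewrite /= cl_high // subrr add0r mul1r.
Qed.

(** Identity below [lo l], constant [lo l] on the interval of the box, and [hi l, 1] stretched onto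
    [lo l, 1]; this is where hi l < 1 enters. *)
Let rho l (r : R) : R :=
  Num.max (Num.min r (lo l)) ((r - hi l) / (1 - hi l) * (1 - lo l) + lo l).

Let rhoP l r : l != k -> [/\ ~~ inI r -> ~~ inI (rho l r),
  lo l <= r <= hi l -> rho l r = lo l & ~~ inI r -> forall s, 0 <= s <= 1 -> ~~ inI ((1 - s) * r + s * rho l r)].
Proof.
move=> lk; have [a b c] := lohi lk; have c0 : 0 < 1 - hi l by lra.
have slope y : y <= 0 -> y / (1 - hi l) * (1 - lo l) <= y.
  by move=> y0; rewrite mulrAC ler_pdivrMr //; nra.
have slope1 y : 0 <= y -> 0 <= y / (1 - hi l) * (1 - lo l).
  by move=> y0; rewrite mulr_ge0 ?divr_ge0 //; lra.
have E0 : r <= 0 -> rho l r = r.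
  move=> r0; rewrite /rho (min_l (_ : r <= lo l)); last by lra.
  by rewrite max_l //; have := slope (r - hi l); lra.
have E1 : 1 <= r -> 1 <= rho l r.
  move=> r1; rewrite /rho le_max; apply/orP; right.
  have : 1 - lo l <= (r - hi l) / (1 - hi l) * (1 - lo l); last by lra.
  by rewrite -[leLHS]mul1r ler_wpM2r ?ler_pdivlMr //; lra.
have E2 : lo l <= r <= hi l -> rho l r = lo l.
  move=> r0; rewrite /rho (min_r (_ : lo l <= r)); last by lra.
  by rewrite max_l //; have := slope (r - hi l); lra.
split=> //.
- rewrite /inI !negb_and -!leNgt => /orP[r0|r1]; apply/orP; [left|right].
    by rewrite E0.
  exact: E1.
- rewrite /inI negb_and -!leNgt => rI s s01; rewrite negb_and -!leNgt; apply/orP.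
  case/orP: rI => r0; [left|right]; first by rewrite E0 //; nra.
  by have := E1 r0; nra.
Qed.

Let crho l : l != k -> continuous (rho l).
Proof. by move=> lk; rewrite /rho; cts. Qed.

Let rhov (s : R) x : 'rV[R]_N :=
  \row_l (if l == k then x ord0 l else (1 - s) * x ord0 l + s * rho l (x ord0 l)).

Let rhov_out s x : 0 <= s <= 1 -> forall l, l != k -> ~~ inI (x ord0 l) -> ~~ inI (rhov s x ord0 l).
Proof.
by move=> s01 l lk xl; rewrite mxE (negbTE lk); have [_ _] := rhoP (x ord0 l) lk; apply.
Qed.

(** Where [mid] is active, [low] sits on the bottom face of the box. It is slid along that face to
    the corner [lo] and then down to height 0. All the while [g_bot] or [g_corner] keeps it at the
    base point there, so it never meets [mid], and at height 0 it is constant everywhere. *)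
Let hom_mid : hom P mid.
Proof.
have ? := @cts_cl R; have [h0 h1 h2] := q01.
pose a (s : R) := cl (2 * s); pose b (s : R) := cl (2 * s - 1).
pose L (p : R * 'rV[R]_N) :=
  g (upd (rhov (a p.1) p.2) k (Num.min (tent (p.2 ord0 k)) (q0 * (1 - b p.1)))).
have ab s : b s = 0 \/ a s = 1.
  by rewrite /a /b; case: (lerP (2 * s) 1) => ?; [left; apply: cl_low|right; apply: cl_high]; lra.
have crv : continuous (fun p : R * 'rV[R]_N => rhov (a p.1) p.2).
  apply: cts_mkrow => l; case: (eqVneq l k) => [_|lk]; first by cts.
  by have ? := crho lk; rewrite /a; cts.
exists (sup L (fun p => mid p.2)); split=> [|x j|x j].
- apply: smap_sup => [||[s x]].
  + apply: (smap_comp sg); first by rewrite /tent /b; cts.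
    move=> [s x] xo; apply: (cubeout_tent (x := x)) => //; last by rewrite ge_min lexx.
    by apply: rhov_out; exact: cl01.
  + by apply: (smap_comp smid) => //; cts.
  + case: (cases x) => [H|H|[H1 H2]]; [right|right|left] => j /=.
    * by apply: mid_e0; left.
    * by apply: mid_e0; right.
    have xb := inbox H2; have s01 := cl01 (2 * s); have b01 := cl01 (2 * s - 1).
    have qb : 0 <= q0 * (1 - b s) <= q0 by rewrite /b; nra.
    have xl l : l != k -> rhov (a s) x ord0 l = (1 - a s) * x ord0 l + a s * lo l.
      move=> lk; rewrite mxE (negbTE lk); have [_ -> //] := rhoP (x ord0 l) lk.
      by have := xb l lk; lra.
    rewrite /L /= min_r; last by lra.
    case: (ab s) => [b0|a1].
      apply: g_bot => [|l lk]; first by rewrite updE b0 subr0 mulr1.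
      by rewrite updN // xl //; have := xb l lk; rewrite /a; nra.
    apply: g_corner => [|l lk]; first by rewrite updE; lra.
    by rewrite updN // xl // a1 subrr mul0r add0r mul1r.
- rewrite /sup; have -> : L (0, x) j = low x j.
    rewrite /L /= /a /b mulr0 cl_low // cl_low; last by lra.
    rewrite subr0 mulr1 /low; congr (g (upd _ k _) j).
    by apply/rowP => l; rewrite mxE subr0 mul1r mul0r addr0 if_same.
  by rewrite /mid addrA addrK addrC subrK.
- rewrite /sup; have -> : L (1, x) j = e0.
    rewrite /L /= /b (cl_high (_ : 1 <= 2 * 1 - 1)); last by lra.
    rewrite subrr mulr0; apply: (smap_upd _ _ _ sg).
    by apply: inI_le0; rewrite ge_min lexx orbT.
  by rewrite addrC addKr.
Qed.

(* Going up g and back down g' in the direction k contracts to a constant loop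
   outside the box; M is what remains inside. *)
Lemma cls_difference (M : 'rV[R]_N -> nat -> V) :
  let A x := \row_l (lo l + (hi l - lo l) * x ord0 l) in
  (forall x j, ~ cubeout x -> 0 < th (A x) -> M x j =
     (if 2 * x ord0 k - 1 <= 0 then g else g')
       (upd (A x) k (Num.min (1 - (1 - q0) * `|2 * x ord0 k - 1|) (q0 + (q1 - q0) * th (A x)))) j) ->
  (forall x j, cubeout x \/ th (A x) = 0 -> M x j = e0) ->
  cls g - cls g' = cls M.
Proof.
move=> A MP Me0; rewrite -(cls_refl k) // -(cls_conc k) //; last exact: smap_refl.
rewrite (cls_hom hom_P) (cls_hom hom_mid).
have [h0 h1 h2] := q01.
(* [tent t] exceeds [q0] exactly for t between q0/2 and 1 - q0/2, so this box contains the support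
   of [mid]. *)
pose lo' l := if l == k then q0 / 2 else lo l.
pose hi' l := if l == k then 1 - q0 / 2 else hi l.
have tent_q0 t : ~~ (q0 / 2 < t < 1 - q0 / 2) -> tent t <= q0.
  rewrite negb_and -!leNgt /tent => /orP[] t0.
    by have := ler_norm (- (2 * t - 1)); rewrite normrN; lra.
  by have := ler_norm (2 * t - 1); lra.
have H := @hom_box R m n mid lo' hi'.
rewrite (cls_hom (H _ _ _ _)).
- congr cls; apply/funext => x; apply/funext => j; apply/esym.
  set y := \row_i _.
  have yk : y ord0 k = q0 / 2 + (1 - q0) * x ord0 k.
    by rewrite mxE /lo' /hi' eqxx; field.
  have yA r : upd y k r = upd (A x) k r.
    by apply/rowP => l; rewrite !mxE; case: ifP => // lk; rewrite /A ?mxE /lo' /hi' lk.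
  have thy : th y = th (A x) by rewrite -(th_upd y 0) -(th_upd (A x) 0) yA.
  have ty : tent (y ord0 k) = 1 - (1 - q0) * `|2 * x ord0 k - 1|.
    rewrite /tent yk; have -> : 2 * (q0 / 2 + (1 - q0) * x ord0 k) - 1 =
      (1 - q0) * (2 * x ord0 k - 1) by field.
    by rewrite normrM ger0_norm //; lra.
  have [xo|xo] := pselect (cubeout x).
    rewrite Me0; last by left.
    rewrite mid_e0 //; have [l xl] := xo; have [E|lk] := eqVneq l k.
      left; rewrite ty; move: xl; rewrite E negb_and -!leNgt => /orP[] x0.
        by have := ler_norm (- (2 * x ord0 k - 1)); rewrite normrN; nra.
      by have := ler_norm (2 * x ord0 k - 1); nra.
    right; apply: (th_out lk); rewrite mxE /lo' /hi' (negbTE lk).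
    have [? ? ?] := lohi lk; move: xl; rewrite !negb_and -!leNgt => /orP[] x0.
      by apply/orP; left; nra.
    by apply/orP; right; nra.
  have [t0|t0] := eqVneq (th (A x)) 0.
    by rewrite Me0; [rewrite mid_e0 //; right; rewrite thy|right].
  have tp : 0 < th (A x) by rewrite lt_neqAle eq_sym t0; case/andP: (th01 (A x)).
  have xk : inI (x ord0 k) by apply: contrapT => /negP xk; apply: xo; exists k.
  rewrite MP // mid_P ?thy //; last first.
    rewrite ty; move: xk => /andP[? ?]; have : `|2 * x ord0 k - 1| < 1 by rewrite ltr_norml; lra.
    by nra.
  rewrite /P /pick ty yA /lev thy yk.
  have -> : 2 * (q0 / 2 + (1 - q0) * x ord0 k) - 1 = (1 - q0) * (2 * x ord0 k - 1) by field.
  by rewrite pmulr_rle0 //; lra.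
- move=> l; rewrite /lo'; case: eqP => [_|/eqP /lohi[]//]; by lra.
- move=> l; rewrite /lo' /hi'; case: eqP => [_|/eqP /lohi[? ? ?]]; by lra.
- move=> l; rewrite /hi'; case: eqP => [_|/eqP /lohi[? ? ?]]; by lra.
- case: smid => c1 n1 d1 _; split=> // x [l xl] j.
  apply: mid_e0; move: xl; rewrite /lo' /hi'; case: (eqVneq l k) => [->|lk] xl.
    by left; exact: tent_q0.
  by right; exact: th_out lk xl.
Qed.

End Difference.

(** * Piecewise constant reparametrisations *)

Section CompactCube.
Context {R : realType} {D : nat}.
Implicit Types y z : 'rV[R]_D.

Definition ccl y : 'rV[R]_D := \row_d cl (y ord0 d).

Lemma cube_ccl y : cube (ccl y).
Proof. by move=> d; rewrite mxE; exact: cl01. Qed.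

Lemma compact_cube : compact [set y : 'rV[R]_D | cube y].
Proof.
have := @rV_compact R D (fun _ => `[0, 1]%classic) (fun _ => @segment_compact R 0 1).
rewrite (_ : [set v | _] = [set y | cube y]) //; by apply/seteqP; split=> y /= H d; have := H d; rewrite /= ?in_itv.
Qed.

Lemma cube_ex : [set y : 'rV[R]_D | cube y] !=set0.
Proof. by exists 0 => d; rewrite mxE lexx ler01. Qed.

Lemma within_cube (f : 'rV[R]_D -> R) : continuous f ->
  {within [set y : 'rV[R]_D | cube y], continuous f}.
Proof. by move=> cf; apply: continuous_subspaceT. Qed.

Lemma cube_min (f : 'rV[R]_D -> R) : continuous f -> (forall y, 0 < f y) ->
  exists2 d, 0 < d & forall y, cube y -> d <= f y.
Proof.
move=> cf f0; have [c _ H] := compact_EVT_min cube_ex compact_cube (within_cube cf).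
by exists (f c) => // y yc; apply: H; rewrite inE.
Qed.

Lemma cube_max (f : 'rV[R]_D -> R) : continuous f ->
  exists2 C, 0 < C & forall y, cube y -> f y <= C.
Proof.
move=> cf; have [c _ H] := compact_EVT_max cube_ex compact_cube (within_cube cf).
exists (Num.max (f c) 1) => [|y yc]; first by rewrite lt_max ltr01 orbT.
by rewrite le_max H // inE.
Qed.

Lemma row_norm_lt y (e : R) : 0 < e -> (forall d, `|y ord0 d| < e) -> `|y| < e.
Proof.
move=> e0 H; rewrite [ltLHS]/Num.norm /= mx_normrE; apply: bigmax_lt => // -[i d] _ /=.
by rewrite ord1.
Qed.

Lemma cube_unif (f : 'rV[R]_D -> R) (e : R) : continuous f -> 0 < e ->
  exists N0 : nat, forall N, (N0 <= N)%N -> forall y z, cube y ->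
    (forall d, `|y ord0 d - z ord0 d| <= N.+1%:R^-1) -> `|f y - f z| <= e.
Proof.
move=> cf e0.
pose P (N : nat) y := forall z, (forall d, `|y ord0 d - z ord0 d| <= N.+1%:R^-1) -> `|f y - f z| <= e.
have /compact_near_coveringP /(_ nat \oo P) H := compact_cube.
have [|N0 _ HN] := H _; last by exists N0 => N NN y z yc; apply: (HN N NN y yc).
move=> y _; have e2 : 0 < e / 2 by rewrite divr_gt0.
have /nbhs_ballP[r /= r0 Hr] : nbhs y (f @^-1` (ball (f y) (e / 2))).
  by apply: cf; apply/nbhs_ballP; exists (e / 2).
have r2 : 0 < r / 2 by rewrite divr_gt0.
exists (ball y (r / 2), [set N | N.+1%:R^-1 < r / 2]).
  split; first by apply/nbhs_ballP; exists (r / 2).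
  have [N1 N1r] : exists N1 : nat, (r / 2)^-1 < N1%:R.
    by exists (Num.truncn (r / 2)^-1).+1; exact: truncnS_gt.
  exists N1 => // N /= NN; rewrite invf_plt ?posrE ?ltr0n //.
  by apply: (lt_le_trans N1r); rewrite ler_nat ltnW.
case=> w N /= [yw Nr] z wz.
have fw : `|f y - f w| < e / 2.
  by apply: (Hr w); rewrite -ball_normE /= in yw *; apply: lt_trans yw _; lra.
have fz : `|f y - f z| < e / 2.
  apply: (Hr z); rewrite -ball_normE /= in yw *.
  have -> : y - z = (y - w) + (w - z) by rewrite addrA subrK.
  apply: (le_lt_trans (ler_normD _ _)); have : `|w - z| < r / 2; last by lra.
  by apply: row_norm_lt => // d; rewrite !mxE; apply: le_lt_trans (wz d) Nr.
have -> : f w - f z = - (f y - f w) + (f y - f z) by ring.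
by apply: (le_trans (ler_normD _ _)); rewrite normrN; lra.
Qed.

Lemma avoid_seq (s : seq R) (e : R) : 0 < e ->
  exists2 r, 0 < r <= e & forall x, x \in s -> x != r.
Proof.
move=> e0; suff [r re H] : exists2 r, 0 < r <= e & forall x, x \in s -> x <= 0 \/ r < x.
  by exists r => // x /H[|]; [move=> x0; rewrite lt_eqF //; lra|move=> rx; rewrite gt_eqF].
elim: s => [|x s [r re H]]; first by exists e => //; rewrite e0 lexx.
have [x0|x0] := lerP x 0.
  by exists r => // z; rewrite inE => /orP[/eqP ->|/H]; [left|].
exists (Num.min r (x / 2)).
  by rewrite lt_min ge_min; case/andP: re => -> ->; rewrite divr_gt0.
move=> z; rewrite inE => /orP[/eqP ->|/H[z0|rz]]; [right|by left|right].
  by rewrite gt_min; apply/orP; right; lra.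
by rewrite gt_min rz.
Qed.

Lemma seq_min (s : seq R) : (forall x, x \in s -> 0 < x) ->
  exists2 r, 0 < r & forall x, x \in s -> r <= x.
Proof.
elim: s => [|x s IH] H; first by exists 1.
have [|r r0 Hr] := IH; first by move=> z zs; apply: H; rewrite inE zs orbT.
exists (Num.min r x); first by rewrite lt_min r0 H // mem_head.
by move=> z; rewrite inE ge_min => /orP[/eqP ->|/Hr ->]; rewrite ?lexx ?orbT.
Qed.

End CompactCube.

Section Staircase.
Context {R : realType}.
Variables (N M : nat).
Hypothesis N0 : (0 < N)%N.
Local Notation L := ((N * M)%:R : R).

(* The staircase phi k climbs from a/N to (a+1)/N precisely when r crosses the
   zone number a * M + k of the subdivision of the unit interval. *)
Definition phi (k : nat) (r : R) : R :=
  N%:R^-1 * \sum_(a < N) cl (2 * (L * r - (a * M + k)%:R) - 2^-1).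

(** The middle half of zone [t]. Climbing is confined to it, so off the middle halves of its own
    zones a staircase stands at a multiple of 1/N. *)
Definition inz (t : nat) (r : R) : Prop := 4^-1 < L * r - t%:R < 3 * 4^-1.

Let n0 : 0 < N%:R :> R. Proof. by rewrite ltr0n. Qed.

Lemma cts_phi k : continuous (phi k).
Proof. by have ? := @cts_cl R; rewrite /phi; cts. Qed.

Lemma phi_cell k r a : (k < M)%N -> (a < N)%N -> a%:R <= N%:R * r <= a.+1%:R ->
  phi k r = N%:R^-1 * (a%:R + cl (2 * (L * r - (a * M + k)%:R) - 2^-1)).
Proof.
move=> kM aN /andP[ra rb]; have M0 : (0 < M)%N by exact: leq_ltn_trans kM.
have LE : L * r = M%:R * (N%:R * r) by rewrite natrM; ring.
have m0 : 0 < M%:R :> R by rewrite ltr0n.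
have kM' : k%:R + 1 <= M%:R :> R by rewrite -[X in _ + X]/(1%:R) -natrD addn1 ler_nat.
have k0 : 0 <= k%:R :> R by rewrite ler0n.
have r1 : M%:R * a%:R <= L * r by rewrite LE ler_pM2l.
have r2 : L * r <= M%:R * (a%:R + 1) by rewrite LE ler_pM2l // -natr1 in rb *.
rewrite /phi; congr (_ * _); rewrite (bigID (fun i : 'I_N => (i <= a)%N)) /=.
rewrite [X in _ + X]big1 ?addr0; last first.
  move=> i; rewrite -ltnNge => ai; apply: cl_low; rewrite natrD natrM.
  have ai' : a%:R + 1 <= i%:R :> R by rewrite -[X in _ + X]/(1%:R) -natrD addn1 ler_nat.
  by nra.
rewrite (bigD1 (Ordinal aN)) //= addrC; congr (_ + _).
rewrite (eq_bigr (fun _ => 1)); last first.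
  move=> i /andP[ia]; rewrite -val_eqE /= => ia'; apply: cl_high; rewrite natrD natrM.
  have ai' : i%:R + 1 <= a%:R :> R.
    by rewrite -[X in _ + X]/(1%:R) -natrD addn1 ler_nat ltn_neqAle ia'.
  by nra.
rewrite (eq_bigl (fun i : 'I_N => (i < a)%N)); last by move=> i; rewrite -val_eqE /=; lia.
by rewrite -(big_ord_widen N (fun _ => 1) (ltnW aN)) sumr_const card_ord.
Qed.

Lemma phi_low k r : (k < M)%N -> r <= 0 -> phi k r = 0.
Proof.
move=> kM r0; rewrite /phi big1 ?mulr0 // => a _; apply: cl_low.
have : L * r <= 0 by rewrite mulr_ge0_le0 ?ler0n.
by have := ler0n R (a * M + k); lra.
Qed.

Lemma phi_high k r : (k < M)%N -> 1 <= r -> phi k r = 1.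
Proof.
move=> kM r1; rewrite /phi (eq_bigr (fun _ => 1)).
  by rewrite sumr_const card_ord mulVf // gt_eqF.
move=> a _; apply: cl_high; have : L <= L * r by rewrite ler_peMr ?ler0n.
have : (a * M + k)%:R + 1 <= L :> R; last by lra.
by rewrite -[X in _ + X]/(1%:R) -natrD ler_nat; have := ltn_ord a; nia.
Qed.

Lemma cell_ex P (r : R) : (0 < P)%N -> 0 <= r <= 1 ->
  exists2 a, (a < P)%N & a%:R <= P%:R * r <= a.+1%:R.
Proof.
move=> P0 /andP[r0 r1]; have p0 : 0 < P%:R :> R by rewrite ltr0n.
have Pr : 0 <= P%:R * r by rewrite mulr_ge0 // ltW.
have /andP[t1 t2] := truncn_itv Pr; have [tP|tP] := ltnP (Num.truncn (P%:R * r)) P.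
  by exists (Num.truncn (P%:R * r)) => //; rewrite t1 ltW.
exists P.-1; first by rewrite prednK.
rewrite prednK //; apply/andP; split; last by rewrite ger_pMr.
by apply: le_trans t1; rewrite ler_nat; exact: leq_trans (leq_pred _) tP.
Qed.

Lemma phi01 k r : (k < M)%N -> 0 <= phi k r <= 1.
Proof.
move=> kM; have [r0|r0] := lerP r 0; first by rewrite phi_low // lexx ler01.
have [r1|r1] := lerP 1 r; first by rewrite phi_high // ler01 lexx.
have [|a aN ar] := @cell_ex N r N0; first by lra.
rewrite (phi_cell kM aN ar); set c := cl _; have : 0 <= c <= 1 by exact: cl01.
have aN' : a%:R + 1 <= N%:R :> R by rewrite -[X in _ + X]/(1%:R) -natrD addn1 ler_nat.
have a0 : 0 <= a%:R :> R by rewrite ler0n.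
move=> c01; apply/andP; split; last by rewrite mulrC ler_pdivrMr //; lra.
by apply: mulr_ge0; [rewrite invr_ge0 ltW|lra].
Qed.

Lemma phi_close k r : (k < M)%N -> `|cl r - phi k r| <= N%:R^-1.
Proof.
move=> kM; have ni : 0 <= N%:R^-1 :> R by rewrite invr_ge0 ltW.
have [r0|r0] := lerP r 0; first by rewrite phi_low // cl_low // subrr normr0.
have [r1|r1] := lerP 1 r; first by rewrite phi_high // cl_high // subrr normr0.
have [|a aN ar] := @cell_ex N r N0; first by lra.
rewrite (phi_cell kM aN ar) cl_id; last by lra.
set c := cl _; have c01 : 0 <= c <= 1 by exact: cl01.
have -> : r - N%:R^-1 * (a%:R + c) = N%:R^-1 * (N%:R * r - (a%:R + c)).
  by rewrite mulrBr mulKf // gt_eqF.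
rewrite normrM ger0_norm // -[leRHS]mulr1 ler_wpM2l // ler_norml.
by rewrite -natr1 in ar; lra.
Qed.

Lemma phi_lattice k r : (k < M)%N -> (forall a, (a < N)%N -> ~ inz (a * M + k) r) ->
  exists2 i, (i <= N)%N & phi k r = N%:R^-1 * i%:R.
Proof.
move=> kM nz; have [r0|r0] := lerP r 0; first by exists 0%N; rewrite ?phi_low ?mulr0.
have [r1|r1] := lerP 1 r; first by exists N => //; rewrite phi_high // mulVf // gt_eqF.
have [|a aN ar] := @cell_ex N r N0; first by lra.
rewrite (phi_cell kM aN ar); have := nz a aN; rewrite /inz => nza.
have [h|h] := lerP (L * r - (a * M + k)%:R) 4^-1.
  by exists a; [exact: ltnW|rewrite cl_low ?addr0 //; lra].
exists a.+1 => //; rewrite cl_high; first by rewrite -addn1 natrD.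
have [h'|h'] := ltrP (L * r - (a * M + k)%:R) (3 * 4^-1); last by lra.
by case: nza; rewrite h h'.
Qed.

(** Inside zone [t] only the staircase labelled t mod M moves; smaller labels have made their step
    of the current period, larger ones have not. *)
Lemma phi_local k r t : (k < M)%N -> (t < N * M)%N -> t%:R <= L * r <= t.+1%:R ->
  phi k r = N%:R^-1 * ((t %/ M)%:R +
    (if (t %% M == k)%N then cl (2 * (L * r - t%:R) - 2^-1) else (k < t %% M)%N%:R)).
Proof.
move=> kM tL /andP[ta tb]; have M0 : (0 < M)%N by exact: leq_ltn_trans kM.
have aN : (t %/ M < N)%N by rewrite ltn_divLR.
have tE := divn_eq t M; have bM := ltn_pmod t M0.
have m0 : 0 < M%:R :> R by rewrite ltr0n.
have LE : L * r = M%:R * (N%:R * r) by rewrite natrM; ring.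
have ar : (t %/ M)%:R <= N%:R * r <= (t %/ M).+1%:R.
  apply/andP; split; rewrite -(ler_pM2l m0) -LE -natrM.
    by apply: le_trans ta; rewrite ler_nat mulnC leq_trunc_div.
  by apply: (le_trans tb); rewrite ler_nat mulnC; lia.
rewrite (phi_cell kM aN ar); congr (_ * (_ + _)).
have [E|E] := eqVneq (t %% M)%N k; first by rewrite -E -tE.
rewrite -natr1 in tb.
have [h|h] := ltnP k (t %% M).
  apply: cl_high; have : (t %/ M * M + k)%:R + 1 <= t%:R :> R; last by lra.
  by rewrite natr1 ler_nat; lia.
apply: cl_low; have : t%:R + 1 <= (t %/ M * M + k)%:R :> R; last by lra.
by rewrite natr1 ler_nat; lia.
Qed.

Lemma inz_cell t t' r : t%:R <= L * r <= t.+1%:R -> inz t' r -> t' = t.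
Proof.
rewrite /inz => /andP[a b] /andP[c d]; rewrite -addn1 natrD in b.
have h1 : (t' < t + 1)%N by rewrite -(ltr_nat R) natrD; lra.
have h2 : (t < t' + 1)%N by rewrite -(ltr_nat R) natrD; lra.
by lia.
Qed.

Lemma inz_inj t t' r : inz t r -> inz t' r -> t' = t.
Proof. by rewrite /inz => H; apply: inz_cell; rewrite -natr1; lra. Qed.

Lemma inz_nat t t' r : L * r = t%:R -> ~ inz t' r.
Proof.
move=> E H; have t't : t' = t by apply: inz_cell H; rewrite E -natr1; lra.
by move: H; rewrite /inz t't E; lra.
Qed.

End Staircase.

(** * Maps of product form and the loop of the difference construction *)

Section Flips.
Context {R : realType} {m n : nat}.
Local Notation V := 'rV[R]_m.+1.
Local Notation smapn := (smap (@cubeout R n.+2)).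

Definition flip (s : seq 'I_n.+2) (x : 'rV[R]_n.+2) : 'rV[R]_n.+2 :=
  \row_l (if l \in s then 1 - x ord0 l else x ord0 l).

Lemma cls_flip (s : seq 'I_n.+2) : uniq s -> exists b : bool,
  forall F : 'rV[R]_n.+2 -> nat -> V, smapn F ->
  smapn (fun x => F (flip s x)) /\ cls (fun x => F (flip s x)) = cls F *~ (-1) ^+ b.
Proof.
elim: s => [_|l s IH /= /andP[ls /IH[b Hb]]].
  exists false => F sF; have -> : (fun x => F (flip [::] x)) = F.
    by apply/funext => x; congr F; apply/rowP => l; rewrite mxE.
  by split=> //; rewrite expr0 mulr1z.
exists (~~ b) => F sF; have [sG cG] := Hb _ (smap_refl l sF).
have E : (fun x => F (flip (l :: s) x)) = (fun x => refl l F (flip s x)).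
  apply/funext => x; rewrite /refl; congr F; apply/rowP => i; rewrite !mxE inE.
  by have [->|il] := eqVneq i l; rewrite ?(negbTE ls).
rewrite E; split=> //; rewrite cG cls_refl // (_ : (-1) ^+ (~~ b) = - (-1) ^+ b); last by case: b {Hb cG}.
by rewrite mulrNz mulNrz.
Qed.

End Flips.

Section ProductForm.
Context {R : realType} {q : nat}.
Local Notation p := (q.+2).
Local Notation V := 'rV[R]_p.+1.
Local Notation e0 := (sphere_pt : V).
Local Notation smapp := (smap (@cubeout R p)).
Implicit Types (w : 'rV[R]_p) (h : 'I_p -> R -> R).
Variables (c Lm dl : R).
Hypothesis dl0 : 0 < dl.
Hypothesis Lm0 : 0 <= Lm.
Hypothesis cL : 0 <= c + Lm * dl.

(** The shape of a staircase map on a single cell, where each tail coordinate depends on one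
    variable of its own. *)
Definition prodv h w : V :=
  consv (c + Lm * \sum_l `|h l (w ord0 l)|) (fun l => h l (w ord0 l)).

Definition tame h : Prop := [/\ forall l, continuous (h l),
  forall l r, r <= 0 -> h l r = h l 0, forall l r, 1 <= r -> h l r = h l 1 &
  forall l, dl <= `|h l 0| /\ dl <= `|h l 1|].

Lemma sum_ge1 (f : 'I_p -> R) l : (forall i, 0 <= f i) -> f l <= \sum_i f i.
Proof. by move=> f0; rewrite (bigD1 l) //= lerDl sumr_ge0. Qed.

Lemma prodv_pos (f : 'I_p -> R) l : dl <= `|f l| -> 0 <= c + Lm * \sum_l `|f l|.
Proof.
move=> fl; apply: (le_trans cL); rewrite lerD2l ler_wpM2l //.
by apply: (le_trans fl); apply: (@sum_ge1 (fun i => `|f i|)) => i; exact: normr_ge0.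
Qed.

Lemma single_e0 (T : Type) i (f : T -> V) : (forall t, f t = e0) -> single i f = basemap.
Proof.
by move=> f0; apply/funext => t; apply/funext => j; rewrite /single /basemap f0 if_same.
Qed.

(** Interpolate the factors. As c < 0 the head is nonzero where all of them vanish, and on each face
    a factor of size at least [dl] puts the head into the base region. *)
Lemma hom_prodv h h' i : c < 0 -> (forall l, continuous (h l)) -> (forall l, continuous (h' l)) ->
  (forall l r a, ~~ inI r -> 0 <= a <= 1 -> dl <= `|(1 - a) * h l r + a * h' l r|) ->
  hom (single i (fun w => stc (prodv h w))) (single i (fun w => stc (prodv h' w))).
Proof.
move=> c0 ch ch' hh; have ? := @cts_cl R.
pose mx (p : R * 'rV[R]_p) l := (1 - cl p.1) * h l (p.2 ord0 l) + cl p.1 * h' l (p.2 ord0 l).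
have cmx l : continuous (mx^~ l).
  by have ? := ch l; have ? := ch' l; rewrite /mx; cts.
exists (single i (fun p => stc (consv (c + Lm * \sum_l `|mx p l|) (mx p)))).
split=> [|w j|w j].
- have nz pp : consv (c + Lm * \sum_l `|mx pp l|) (mx pp) != 0.
    apply/row_neq0P; have [z|[l lz]] : (forall l, mx pp l = 0) \/ exists l, mx pp l <> 0.
      by have [?|/existsNP] := pselect (forall l, mx pp l = 0); [left|right].
      by left; rewrite consv0 big1 ?mulr0 ?addr0 => [|l _]; [lra|rewrite z normr0].
    by right; exists l; rewrite consvS.
  apply: smap_single => [|pp|[s w] [l wl]]; last first.
  - by apply: stc_e0; rewrite consv0; apply: (@prodv_pos _ l); apply: hh => //; exact: cl01.
  - exact/stc_neq0/nz.
  - apply: cts_stc; first exact: nz.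
    apply: cts_consv => //.
    by apply: ctsD; [exact: ctsc|apply: ctsM; [exact: ctsc|apply: cts_sum => l _; apply: ctsabs]].
- rewrite /single; case: ifP => // _; congr (stc (consv (_ + _ * _) _)).
    by apply: eq_bigr => l _; rewrite /mx /= cl_low // subr0 mul1r mul0r addr0.
  by apply/funext => l; rewrite /mx /= cl_low // subr0 mul1r mul0r addr0.
- rewrite /single; case: ifP => // _; congr (stc (consv (_ + _ * _) _)).
    by apply: eq_bigr => l _; rewrite /mx /= cl_high // subrr mul1r mul0r add0r.
  by apply/funext => l; rewrite /mx /= cl_high // subrr mul1r mul0r add0r.
Qed.

Lemma out_cases (r : R) : ~~ inI r -> r <= 0 \/ 1 <= r.
Proof. by rewrite /inI negb_and -!leNgt => /orP. Qed.

Lemma mix_ge (x y a d : R) : 0 <= a <= 1 -> d <= `|x| -> d <= `|y| -> 0 <= x * y ->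
  0 < d -> d <= `|(1 - a) * x + a * y|.
Proof.
move=> a01 dx dy xy d0; have [x0|x0] := lerP 0 x.
  rewrite ger0_norm // in dx; have y0 : 0 <= y by nra.
  by rewrite ger0_norm // in dy; apply: le_trans (ler_norm _); nra.
rewrite ltr0_norm // in dx; have y0 : y <= 0 by nra.
rewrite ler0_norm // in dy; rewrite -normrN; apply: le_trans (ler_norm _); nra.
Qed.

Lemma sign_mul (a b d : R) : 0 < d -> a * b < 0 ->
  0 <= a * ((if 0 < b then 1 else -1) * - d) /\ 0 <= b * ((if 0 < b then 1 else -1) * d).
Proof.
move=> d0 ab; case: ltP => b0.
  have a0 : a < 0 by rewrite pmulr_llt0 in ab.
  by rewrite !mul1r; split; [rewrite mulr_le0 ?oppr_le0 ?ltW|rewrite mulr_ge0 ?ltW].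
have b1 : b < 0.
  by rewrite lt_neqAle b0 andbT; apply/eqP => E; rewrite E mulr0 ltxx in ab.
have a0 : 0 < a by rewrite nmulr_llt0 in ab.
by rewrite !mulN1r opprK; split; [rewrite mulr_ge0 ?ltW|rewrite mulr_le0 ?oppr_le0 ?ltW].
Qed.

(** For c >= 0 the map is constant. For c < 0 only the signs of the factors at the ends of the
    interval matter: if one factor has equal signs at both ends it can be made constant and the map
    is null; otherwise all factors become linear and the map is the generator with some coordinates
    reversed. *)
Lemma cls_prodv h i : tame h -> (forall w, prodv h w != 0) -> smapp (single i (fun w => stc (prodv h w))) /\
  exists e : int, cls (single i (fun w => stc (prodv h w))) = @ioc R q i *~ e.
Proof.
move=> [ch h0 h1 hd] nz; have cprod : continuous (prodv h).
  apply: cts_consv => [|l]; last by have ? := ch l; cts.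
  apply: ctsD; first exact: ctsc.
  by apply: ctsM; [exact: ctsc|apply: cts_sum => l _; have ? := ch l; cts].
have sU : smapp (single i (fun w => stc (prodv h w))).
  apply: smap_single => [|w|w [l /out_cases wl]].
  - exact: cts_stc.
  - exact: stc_neq0.
  - apply: stc_e0; rewrite consv0; apply: (@prodv_pos _ l).
    by case: wl => wl; [rewrite h0|rewrite h1]; rewrite //; case: (hd l).
split=> //; have [c0|c0] := lerP 0 c.
  exists 0; rewrite mulr0z single_e0 ?cls_base // => w; apply: stc_e0.
  by rewrite consv0 addr_ge0 // mulr_ge0 // sumr_ge0.
have hmix l r a (h' : R -> R) : (forall r, r <= 0 -> dl <= `|h' r| /\ 0 <= h l 0 * h' r) ->
    (forall r, 1 <= r -> dl <= `|h' r| /\ 0 <= h l 1 * h' r) -> ~~ inI r -> 0 <= a <= 1 ->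
    dl <= `|(1 - a) * h l r + a * h' r|.
  move=> H0 H1 /out_cases[] r0 a01; have [? ?] := hd l.
    by have [? ?] := H0 r r0; apply: mix_ge; rewrite ?(h0 l r).
  by have [? ?] := H1 r r0; apply: mix_ge; rewrite ?(h1 l r).
have [[l0 pos]|/forallNP neg] := pselect (exists l, 0 < h l 0 * h l 1).
  exists 0; rewrite mulr0z.
  (* [h l0] is replaced by a constant of absolute value [dl]; then the head is nonnegative
     everywhere. *)
  pose s : R := if 0 < h l0 0 then dl else - dl.
  pose h' l (r : R) := if l == l0 then s else h l r.
  have sE : `|s| = dl by rewrite /s; case: ifP => _; rewrite ?normrN gtr0_norm.
  rewrite (@cls_hom _ _ _ _ (single i (fun w => stc (prodv h' w)))).
    rewrite single_e0 ?cls_base // => w; apply: stc_e0; rewrite consv0.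
    by apply: (@prodv_pos _ l0); rewrite /h' eqxx sE.
  apply: hom_prodv => // [l|l r a rI a01].
    by rewrite /h'; case: (l == l0); [exact: ctsc|exact: ch].
  have [? ?] := hd l0; rewrite /h'; case: eqP => [->|_]; last first.
    apply: (@hmix l r a (h l)) => // r' r0; [rewrite h0|rewrite h1] => //;
      by have [? ?] := hd l; split=> //; rewrite -expr2 sqr_ge0.
  apply: (@hmix l0 r a (fun _ => s)) => // r' r0; rewrite sE; split=> //.
    rewrite /s; case: ltP => h00; first by rewrite mulr_ge0 // ltW.
    by rewrite mulr_le0 // oppr_le0 ltW.
  rewrite /s; case: ltP => h00.
    by rewrite mulr_ge0 ?(ltW dl0) //; rewrite pmulr_rgt0 // in pos; exact: ltW.
  have h00' : h l0 0 < 0.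
    by rewrite lt_neqAle h00 andbT; apply/eqP => E; rewrite E mul0r ltxx in pos.
  by rewrite mulr_le0 ?oppr_le0 ?(ltW dl0) //; rewrite nmulr_rgt0 // in pos; exact: ltW.
have {}neg l : h l 0 * h l 1 < 0.
  have [? ?] := hd l; rewrite lt_neqAle leNgt; apply/andP; split; last exact/negP/neg.
  by rewrite mulf_neq0 // -normr_gt0; apply: lt_le_trans dl0 _.
pose sg l : R := if 0 < h l 1 then 1 else -1.
pose h' l r := sg l * (dl * (2 * cl r - 1)).
have nsg l x : `|sg l * x| = `|x| by rewrite /sg; case: ifP => _; rewrite ?mul1r ?mulN1r ?normrN.
have ? := @cts_cl R.
have H1 : hom (single i (fun w => stc (prodv h w))) (single i (fun w => stc (prodv h' w))).
  apply: hom_prodv => // [l|l r a rI a01]; first by rewrite /h'; cts.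
  have [? ?] := hd l; have := neg l => nl; apply: (@hmix l r a (h' l)) => // r' r0; rewrite /h' nsg.
    rewrite cl_low // mulr0 sub0r mulrN1 normrN gtr0_norm // lexx; split=> //.
    exact: (sign_mul dl0 nl).1.
  rewrite cl_high // (_ : 2 * 1 - 1 = 1) ?mulr1 ?gtr0_norm // ?lexx; last by ring.
  by split=> //; exact: (sign_mul dl0 nl).2.
pose J w : V := consv (2 * rho w - 1) (fun l => sg l * cent w l).
have H2 : hom (single i (fun w => stc (prodv h' w))) (single i (fun w => stc (J w))).
  pose mx (p : R * 'rV[R]_p) l :=
    sg l * ((1 - cl p.1) * (dl * (2 * cl (p.2 ord0 l) - 1)) + cl p.1 * cent p.2 l).
  pose m0 (p : R * 'rV[R]_p) := (1 - cl p.1) *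
    (c + Lm * \sum_l `|h' l (p.2 ord0 l)|) + cl p.1 * (2 * rho p.2 - 1).
  have ? := @cts_rho R q.
  have cmx l : continuous (mx^~ l) by rewrite /mx /cent; cts.
  have cm0 : continuous m0 by rewrite /m0 /h'; cts.
  exists (single i (fun p => stc (consv (m0 p) (mx p)))); split=> [|w j|w j].
  - have nzc pp : consv (m0 pp) (mx pp) != 0.
      apply/row_neq0P; have [z|[l lz]] : (forall l, mx pp l = 0) \/ exists l, mx pp l <> 0.
        by have [?|/existsNP] := pselect (forall l, mx pp l = 0); [left|right].
        left; rewrite consv0; have cz l : 2 * cl (pp.2 ord0 l) - 1 = 0 /\ cent pp.2 l = 0.
          have := z l => /eqP; rewrite -normr_eq0 /mx nsg normr_eq0 => /eqP.
          have := cl01 pp.1; rewrite /cent; set a := cl pp.1; move: (pp.2 ord0 l) => r a01.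
          have w0 : 0 < (1 - a) * dl + a by have := dl0; nra.
          case: (clP r) => [r0 E|r0 r1 E|r1 E].
          - by have : a * r <= 0; [nra|lra].
          - have : (2 * r - 1) * ((1 - a) * dl + a) = 0 by rewrite -[RHS]E; ring.
            by move/eqP; rewrite mulf_eq0 (gt_eqF w0) orbF => /eqP.
          - by have : 0 <= a * (r - 1); [nra|lra].
        rewrite /m0 /rho !big1 => [|l _|l _].
        + by have := cl01 pp.1; nra.
        + by rewrite (cz l).2 normr0.
        + by rewrite /h' (cz l).1 !mulr0 normr0.
      by right; exists l; rewrite consvS.
    apply: smap_single => // [||[s w] /= wo].
    + by apply: cts_stc => //; apply: cts_consv.
    + by move=> pp; exact: stc_neq0.
    + apply: stc_e0; rewrite consv0 /m0 /=; have := rho_out wo; have := cl01 s => s01 r1.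
      have [l /out_cases wl] := wo; have := @prodv_pos (fun l => h' l (w ord0 l)) l.
      rewrite /= /h' nsg; move=> H; have : 0 <= c + Lm * \sum_l `|h' l (w ord0 l)|.
        apply: H; case: wl => wl; rewrite ?(cl_low wl) ?(cl_high wl).
          by rewrite mulr0 sub0r mulrN1 normrN gtr0_norm.
        by rewrite (_ : 2 * 1 - 1 = 1) ?mulr1 ?gtr0_norm //; ring.
      by move=> ?; nra.
  - rewrite /single; case: ifP => // _; congr (stc (consv _ _)).
      by rewrite /m0 /= cl_low // subr0 mul1r mul0r addr0.
    by apply/funext => l; rewrite /mx /= cl_low // subr0 mul1r mul0r addr0.
  - rewrite /single; case: ifP => // _; congr (stc (consv _ _)).
      by rewrite /m0 /= cl_high // subrr mul1r mul0r add0r.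
    by apply/funext => l; rewrite /mx /= cl_high // subrr mul1r mul0r add0r.
(* The coordinates whose factor runs from positive to negative; reversing them turns [J] into
   [io0]. *)
pose s := [seq l <- enum 'I_p | sg l != 1].
have us : uniq s by rewrite filter_uniq // enum_uniq.
have [b Hb] := @cls_flip R p q s us; have [sF cF] := Hb _ (@smap_iomap R q i).
exists ((-1) ^+ b); rewrite (cls_hom H1) (cls_hom H2) -cF.
congr cls; apply/funext => w; rewrite /iomap /single; apply/funext => j; case: ifP => // _.
have E l : sg l * cent w l = cent (flip s w) l.
  rewrite /cent mxE mem_filter mem_enum andbT /sg; case: ifP => _; first by rewrite eqxx mul1r.
  by rewrite ifT; [ring|apply/eqP; lra].
congr (stc (consv _ _)); last by apply/funext.
rewrite /rho; congr (_ * _ - _); apply: eq_bigr => l _.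
by rewrite -E nsg.
Qed.

End ProductForm.

Section MidLoop.
Context {R : realType} {m q : nat}.
Local Notation n := (q + q.+1)%N.
Local Notation N := (n.+2).
Implicit Types (x : 'rV[R]_N) (u v : 'rV[R]_q.+2 -> nat -> 'rV[R]_m.+1).
Variable C : R.
Hypothesis C1 : 1 <= C.

Definition bb (r : R) : R := cl (8 * Num.min r (1 - r) - 1).
Definition bprod x : R := \prod_(k | k != ord0) bb (x ord0 k).
(** The loop that [cls_difference] leaves on a cell: [mid1] is the excursion up and down in one
    space coordinate, [mid2] the height of the sweep, raised by the bump of the cell on the way up.
    [C] is the distance, counted in zones, from the bottom of the cell to 1. *)
Definition mid1 x : R :=
  2 * Num.min (C * (1 - `|2 * x ord0 ord0 - 1|)) (lam x) - 2^-1.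
Definition mid2 x : R := 2 * (bprod x * bb (Num.min (2 * C * x ord0 ord0) (lam x))) - 2^-1.

Lemma cts_bb : continuous bb.
Proof. by have ? := @cts_cl R; rewrite /bb; cts. Qed.

Lemma bb_low r : r <= 8^-1 \/ 7 * 8^-1 <= r -> bb r = 0.
Proof.
move=> H; apply: cl_low; have : Num.min r (1 - r) <= 8^-1.
  by rewrite ge_min; apply/orP; case: H => ?; [left|right]; lra.
by move: (Num.min _ _) => z; lra.
Qed.

Lemma bb_high r : 4^-1 <= r <= 3 * 4^-1 -> bb r = 1.
Proof.
move=> H; apply: cl_high; have : 4^-1 <= Num.min r (1 - r).
  by rewrite le_min; apply/andP; split; lra.
by move: (Num.min _ _) => z; lra.
Qed.

Lemma core_bprod x : core x -> bprod x = 1.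
Proof. by move=> cx; apply: big1 => k /cx ?; apply: bb_high; lra. Qed.

(** Where some factor of [lam] is below 1 a coordinate is within 1/8 of its faces and [bprod]
    vanishes; otherwise [lam] is 1, and [bb] vanishes at 1. *)
Lemma bprod_lam x : bprod x * bb (lam x) = 0.
Proof.
have [E|E] := pselect (forall k, k != ord0 -> cl (8 * Num.min (x ord0 k) (1 - x ord0 k)) = 1).
  rewrite /lam big1 // bb_low ?mulr0 //; right; lra.
have [k [k0 xk]] : exists k, k != ord0 /\ cl (8 * Num.min (x ord0 k) (1 - x ord0 k)) <> 1.
  by apply: contrapT => H; apply: E => k k0; apply: contrapT => xk; apply: H; exists k.
rewrite /bprod (bigD1 k) //= [bb (x ord0 k)]cl_low ?mul0r //.
by move: xk; move: (Num.min _ _) => z; case: clP => *; lra.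
Qed.

Lemma tent_out_le (t : R) : t <= 0 \/ 1 <= t -> C * (1 - `|2 * t - 1|) <= 0.
Proof.
by case=> t0; rewrite mulr_ge0_le0 ?subr_le0 ?(le_trans ler01) //;
  [rewrite ler0_norm|rewrite ger0_norm]; lra.
Qed.

Lemma mulC_bounds (t : R) : (t <= 0 -> 2 * C * t <= 0) /\ (2^-1 <= t -> 1 <= 2 * C * t).
Proof. by have := C1; split=> ?; nra. Qed.

Lemma mid_out x : cubeout x -> mid1 x <= 0 /\ mid2 x <= 0.
Proof.
move=> [k xk]; have l01 := lam01 x; have [E|k0] := eqVneq k ord0.
  have x0 : x ord0 ord0 <= 0 \/ 1 <= x ord0 ord0 by apply/out_cases; rewrite -E.
  have t0 := tent_out_le x0.
  split; rewrite /mid1 /mid2; first by rewrite min_l; lra.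
  case: x0 => x0; last first.
    rewrite min_r ?bprod_lam; first lra.
    by apply: le_trans ((mulC_bounds _).2 _); lra.
  rewrite [bb (Num.min _ _)]bb_low ?mulr0; first lra.
  by left; rewrite ge_min; apply/orP; left; have := (mulC_bounds _).1 x0; lra.
have l0 : lam x = 0 by apply: (lam0 k0).
rewrite /mid1 /mid2 l0; split.
  have : Num.min (C * (1 - `|2 * x ord0 ord0 - 1|)) 0 <= 0 by rewrite ge_min lexx orbT.
  by move: (Num.min _ _) => z; lra.
rewrite [bb (Num.min _ _)]bb_low ?mulr0; first lra.
by left; rewrite ge_min; apply/orP; right; lra.
Qed.

(* The phases of the loop: in each of them one of the two coordinates stays on
   the same side of the unit square as in the corresponding phase of gam. *)
Lemma mid_phases x : core x ->
  [/\ x ord0 ord0 <= (8 * C)^-1 -> mid1 x <= 0,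
      (8 * C)^-1 <= x ord0 ord0 <= 3 * (8 * C)^-1 -> 1 <= mid2 x,
      3 * (8 * C)^-1 <= x ord0 ord0 <= 2^-1 -> 1 <= mid1 x &
      2^-1 <= x ord0 ord0 -> mid2 x <= 0].
Proof.
move=> cx; rewrite /mid1 /mid2 core_bprod // core_lam // mul1r.
have ? := C1; set t := x ord0 ord0; set i := (8 * C)^-1.
have Ci : C * i = 8^-1 by rewrite /i invfM mulrCA divff ?mulr1 // gt_eqF //; lra.
have i0 : 0 < i by rewrite invr_gt0; lra.
split=> H.
- have : Num.min (C * (1 - `|2 * t - 1|)) 1 <= 4^-1; last by move: (Num.min _ _) => z; lra.
  rewrite ge_min; apply/orP; left; have := ler_norm (- (2 * t - 1)); rewrite normrN; nra.
- rewrite bb_high; first lra.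
  by rewrite min_l; nra.
- rewrite ler0_norm; last lra.
  have : 3 * 4^-1 <= Num.min (C * (1 - - (2 * t - 1))) 1; last by move: (Num.min _ _) => z; lra.
  by rewrite le_min; apply/andP; split; nra.
- rewrite min_r ?bb_low; [lra|right; lra|exact: (mulC_bounds _).2].
Qed.

Lemma admissible_mid : admissible mid1 mid2.
Proof.
have ? := cts_bb; have ? := @cts_lam R q.
have cb : continuous bprod by apply: cts_prod => k; cts.
split; [by rewrite /mid1; cts|by rewrite /mid2; cts|exact: mid_out|].
move=> x cx [/andP[a b] /andP[d e]]; have [H1 H2 H3 H4] := mid_phases cx.
have [h|h] := lerP (x ord0 ord0) (8 * C)^-1; first by have := H1 h; lra.
have [h'|h'] := lerP (x ord0 ord0) (3 * (8 * C)^-1); first by have := H2; lra.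
by have [h''|h''] := lerP (x ord0 ord0) 2^-1; [have := H3|have := H4]; lra.
Qed.

Let i := (8 * C)^-1.
(** Maps 0, i, 3i, 1/2, 1 to 0, 1/4, 1/2, 3/4, 1, so that each phase of this loop is compared with
    the corresponding side of [gam]. *)
Let rh (t : R) : R := 4^-1 *
  (cl (8 * C * t) + cl ((8 * C * t - 1) * 2^-1) + cl ((t - 3 * i) / (2^-1 - 3 * i)) + cl (2 * t - 1)).

Lemma hom_mid_wmap u v : smap (@cubeout R q.+2) u -> smap (@cubeout R q.+2) v ->
  hom (Wgen mid1 mid2 u v) (wmap u v).
Proof.
move=> su sv; have ? := @cts_cl R; have ? := C1.
have i0 : 0 < i by rewrite invr_gt0; lra.
have Ci : C * i = 8^-1 by rewrite /i invfM mulrCA divff ?mulr1 // gt_eqF //; lra.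
have i8 : i <= 8^-1 by nra.
have w0 : 0 < 2^-1 - 3 * i by lra.
have crh : continuous rh by rewrite /rh; cts.
have third t : (t <= 3 * i -> cl ((t - 3 * i) / (2^-1 - 3 * i)) = 0) /\
               (2^-1 <= t -> cl ((t - 3 * i) / (2^-1 - 3 * i)) = 1).
  split=> H; [apply: cl_low|apply: cl_high].
    by rewrite pmulr_lle0 ?invr_gt0 //; lra.
  by rewrite ler_pdivlMr //; lra.
have rh0 t : t <= 0 -> rh t <= 0.
  move=> t0; rewrite /rh !cl_low; try lra; try nra.
  by rewrite pmulr_lle0 ?invr_gt0 //; lra.
have rh1 t : 1 <= t -> 1 <= rh t.
  move=> t1; rewrite /rh (third t).2 ?cl_high; try lra; try nra.
apply: (@hom_trans _ _ _ (fun x => wmap u v (upd x ord0 (rh (x ord0 ord0))))); last first.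
  by apply: hom_reparam_id => //; exact: smap_wmap.
pose k1 x := kap1 (upd x ord0 (rh (x ord0 ord0))).
pose k2 x := kap2 (upd x ord0 (rh (x ord0 ord0))).
have lamu x r : lam (upd x ord0 r) = lam x.
  by apply: eq_bigr => k k0; rewrite updN.
have -> : (fun x => wmap u v (upd x ord0 (rh (x ord0 ord0)))) = Wgen k1 k2 u v.
  apply/funext => x; rewrite /wmap /Wgen /sup /upart /vpart.
  by apply/funext => j; congr (u (consv _ _) j + v (consv _ _) j - _);
     apply/funext => l; rewrite updN.
have adm : admissible k1 k2.
  have [c1 c2 z12 sq] := @admissible_kap R q; split.
  - by rewrite /k1; cts.
  - by rewrite /k2; cts.
  - move=> x xo; apply: z12; apply: cubeoutP xo _ => xk; apply/negP => /andP[? ?].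
    by case/out_cases: xk => [/rh0|/rh1] ?; lra.
  - by move=> x cx; apply: sq => k k0; rewrite updN //; exact: cx.
apply: hom_Wgen => // [|x cx]; first exact: admissible_mid.
have [H1 H2 H3 H4] := mid_phases cx.
have E1 : k1 x = gam1 (rh (x ord0 ord0)).
  by rewrite /k1 /kap1 lamu core_lam // mul1r updE addrC addrK.
have E2 : k2 x = gam2 (rh (x ord0 ord0)).
  by rewrite /k2 /kap2 lamu core_lam // mul1r updE addrC addrK.
rewrite E1 E2; set t := x ord0 ord0 in H1 H2 H3 H4 *.
have r1 := cl01 (8 * C * t); have r2 := cl01 ((8 * C * t - 1) * 2^-1).
have r3 := cl01 ((t - 3 * i) / (2^-1 - 3 * i)); have r4 := cl01 (2 * t - 1).
have [h|h] := lerP t i.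
  constructor 1; split; first exact: H1.
  have : rh t <= 4^-1.
    rewrite /rh (third t).1 ?(cl_low (_ : (8 * C * t - 1) * 2^-1 <= 0))
      ?(cl_low (_ : 2 * t - 1 <= 0)); try lra; nra.
  by move=> hr; rewrite /gam1 !cl_low; lra.
have Ct : 1 <= 8 * C * t by nra.
have [h'|h'] := lerP t (3 * i).
  constructor 4; split; first by apply: H2; rewrite -/i; lra.
  have : 4^-1 <= rh t <= 2^-1.
    rewrite /rh (third t).1 ?(cl_low (_ : 2 * t - 1 <= 0)) ?(cl_high Ct); try lra.
  by move=> hr; rewrite /gam2 cl_high ?cl_low; lra.
have Ct3 : 1 <= (8 * C * t - 1) * 2^-1 by nra.
have [h''|h''] := lerP t 2^-1.
  constructor 2; split; first by apply: H3; rewrite -/i; lra.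
  have : 2^-1 <= rh t <= 3 * 4^-1.
    rewrite /rh ?(cl_low (_ : 2 * t - 1 <= 0)) ?(cl_high Ct) ?(cl_high Ct3); lra.
  by move=> hr; rewrite /gam1 cl_high ?cl_low; lra.
constructor 3; split; first by apply: H4; lra.
have : 3 * 4^-1 <= rh t.
  by rewrite /rh (third t).2 ?(cl_high Ct) ?(cl_high Ct3); lra.
by move=> hr; rewrite /gam2 !cl_high; lra.
Qed.

End MidLoop.

(** * Maps assembled from staircase pullbacks *)

Section Stair.
Context {R : realType} {q n : nat}.
Local Notation p := (q.+2).
Local Notation d := (n.+2).
Local Notation D := (n.+3).
Local Notation V := 'rV[R]_p.+1.
Local Notation e0 := (sphere_pt : V).
Implicit Types (y z : 'rV[R]_D) (x : 'rV[R]_d).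

Definition lab (j l : nat) : nat := (j * p.+1 + l)%N.

Lemma lab_inj j l j' l' : (l <= p)%N -> (l' <= p)%N -> lab j l = lab j' l' -> j = j' /\ l = l'.
Proof.
rewrite /lab => lp lp' E; have [jj|jj|jj] := ltngtP j j'; last by split=> //; lia.
  have : (j.+1 * p.+1 <= j' * p.+1)%N by rewrite leq_mul2r jj orbT.
  by rewrite mulSn; lia.
have : (j'.+1 * p.+1 <= j * p.+1)%N by rewrite leq_mul2r jj orbT.
by rewrite mulSn; lia.
Qed.

(* The label K * p.+1 is carried by no coordinate function: it keeps the cells
   carrying labels away from the face y_d = 1. *)
Definition nlab (K : nat) : nat := (K * p.+1).+1.

Lemma lab_lt K j l : (j < K)%N -> (l <= p)%N -> (lab j l < (nlab K).-1)%N.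
Proof.
rewrite /lab /nlab /= => jK lp.
have : (j.+1 * p.+1 <= K * p.+1)%N by rewrite leq_mul2r jK orbT.
by rewrite mulSn; lia.
Qed.

Variables (K N : nat) (h0 : nat -> 'rV[R]_D -> R) (hh : nat -> 'I_p -> 'rV[R]_D -> R) (Lm dl : R).
Local Notation M := (nlab K).

Lemma lab_ltM j l : (j < K)%N -> (l <= p)%N -> (lab j l < M)%N.
Proof. by move=> jK lp; apply: leq_trans (lab_lt jK lp) _; rewrite /nlab. Qed.

Definition Phi k y : 'rV[R]_D := \row_e phi N M k (y ord0 e).
Definition hv j y : 'I_p -> R := fun l => hh j l (Phi (lab j l.+1) y).
(** Each of the p + 1 coordinates of a nullhomotopy is pulled back along a staircase of its own. The
    last summand of the head is the penalty; by [stair_lat] and [stair_bnd] it outweighs the rest as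
    soon as one tail coordinate is read at a lattice point. *)
Definition Ft j y : V := consv (h0 j (Phi (lab j 0) y) + Lm * \sum_l `|hv j y l|) (hv j y).
Definition Gt y : nat -> V := fun j => if (j < K)%N then stc (Ft j y) else e0.
Definition neg j y : Prop := (j < K)%N /\ Ft j y ord0 ord0 < 0.
Definition conflict y i j : Prop := [/\ i <> j, neg i y & neg j y].

Definition lattice z : Prop := forall e, exists2 i, (i <= N)%N & z ord0 e = N%:R^-1 * i%:R.
(** Where a nullhomotopy is at the base point: beyond its end y0 = 1, or outside the cube in space.
    At y0 <= 0 it carries the original map. *)
Definition outY y : Prop := 1 <= y ord0 ord0 \/ exists l : 'I_d, ~~ inI (y ord0 (lift ord0 l)).

Record stair : Prop := Stair {
  stair_N : (0 < N)%N;
  stair_dl : 0 < dl;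
  stair_Lm : 0 <= Lm;
  stair_h0 : forall j, continuous (h0 j);
  stair_hh : forall j l, continuous (hh j l);
  stair_lat : forall j l z, (j < K)%N -> lattice z -> dl <= `|hh j l z|;
  stair_bnd : forall j z, (j < K)%N -> cube z -> 0 <= h0 j z + Lm * dl;
  stair_nz : forall j y, (j < K)%N -> Ft j y != 0;
  stair_out : forall j z, (j < K)%N -> outY z -> 0 <= h0 j z }.

Hypothesis St : stair.
Let N0 := stair_N St.

Lemma cts_Phi k : continuous (Phi k).
Proof. by have ? := @cts_phi R N M k; apply: cts_mkrow => e; cts. Qed.

Lemma cts_Ft j : continuous (Ft j).
Proof.
have ch l : continuous (fun y => hv j y l).
  by have ? := stair_hh St (j := j) (l := l); have ? := @cts_Phi (lab j l.+1); rewrite /hv; cts.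
have ? := stair_h0 St (j := j); have ? := @cts_Phi (lab j 0).
apply: cts_consv => //; apply: ctsD; first by cts.
by apply: ctsM; [exact: ctsc|apply: cts_sum => l _; apply: ctsabs].
Qed.

Lemma Ft_sum_ge0 j y : 0 <= Lm * \sum_l `|hv j y l|.
Proof. by rewrite mulr_ge0 ?(stair_Lm St) // sumr_ge0. Qed.

Lemma cube_Phi k y : (k < M)%N -> cube (Phi k y).
Proof. by move=> kM e; rewrite mxE; exact: phi01. Qed.

Lemma Phi_out k y : (k < M)%N -> outY y -> outY (Phi k y).
Proof.
move=> kM [y0|[l /out_cases yl]]; [left|right; exists l]; rewrite mxE.
  by rewrite phi_high.
by case: yl => yl; [rewrite phi_low|rewrite phi_high] => //; rewrite /inI ltxx ?andbF.
Qed.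

Lemma Ft_out j y : (j < K)%N -> outY y -> 0 <= Ft j y ord0 ord0.
Proof.
move=> jK yo; rewrite consv0 addr_ge0 ?Ft_sum_ge0 //; apply: (stair_out St) => //.
by apply: Phi_out => //; exact: lab_ltM.
Qed.

(** Otherwise the staircase of this label stands at a lattice point in all coordinates, and the
    penalty makes the head nonnegative. *)
Lemma neg_label j y (l : 'I_p) : neg j y -> exists e t,
  [/\ (t < N * M)%N, inz N M t (y ord0 e) & (t %% M = lab j l.+1)%N].
Proof.
move=> [jK]; rewrite consv0; apply: contraPP => H; apply/negP; rewrite -leNgt.
have lM : (lab j l.+1 < M)%N by apply: lab_ltM.
have lat : lattice (Phi (lab j l.+1) y).
  move=> e; rewrite mxE; apply: phi_lattice => // a aN ez; apply: H.
  exists e, (a * M + lab j l.+1)%N; split=> //; last by rewrite modnMDl modn_small.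
  have : (a.+1 * M <= N * M)%N by rewrite leq_mul2r aN orbT.
  by rewrite mulSn; lia.
apply: le_trans (stair_bnd St jK (cube_Phi y (lab_ltM jK (leq0n _)))) _.
rewrite lerD2l ler_wpM2l ?(stair_Lm St) //; apply: (le_trans (stair_lat St l jK lat)).
by apply: (@sum_ge1 R q (fun i => `|hv j y i|)) => i; exact: normr_ge0.
Qed.

Lemma smap_Gt (T : topologicalType) (Z : set T) (y : T -> 'rV[R]_D) : continuous y ->
  (forall t i j, ~ conflict (y t) i j) -> (forall t, Z t -> outY (y t)) ->
  smap Z (fun t => Gt (y t)).
Proof.
move=> cy nc Zy; split=> [j|t j|t i j ij|t Zt j].
- rewrite /Gt; case jK: (j < K)%N; last exact: ctsc.
  apply: cts_stc => [t|]; first exact: (stair_nz St).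
  by have ? := @cts_Ft j; cts.
- by rewrite /Gt; case: ifP => jK; [apply/stc_neq0/(stair_nz St)|exact: e0_neq0].
- have H k : Gt (y t) k = e0 \/ neg k (y t).
    rewrite /Gt /neg; case: ltnP => kK; last by left.
    by case: (lerP 0 (Ft k (y t) ord0 ord0)) => ?; [left; exact: stc_e0|right].
  case: (H i) => [|ni]; first by left.
  case: (H j) => [|nj]; first by right.
  by exfalso; apply: (nc t i j); split=> //; apply/eqP.
- by rewrite /Gt; case: ifP => // jK; apply: stc_e0; apply: Ft_out => //; exact: Zy.
Qed.

Definition slabel i j (u : 'I_p + 'I_p) : nat :=
  match u with inl l => lab i l.+1 | inr l => lab j l.+1 end.

Lemma slabel_inj i j : i <> j -> injective (slabel i j).
Proof.
move=> ij [l|l] [l'|l'] /= /lab_inj[] // E /succn_inj /val_inj ->; by [|case: ij|case: ij].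
Qed.

(** A coordinate lies in at most one zone and a zone has one label, so the 2p labels of the two
    spheres occupy 2p distinct coordinates. *)
Lemma conflict_inj y i j : conflict y i j -> exists (E : 'I_p + 'I_p -> 'I_D) (t : 'I_p + 'I_p -> nat),
  injective E /\ forall u, [/\ (t u < N * M)%N, inz N M (t u) (y ord0 (E u)) &
    (t u %% M = slabel i j u)%N].
Proof.
move=> [ij ni nj].
have /choice[Et H] : forall u, exists et : 'I_D * nat,
    [/\ (et.2 < N * M)%N, inz N M et.2 (y ord0 et.1) & (et.2 %% M = slabel i j u)%N].
  by case=> l; [have [e [t H]] := neg_label l ni|have [e [t H]] := neg_label l nj]; exists (e, t).
exists (fun u => (Et u).1), (fun u => (Et u).2); split=> // u v E.
apply: (slabel_inj ij); have [_ zu <-] := H u; have [_ zv <-] := H v.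
by rewrite E in zu; rewrite (inz_inj N0 zu zv).
Qed.

Lemma Gt_out y j : outY y -> Gt y j = e0.
Proof. by move=> yo; rewrite /Gt; case: ifP => // jK; apply: stc_e0; exact: Ft_out. Qed.

Definition yv (s : R) x : 'rV[R]_D := consv s (fun l => x ord0 l).

Lemma cts_yv (T : topologicalType) (s : T -> R) (x : T -> 'rV[R]_d) :
  continuous s -> continuous x -> continuous (fun t => yv (s t) (x t)).
Proof. by move=> cs cx; apply: cts_consv => // l; cts. Qed.

Lemma yv0 s x : yv s x ord0 ord0 = s.
Proof. by rewrite /yv consv0. Qed.

Lemma yvS s x l : yv s x ord0 (lift ord0 l) = x ord0 l.
Proof. by rewrite /yv consvS. Qed.

Lemma yv_out s x : cubeout x -> outY (yv s x).
Proof. by move=> [l xl]; right; exists l; rewrite yvS. Qed.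

Lemma hom_Gt (s0 s1 : 'rV[R]_d -> R) : continuous s0 -> continuous s1 ->
  (forall r x i j, 0 <= r <= 1 -> ~ conflict (yv ((1 - r) * s0 x + r * s1 x) x) i j) ->
  hom (fun x => Gt (yv (s0 x) x)) (fun x => Gt (yv (s1 x) x)).
Proof.
move=> c0 c1 nc; have ? := @cts_cl R.
exists (fun p => Gt (yv ((1 - cl p.1) * s0 p.2 + cl p.1 * s1 p.2) p.2)); split=> [|x j|x j].
- apply: smap_Gt => [|[r x] i j|[r x] xo].
  + by apply: cts_yv; cts.
  + by apply: nc; exact: cl01.
  + exact: yv_out.
- by rewrite /= cl_low // subr0 mul1r mul0r addr0.
- by rewrite /= cl_high // subrr mul1r mul0r add0r.
Qed.

(** With fewer than 2p coordinates no two components are ever active together, so the height can be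
    moved freely from 0 to 1. *)
Lemma cls_Gt_small : (n.+3 < 2 * p)%N -> cls (fun x => Gt (yv 0 x)) = 0.
Proof.
move=> np; rewrite -cls_base; apply: cls_hom.
apply: (@hom_trans _ _ _ (fun x => Gt (yv 1 x))).
  apply: (@hom_Gt (fun _ => 0) (fun _ => 1)); [exact: ctsc|exact: ctsc|].
  move=> r x i j _ /conflict_inj[E [t [/leq_card + _]]].
  by rewrite card_sum !card_ord; lia.
apply: hom_eq => [|x j]; last by apply: Gt_out; left; rewrite yv0.
apply: smap_Gt => [|x i j /conflict_inj[E [t [/leq_card + _]]]|x]; last exact: yv_out.
  by apply: cts_yv; [exact: ctsc|exact: cts_id].
by rewrite card_sum !card_ord; lia.
Qed.

End Stair.

(** * Sweeping the cells of a slab *)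

Section Bumps.
Context {R : realType} {d L : nat}.
Implicit Types (T : {ffun 'I_d -> 'I_L}) (s : seq {ffun 'I_d -> 'I_L}) (x : 'rV[R]_d).

Definition bump T x : R := \prod_l bb (L%:R * x ord0 l - (T l)%:R).
Definition sig s x : R := \sum_(T <- s) bump T x.
Definition incell T x : Prop := forall l, (T l)%:R <= L%:R * x ord0 l <= (T l).+1%:R.
Definition inzone T x : Prop := forall l, 4^-1 < L%:R * x ord0 l - (T l)%:R < 3 * 4^-1.

Lemma cts_bump T : continuous (bump T).
Proof. by have ? := @cts_bb R; apply: cts_prod => l; cts. Qed.

Lemma cts_sig s : continuous (sig s).
Proof. by apply: cts_sum => T _; exact: cts_bump. Qed.

Lemma bump_neq0 T x : bump T x != 0 -> forall l, (T l)%:R < L%:R * x ord0 l < (T l).+1%:R.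
Proof.
move=> Tx l; rewrite -[(T l).+1]addn1 natrD; have : bb (L%:R * x ord0 l - (T l)%:R) != 0.
  by apply: contraNN Tx => /eqP E; rewrite /bump (bigD1 l) //= E mul0r.
move=> /eqP b0; have [h|h] := lerP (L%:R * x ord0 l - (T l)%:R) 8^-1.
  by case: b0; apply: bb_low; left.
have [h'|h'] := lerP (7 * 8^-1) (L%:R * x ord0 l - (T l)%:R).
  by case: b0; apply: bb_low; right.
by apply/andP; split; lra.
Qed.

Lemma bump_zone T x : inzone T x -> bump T x = 1.
Proof. by move=> Tx; apply: big1 => l _; apply: bb_high; have := Tx l; lra. Qed.

Lemma inzone_cell T x : inzone T x -> incell T x.
Proof. by move=> Tx l; have := Tx l; rewrite -[(T l).+1]addn1 natrD; lra. Qed.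

Lemma bump_other T T' x : incell T x -> T' != T -> bump T' x = 0.
Proof.
move=> Tx TT; apply/eqP/negPn/negP => /bump_neq0 H; move/eqP: TT; apply.
apply/ffunP => l; apply/val_inj; have /andP[a b] := H l; have /andP[c e] := Tx l.
have h1 : ((T' l : nat) < (T l).+1)%N by rewrite -(ltr_nat R); lra.
have h2 : ((T l : nat) < (T' l).+1)%N by rewrite -(ltr_nat R); lra.
by rewrite /=; lia.
Qed.

Lemma sig_cell s T x : uniq s -> incell T x -> sig s x = if T \in s then bump T x else 0.
Proof.
move=> us Tx; rewrite /sig; case: ifP => Ts; last first.
  by rewrite big_seq; apply: big1 => T' sT'; apply: (bump_other Tx); apply/eqP => E; rewrite -E sT' in Ts.
by rewrite (bigD1_seq T) //= big1 ?addr0 // => T' TT; exact: bump_other Tx TT.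
Qed.

Lemma sig_zone s T x : uniq s -> inzone T x -> sig s x = (T \in s)%:R.
Proof.
by move=> us Tx; rewrite (sig_cell us (inzone_cell Tx)); case: ifP => _ //; exact: bump_zone.
Qed.

Lemma sig_int s x l (t : nat) : L%:R * x ord0 l = t%:R -> sig s x = 0.
Proof.
move=> xl; apply: big1 => T _; apply/eqP/negPn/negP => /bump_neq0 /(_ l).
by rewrite xl !ltr_nat; lia.
Qed.

End Bumps.

Section Slab.
Context {R : realType} {q : nat}.
Local Notation p := (q.+2).
Local Notation n := (q + q.+1)%N.
Local Notation d := (n.+2).
Local Notation D := (n.+3).
Variables (K N : nat) (h0 : nat -> 'rV[R]_D -> R) (hh : nat -> 'I_p -> 'rV[R]_D -> R) (Lm dl : R).
Local Notation M := (nlab (q := q) K).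
Local Notation L := (N * M)%N.
Local Notation Gt := (@Gt R q n K N h0 hh Lm).
Local Notation conflict := (@conflict R q n K N h0 hh Lm).
Local Notation lab := (@lab q).
Hypothesis St : @stair R q n K N h0 hh Lm dl.
Let N0 := stair_N St.
Implicit Types (y z : 'rV[R]_D) (x : 'rV[R]_d) (T : {ffun 'I_d -> 'I_L}).

Lemma L_gt0 : (0 < L)%N.
Proof. by rewrite muln_gt0 N0. Qed.

Lemma Lr_gt0 : 0 < L%:R :> R.
Proof. by rewrite ltr0n L_gt0. Qed.

(* The 2p labels of the spheres i and j are distributed over the 2p coordinates. *)
Record labelled (i j : nat) (b : 'I_D -> nat) (E : 'I_p + 'I_p -> 'I_D) : Prop := Labelled {
  labelled_ij : i <> j;
  labelled_i : (i < K)%N;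
  labelled_j : (j < K)%N;
  labelled_inj : injective E;
  labelled_lt : forall e, (b e < L)%N;
  labelled_mod : forall u, (b (E u) %% M = slabel i j u)%N }.

Lemma labelled_surj i j b E : labelled i j b E -> forall e, exists u, E u = e.
Proof.
move=> lE e; have : bijective E.
  by apply: inj_card_bij; [exact: labelled_inj lE|rewrite card_sum !card_ord; lia].
by case=> E' _ EK; exists (E' e).
Qed.

Lemma labelled_sym i j b E : labelled i j b E ->
  labelled j i b (fun u => match u with inl l => E (inr l) | inr l => E (inl l) end).
Proof.
move=> [ij iK jK iE bL bE]; split=> // [/esym|[l|l] [l'|l'] /iE []|[l|l]] //.
- by move=> ->.
- by move=> ->.
Qed.

Lemma conflict_labelled y i j : conflict y i j -> exists b E,
  labelled i j b E /\ forall e, inz N M (b e) (y ord0 e).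
Proof.
move=> C; have [E [t [iE H]]] := conflict_inj St C.
have [E' EK E'K] : bijective E by apply: inj_card_bij; rewrite ?card_sum ?card_ord //; lia.
exists (fun e => t (E' e)), E; split; last by move=> e; have [_ + _] := H (E' e); rewrite E'K.
case: C => ij [iK _] [jK _]; split=> // [e|u]; first by have [] := H (E' e).
by rewrite EK; have [] := H u.
Qed.

(* The parameter of the homotopy is raised from tau / L to (tau + 1) / L over the
   cells listed in s. *)
Definition gs (tau : nat) (s : seq {ffun 'I_d -> 'I_L}) x : nat -> 'rV[R]_p.+1 :=
  Gt (yv ((tau%:R + sig s x) / L%:R) x).

(** Cells over which passing through slab [tau] can meet a conflict. *)
Definition hot (tau : nat) T : Prop := exists i j b E,
  [/\ labelled i j b E, b ord0 = tau & forall l, b (lift ord0 l) = T l].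

(** In a conflict every coordinate, the height included, lies in the middle half of a zone; so none
    occurs at a height that is a multiple of 1/L. *)
Lemma conflict_zone s x i j : conflict (yv s x) i j -> exists T,
  [/\ inzone T x, forall k : nat, L%:R * s != k%:R &
    forall tau : nat, tau%:R <= L%:R * s <= tau.+1%:R -> hot tau T].
Proof.
move=> /conflict_labelled[b [E [lE bz]]].
exists [ffun l => Ordinal (labelled_lt lE (lift ord0 l))]; split.
- by move=> l; have := bz (lift ord0 l); rewrite yvS ffunE.
- move=> k; apply/eqP => E0; have := bz ord0; rewrite yv0; exact: (inz_nat N0 E0).
- move=> tau ts; exists i, j, b, E; split=> // [|l]; last by rewrite ffunE.
  by have := bz ord0; rewrite yv0 => /(inz_cell N0 ts).
Qed.

Lemma mulLV (r : R) : L%:R * (r / L%:R) = r.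
Proof. by rewrite mulrC divfK // gt_eqF // Lr_gt0. Qed.

Lemma smap_gs tau s : uniq s -> smap (@cubeout R d) (gs tau s).
Proof.
move=> us; have ? := @cts_sig R d L s.
apply: (smap_Gt St) => [|x i j /conflict_zone[T [Tx /(_ (tau + (T \in s))%N)/eqP E _]]|x].
- by apply: cts_yv; [cts|exact: cts_id].
- by apply: E; rewrite mulLV natrD (sig_zone us Tx).
- exact: yv_out.
Qed.

(** Where all space coordinates are in middle halves of zones both ends have height (tau + 1)/L, at
    which there are no conflicts; elsewhere there are none at any height. *)
Lemma hom_gs_full tau s : uniq s -> (forall T, T \in s) -> hom (gs tau s) (gs tau.+1 [::]).
Proof.
move=> us sT; have ? := @cts_sig R d L s; have ? := @cts_sig R d L [::].
apply: (@hom_Gt R q n K N h0 hh Lm dl St (fun x => (tau%:R + sig s x) / L%:R)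
  (fun x => (tau.+1%:R + sig [::] x) / L%:R)); [by cts|by cts|].
move=> r x i j r01 /conflict_zone[T [Tx /(_ tau.+1)/eqP E _]]; apply: E.
rewrite (sig_zone us Tx) sT /sig big_nil addr0 mulr1n natr1.
by rewrite -mulrDl subrK mul1r mulLV.
Qed.

(** The heights differ only over [T], where they run between tau/L and (tau + 1)/L; a conflict met
    there would make [T] hot. *)
Lemma hom_gs_cold tau T s : uniq (T :: s) -> ~ hot tau T -> hom (gs tau (T :: s)) (gs tau s).
Proof.
move=> /andP[Ts us] nT; have ? := @cts_sig R d L s; have ? := @cts_sig R d L (T :: s).
apply: (@hom_Gt R q n K N h0 hh Lm dl St (fun x => (tau%:R + sig (T :: s) x) / L%:R)
  (fun x => (tau%:R + sig s x) / L%:R)); [by cts|by cts|].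
move=> r x i j r01 /conflict_zone[T' [T'x E H]].
have sE : sig (T :: s) x = bump T x + sig s x by rewrite /sig big_cons.
have : L%:R * ((1 - r) * ((tau%:R + sig (T :: s) x) / L%:R) + r * ((tau%:R + sig s x) / L%:R)) =
  tau%:R + ((1 - r) * bump T x + (T' \in s)%:R).
  have mL (c a : R) : L%:R * (c * (a / L%:R)) = c * a by rewrite mulrCA mulLV.
  by rewrite mulrDr !mL sE (sig_zone us T'x); ring.
have [TT|TT] := eqVneq T' T; last first.
  rewrite (bump_other (inzone_cell T'x)) 1?eq_sym // mulr0 add0r -natrD => F.
  by move: (E (tau + (T' \in s))%N); rewrite F eqxx.
move=> F; apply: nT; rewrite -TT; apply: H; rewrite F TT (negbTE Ts) addr0 -TT (bump_zone T'x).
by rewrite -addn1 natrD; lra.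
Qed.

End Slab.

(** * The two active spheres on one cell *)

Section Factors.
Context {R : realType} {q : nat}.
Local Notation p := (q.+2).
Local Notation n := (q + q.+1)%N.
Local Notation d := (n.+2).
Local Notation D := (n.+3).
Variables (K N : nat) (h0 : nat -> 'rV[R]_D -> R) (hh : nat -> 'I_p -> 'rV[R]_D -> R) (Lm dl : R).
Local Notation M := (nlab (q := q) K).
Local Notation L := (N * M)%N.
Local Notation Ft := (@Ft R q n K N h0 hh Lm).
Local Notation Gt := (@Gt R q n K N h0 hh Lm).
Local Notation neg := (@neg R q n K N h0 hh Lm).
Local Notation Phi := (@Phi R q n K N).
Local Notation lab := (@lab q).
Hypothesis St : @stair R q n K N h0 hh Lm dl.
Let N0 := stair_N St.
Variable b : 'I_D -> nat.
Implicit Types (y : 'rV[R]_D) (a i j k : nat) (E : 'I_p + 'I_p -> 'I_D).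

Definition incell_of y : Prop := forall e, (b e)%:R <= L%:R * y ord0 e <= (b e).+1%:R.

(* On the cell b all coordinates of the staircase k are constant, except the one
   with label k, whose position is r. *)
Definition Lv k (r : R) : 'rV[R]_D := \row_e (N%:R^-1 *
  ((b e %/ M)%:R + if (b e %% M == k)%N then r else (k < b e %% M)%N%:R)).
Definition hfac a : 'I_p -> R -> R := fun l r => hh a l (Lv (lab a l.+1) (cl r)).
Definition cfac a : R := h0 a (Lv (lab a 0) 0).

Lemma cts_Lv k : continuous (Lv k).
Proof.
by apply: cts_mkrow => e; case: (b e %% M == k)%N; [cts|exact: ctsc].
Qed.

Hypothesis bL : forall e, (b e < L)%N.

Lemma lattice_Lv k (c : bool) : @lattice R n N (Lv k c%:R).
Proof.
move=> e; exists (b e %/ M + (if b e %% M == k then c else (k < b e %% M)))%N.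
  have : (b e %/ M < N)%N by rewrite ltn_divLR.
  by case: ifP => _; [case: c|case: (k < _)%N]; lia.
by rewrite mxE natrD; case: ifP.
Qed.

Lemma cube_Lv0 k : cube (Lv k 0).
Proof.
have n0 : 0 < N%:R :> R by rewrite ltr0n.
move=> e; have [t tN ->] := @lattice_Lv k false e; apply/andP; split.
  by rewrite mulr_ge0 ?invr_ge0 ?ler0n.
by rewrite mulrC ler_pdivrMr // mul1r ler_nat.
Qed.

Lemma tame_hfac a : (a < K)%N -> tame dl (hfac a).
Proof.
move=> aK; have ? := @cts_cl R; split=> [l|l r r0|l r r1|l].
- by have ? := stair_hh St (j := a) (l := l); have ? := @cts_Lv (lab a l.+1); rewrite /hfac; cts.
- by rewrite /hfac !cl_low.
- by rewrite /hfac !cl_high.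
- rewrite /hfac cl_low // cl_high //; split; apply: (stair_lat St) => //.
    exact: (@lattice_Lv _ false).
  exact: (@lattice_Lv _ true).
Qed.

Lemma cfac_bound a : (a < K)%N -> 0 <= cfac a + Lm * dl.
Proof. by move=> aK; apply: (stair_bnd St) => //; exact: cube_Lv0. Qed.

Section Labelled.
Context {i j : nat} {E : 'I_p + 'I_p -> 'I_D}.
Hypothesis lE : labelled K N i j b E.

Lemma slabel_lt (u : 'I_p + 'I_p) : (slabel i j u < M)%N.
Proof.
by case: u => l; apply: lab_ltM; rewrite ?(labelled_i lE) ?(labelled_j lE).
Qed.

Lemma Phi_cell y (u : 'I_p + 'I_p) : incell_of y ->
  Phi (slabel i j u) y = Lv (slabel i j u) (cl (2 * (L%:R * y ord0 (E u) - (b (E u))%:R) - 2^-1)).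
Proof.
move=> yb; apply/rowP => e; rewrite !mxE (phi_local N0 (slabel_lt u) (bL e) (yb e)).
congr (_ * (_ + _)); case: ifP => // /eqP be; have [v vE] := labelled_surj St lE e.
have : slabel i j v = slabel i j u by rewrite -be -vE (labelled_mod lE).
by move/(slabel_inj (labelled_ij lE)) => <-; rewrite vE.
Qed.

Lemma Phi_free y k : (k < M)%N -> incell_of y -> (forall u : 'I_p + 'I_p, slabel i j u <> k) -> Phi k y = Lv k 0.
Proof.
move=> kM yb uk; apply/rowP => e; rewrite !mxE (phi_local N0 kM (bL e) (yb e)).
congr (_ * (_ + _)); case: ifP => // /eqP be; have [v vE] := labelled_surj St lE e.
by case: (uk v); rewrite -be -vE (labelled_mod lE).
Qed.

Lemma Ft_cell y : incell_of y -> Ft i y = prodv (cfac i) Lm (hfac i)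
  (\row_l (2 * (L%:R * y ord0 (E (inl l)) - (b (E (inl l)))%:R) - 2^-1)).
Proof.
move=> yb; have Eh l : hv K N hh i y l = hfac i l ((\row_l' (2 * (L%:R * y ord0 (E (inl l')) -
    (b (E (inl l')))%:R) - 2^-1)) ord0 l).
  by rewrite /hv /hfac mxE; congr (hh i l _); exact: (@Phi_cell y (inl l)).
have F0 : Phi (lab i 0) y = Lv (lab i 0) 0.
  apply: Phi_free => // [|[l|l]] /=; first by apply: lab_ltM => //; exact: labelled_i lE.
    by case/lab_inj.
  by case/lab_inj => // /esym; exact: labelled_ij lE.
rewrite /Ft /prodv F0 -/(cfac i); congr (consv (_ + _ * _) _); last exact/funext.
by apply: eq_bigr => l _; rewrite Eh.
Qed.

Lemma neg_cell a y : incell_of y -> neg a y ->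
  (a = i /\ forall l, inz N M (b (E (inl l))) (y ord0 (E (inl l)))) \/
  (a = j /\ forall l, inz N M (b (E (inr l))) (y ord0 (E (inr l)))).
Proof.
move=> yb na; have H (l : 'I_p) : exists u : 'I_p + 'I_p, slabel i j u = lab a l.+1 /\ inz N M (b (E u)) (y ord0 (E u)).
  have [e [t [tL tz tM]]] := neg_label St l na.
  have tb := inz_cell N0 (yb e) tz; have [u uE] := labelled_surj St lE e.
  by exists u; rewrite -(labelled_mod lE) uE -tb tM.
have ai : a = i \/ a = j.
  by have [[l|l] [/lab_inj[] // E0 _ _]] := H ord0; [left|right].
have ij := labelled_ij lE; case: ai => ai; [left|right]; split=> // l.
  have [[l'|l'] [/lab_inj[] // E0 E1 z]] := H l; last by case: ij; rewrite E0.
  by have <- : l' = l by apply/val_inj; case: E1.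
have [[l'|l'] [/lab_inj[] // E0 E1 z]] := H l; first by case: ij; rewrite E0.
by have <- : l' = l by apply/val_inj; case: E1.
Qed.

(** Every clamped argument is realised by a point of the cell, so nonvanishing is inherited from
    [stair_nz]. *)
Lemma prodv_neq0 w : prodv (cfac i) Lm (hfac i) w != 0.
Proof.
have [E' EK E'K] : bijective E.
  by apply: inj_card_bij; [exact: labelled_inj lE|rewrite card_sum !card_ord; lia].
have L0 : 0 < L%:R :> R by exact: (Lr_gt0 St).
pose r e : R := if E' e is inl l then (cl (w ord0 l) + 2^-1) / 2 else 0.
pose y : 'rV[R]_D := \row_e (((b e)%:R + r e) / L%:R).
have yE e : L%:R * y ord0 e = (b e)%:R + r e by rewrite mxE (mulLV St).
have yb : incell_of y.
  move=> e; rewrite yE -addn1 natrD /r; case: (E' e) => [l|_]; last by lra.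
  by have := cl01 (w ord0 l); lra.
have := stair_nz St y (labelled_i lE); rewrite (Ft_cell yb).
congr (_ != 0); rewrite /prodv.
have Eh l : hfac i l ((\row_l0 (2 * (L%:R * y ord0 (E (inl l0)) - (b (E (inl l0)))%:R) - 2^-1))
    ord0 l) = hfac i l (w ord0 l).
  have H (B c : R) : 2 * (B + (c + 2^-1) / 2 - B) - 2^-1 = c by field.
  by rewrite /hfac mxE yE /r EK H cl_id ?cl01.
by congr (consv (_ + _ * _) _); [apply: eq_bigr => l _; rewrite Eh|exact/funext].
Qed.

End Labelled.

End Factors.

Lemma Wgen_mid_e0 (R : realType) (m q : nat) (C : R) (u v : 'rV[R]_q.+2 -> nat -> 'rV[R]_m.+1) z j :
  smap (@cubeout R q.+2) u -> smap (@cubeout R q.+2) v -> lam z = 0 ->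
  Wgen (mid1 C) (mid2 C) u v z j = sphere_pt.
Proof.
move=> su sv l0; rewrite /Wgen /sup upart_e0 ?vpart_e0 ?addrK //; apply: inI_le0.
  rewrite /mid2 l0 [bb (Num.min _ _)]bb_low ?mulr0; first lra.
  by left; rewrite ge_min; apply/orP; right; lra.
rewrite /mid1 l0; have : Num.min (C * (1 - `|2 * z ord0 ord0 - 1|)) 0 <= 0.
  by rewrite ge_min lexx orbT.
by move: (Num.min _ _) => r; lra.
Qed.

Lemma bb_neq0 (R : realType) (r : R) : bb r != 0 -> cl (8 * Num.min r (1 - r)) = 1.
Proof.
rewrite /bb; move: (Num.min _ _) => s; case: clP => s0; rewrite ?eqxx //= => *;
  by apply: cl_high; lra.
Qed.

Lemma bb01 (R : realType) (r : R) : 0 <= bb r <= 1.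
Proof. exact: cl01. Qed.

(** * Crossing a hot cell *)

Section Hot.
Context {R : realType} {q : nat}.
Local Notation p := (q.+2).
Local Notation n := (q + q.+1)%N.
Local Notation d := (n.+2).
Local Notation D := (n.+3).
Local Notation V := 'rV[R]_p.+1.
Local Notation e0 := (sphere_pt : V).
Variables (K N : nat) (h0 : nat -> 'rV[R]_D -> R) (hh : nat -> 'I_p -> 'rV[R]_D -> R) (Lm dl : R).
Local Notation M := (nlab (q := q) K).
Local Notation L := (N * M)%N.
Local Notation Ft := (@Ft R q n K N h0 hh Lm).
Local Notation Gt := (@Gt R q n K N h0 hh Lm).
Local Notation neg := (@neg R q n K N h0 hh Lm).
Local Notation gs := (gs h0 hh Lm).
Hypothesis St : @stair R q n K N h0 hh Lm dl.
Let N0 := stair_N St.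
Variables (i j : nat) (b : 'I_D -> nat) (E : 'I_p + 'I_p -> 'I_D) (l0 : 'I_p).
Hypothesis lE : labelled K N i j b E.
Hypothesis El0 : E (inl l0) = ord0.
Variables (tau : nat) (T : {ffun 'I_d -> 'I_L}) (s : seq {ffun 'I_d -> 'I_L}).
Hypothesis Ts : uniq (T :: s).
Hypothesis b0 : b ord0 = tau.
Hypothesis bS : forall l, b (lift ord0 l) = T l.
Implicit Types x z : 'rV[R]_d.

Let bL := labelled_lt lE.
Let Lr0 : 0 < L%:R :> R := Lr_gt0 St.
Let us : uniq s. Proof. by case/andP: Ts. Qed.
Let Tns : T \notin s. Proof. by case/andP: Ts. Qed.

Let pi : {perm 'I_p} := tperm ord0 l0.
Let E1 (u : 'I_p + 'I_p) : 'I_D := match u with inl l => E (inl (pi l)) | inr l => E (inr l) end.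

Let E1_inj : injective E1.
Proof.
by move=> [l|l] [l'|l'] /(labelled_inj lE) // [/perm_inj ->].
Qed.

Let E10 : E1 (inl ord0) = ord0.
Proof. by rewrite /E1 tpermL. Qed.

(** Matches the coordinates of [Wgen] with the labels: the loop coordinate and the first block carry
    the labels of [j], the second block those labels of [i] that the height does not carry. [s0] is
    the resulting permutation of the space coordinates. *)
Let f0 (k : 'I_d) : 'I_p + 'I_p :=
  if unlift ord0 k is Some l then
    match fintype.split (l : 'I_(q.+1 + q.+1)) with
      inl l' => inr (lift ord0 l') | inr l' => inl (lift ord0 l') end
  else inr ord0.

Let f0_0 : f0 ord0 = inr ord0.
Proof. by rewrite /f0 unlift_none. Qed.

Let f0_ix l : f0 (ix l) = inr (lift ord0 l).
Proof. by rewrite /f0 /ix liftK (unsplitK (inl l)). Qed.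

Let f0_iy l : f0 (iy l) = inl (lift ord0 l).
Proof. by rewrite /f0 /iy liftK (unsplitK (inr l)). Qed.

Let f0_inj : injective f0.
Proof.
apply: ixyP => [|l|l]; apply: ixyP => [|l'|l']; rewrite ?f0_0 ?f0_ix ?f0_iy //;
  try (by move/eqP; rewrite ?(inj_eq inr_inj) ?(inj_eq inl_inj) ?(eq_sym ord0) (negbTE (neq_lift _ _)));
  by move=> [] => [/addnI] /val_inj ->.
Qed.

Let f0_neq k : E1 (f0 k) != ord0.
Proof.
rewrite -E10 (inj_eq E1_inj).
by move: k; apply: (@ixyP q) => [|l|l]; rewrite ?f0_0 ?f0_ix ?f0_iy.
Qed.

Let s0f k : 'I_d := odflt k (unlift ord0 (E1 (f0 k))).

Let s0fP k : lift ord0 (s0f k) = E1 (f0 k).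
Proof.
by rewrite /s0f; case: unliftP => [l ->//|E0]; case/eqP: (f0_neq k).
Qed.

Let s0f_inj : injective s0f.
Proof.
by move=> k k' /(congr1 (lift ord0)); rewrite !s0fP => /E1_inj /f0_inj.
Qed.

Let s0 : {perm 'I_d} := perm s0f_inj.
Let s0P k : lift ord0 (s0 k) = E1 (f0 k).
Proof. by rewrite permE s0fP. Qed.

Let k := s0 ord0.
Let Ek : E (inr ord0) = lift ord0 k.
Proof. by rewrite /k s0P f0_0. Qed.

Let rho x l : R := L%:R * x ord0 l - (T l)%:R.
(** In the coordinates of the cell, permuted by [s0], this is [lam], with direction [k] as the loop
    coordinate. *)
Let th x : R := \prod_(l | l != k) cl (8 * Num.min (rho x l) (1 - rho x l)).
Let lo l : R := (T l)%:R / L%:R.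
Let hi l : R := (T l).+1%:R / L%:R.
Let C : R := L%:R - (T k)%:R.
Let g := gs tau (T :: s).
Let g' := gs tau s.

Let sg : smap (@cubeout R d) g. Proof. exact: (smap_gs St). Qed.
Let sg' : smap (@cubeout R d) g'. Proof. exact: (smap_gs St). Qed.

Let TL l : (T l).+1%:R <= L%:R :> R.
Proof. by rewrite ler_nat. Qed.

Let TL' l : (T l).+1%:R < L%:R :> R.
Proof.
rewrite ltr_nat; have [u uE] := labelled_surj St lE (lift ord0 l).
have bM : (b (lift ord0 l) %% M < M.-1)%N.
  rewrite -uE (labelled_mod lE); case: u {uE} => a /=; apply: lab_lt => //.
    exact: labelled_i lE.
  exact: labelled_j lE.
have : (b (lift ord0 l) %/ M < N)%N by rewrite ltn_divLR.
have := divn_eq (b (lift ord0 l)) M; rewrite bS in bM *.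
rewrite /nlab /= in bM *; set W := (K * p.+1)%N in bM *; set Q := (_ %/ _)%N => TE QN.
have : (Q.+1 * W.+1 <= N * W.+1)%N by rewrite leq_mul2r QN orbT.
by rewrite mulSn TE; lia.
Qed.

Let C1 : 1 <= C.
Proof. by have := TL k; rewrite /C -addn1 natrD; lra. Qed.

Let cth : continuous th.
Proof. by have ? := @cts_cl R; apply: cts_prod => l; rewrite /rho; cts. Qed.

Let th01 x : 0 <= th x <= 1.
Proof.
apply/andP; split; first by apply: prodr_ge0 => l _; case/andP: (cl01 (8 * Num.min (rho x l) (1 - rho x l))).
by apply: prodr_ile1 => l _; exact: cl01.
Qed.

Let th_upd x r : th (upd x k r) = th x.
Proof. by apply: eq_bigr => l lk; rewrite /rho updN. Qed.

Let lohiE x l : (lo l <= x ord0 l) = (0 <= rho x l) /\ (x ord0 l <= hi l) = (rho x l <= 1).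
Proof.
rewrite /lo /hi /rho ler_pdivrMr // ler_pdivlMr // subr_ge0 lerBlDr -[(T l).+1]addn1 natrD.
by rewrite addrC mulrC.
Qed.

Let th_out x l : l != k -> ~~ (lo l < x ord0 l < hi l) -> th x = 0.
Proof.
move=> lk xl; rewrite /th (bigD1 l) //= cl_low ?mul0r //.
have : Num.min (rho x l) (1 - rho x l) <= 0; last by move: (Num.min _ _) => r; lra.
rewrite ge_min; move: xl; rewrite negb_and -!leNgt /lo /hi /rho ler_pdivlMr // ler_pdivrMr //.
by rewrite -[(T l).+1]addn1 natrD => /orP[] ?; apply/orP; [left|right]; lra.
Qed.

Let gE x : g x = Gt (yv ((tau%:R + (bump T x + sig s x)) / L%:R) x).
Proof. by rewrite /g /gs /sig big_cons. Qed.

Let gg' x a : [\/ x ord0 k <= lo k, hi k <= x ord0 k | th x < 1] -> g x a = g' x a.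
Proof.
move=> H; rewrite gE (_ : bump T x = 0) ?add0r //; apply/eqP/negPn/negP => bx.
have := bump_neq0 bx k; move: H; rewrite /lo /hi ler_pdivlMr // ler_pdivrMr //.
case=> H; [lra|lra|]; rewrite [th x]big1 ?ltxx // in H => l _.
apply: bb_neq0; apply: contraNN bx => /eqP E0.
by rewrite /bump (bigD1 l) //= E0 mul0r.
Qed.

Let incell_yv (sg0 : R) x : 0 <= sg0 <= 1 -> incell T x ->
  incell_of K N b (yv ((tau%:R + sg0) / L%:R) x).
Proof.
move=> s01 xT e; case: (unliftP ord0 e) => [l|] ->; first by rewrite yvS bS.
by rewrite yv0 (mulLV St) b0 -addn1 natrD; lra.
Qed.

Let Gt_e0 y a : ~ neg a y -> Gt y a = e0.
Proof.
move=> na; rewrite /Gt; case: ifP => // aK; apply: stc_e0; rewrite leNgt; apply/negP => F0.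
exact: na.
Qed.

(** On the bottom face the height is tau/L and coordinate [k] is a multiple of 1/L. The first fact
    silences sphere [i], the second sphere [j], and no other sphere is active on the cell. *)
Let g_bot x a : x ord0 k = lo k -> (forall l, l != k -> lo l <= x ord0 l <= hi l) -> g x a = e0.
Proof.
move=> xk xl; have rk : L%:R * x ord0 k = (T k)%:R by rewrite xk (mulLV St).
have xT : incell T x.
  move=> l; have [->|lk] := eqVneq l k; first by rewrite rk lexx ler_nat leqnSn.
  have := xl l lk; have [-> ->] := lohiE x l; rewrite /rho -[(T l).+1]addn1 natrD; lra.
have bx : bump T x = 0.
  by apply/eqP/negPn/negP => /bump_neq0 /(_ k); rewrite rk ltxx.
rewrite gE bx (sig_cell us xT) (negbTE Tns) addr0 addr0; apply: Gt_e0.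
have yT : incell_of K N b (yv ((tau%:R + 0) / L%:R) x) by apply: incell_yv; rewrite ?lexx ?ler01.
rewrite addr0 in yT; case/(neg_cell St lE yT) => -[_ H].
  by have := H l0; rewrite El0 yv0; apply: (inz_nat N0); rewrite (mulLV St).
by have := H ord0; rewrite Ek yvS; exact: (inz_nat N0 rk).
Qed.

(** Over the corner only coordinate [k] can be inside a zone. An active sphere would need all of its
    p >= 2 labels there, but a coordinate meets one label at a time. *)
Let g_corner x a : x ord0 k <= lo k -> (forall l, l != k -> x ord0 l = lo l) -> g x a = e0.
Proof.
move=> xk xl; have rl l : l != k -> L%:R * x ord0 l = (T l)%:R.
  by move=> /xl ->; rewrite (mulLV St).
have [l1 l1k] : exists l : 'I_d, l != k.
  by have [E0|] := eqVneq k ord0; [exists (lift ord0 ord0); rewrite E0 eq_sym neq_lift|exists ord0; rewrite eq_sym].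
have sg0 := sig_int _ (rl l1 l1k); rewrite /g /gs sg0 addr0; apply: Gt_e0 => na.
have H (l : 'I_p) : exists t, inz N M t (x ord0 k) /\ (t %% M = lab (q := q) a l.+1)%N.
  have [e [t [_ + tM]]] := neg_label St l na; case: (unliftP ord0 e) => [e'|] ->; last first.
    by rewrite yv0 => /(inz_nat N0 (mulLV St _)).
  rewrite yvS; have [->|ek] := eqVneq e' k; first by exists t.
  by move/(inz_nat N0 (rl e' ek)).
have [t [tz tM]] := H ord0; have [t' [tz' tM']] := H (lift ord0 ord0).
move: tM'; rewrite (inz_inj N0 tz tz') tM => /lab_inj [] //.
Qed.

Let hU w := stc (prodv (cfac K N h0 b i) Lm (hfac K N hh b i) w).
Let hV w := stc (prodv (cfac K N h0 b j) Lm (hfac K N hh b j) w).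
Let u : 'rV[R]_p -> nat -> V := single j hV.
Let v : 'rV[R]_p -> nat -> V := fun w => single i hU (permx pi w).
Let Mid x := Wgen (mid1 C) (mid2 C) u v (permx s0 x).

Let spec_i := cls_prodv (stair_dl St) (stair_Lm St) (cfac_bound St bL (labelled_i lE)) i
  (tame_hfac St bL (labelled_i lE)) (prodv_neq0 St bL lE).
Let spec_j := cls_prodv (stair_dl St) (stair_Lm St) (cfac_bound St bL (labelled_j lE)) j
  (tame_hfac St bL (labelled_j lE)) (prodv_neq0 St bL (labelled_sym lE)).

Let su : smap (@cubeout R p) u. Proof. by have [] := spec_j. Qed.
Let sv : smap (@cubeout R p) v. Proof. by apply: smap_permx; have [] := spec_i. Qed.

(** [u] is a multiple of iota_j and [v], up to a permutation of coordinates, one of iota_i. Integers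
    come out of the right factor by additivity; those on the left are first moved across by
    antisymmetry. *)
Lemma cls_Mid : exists c : int, cls Mid = wh (ioc i) (ioc j) *~ c.
Proof.
have [_ [ei Ei]] := spec_i; have [_ [ej Ej]] := spec_j.
have [bp Hp] := @cls_permx R p q pi; have [bs Hs] := @cls_permx R p n s0.
have [sa Hsa] := @wh_antisym R p q.
rewrite /Mid Hs; last by apply: smap_Wgen => //; exact: admissible_mid.
rewrite (cls_hom (hom_mid_wmap C1 su sv)) -wh_cls // /u Ej /v Hp; last by have [] := spec_i.
rewrite Ei !whMzr.
have -> (a b' : Pi R p q) (e : int) : wh (a *~ e) b' = wh b' a *~ (e * sa).
  by rewrite Hsa whMzr mulrzA.
by rewrite -!mulrzA; eexists.
Qed.

Let A x : 'rV[R]_d := \row_l (lo l + (hi l - lo l) * x ord0 l).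

Let AE x l : L%:R * A x ord0 l = (T l)%:R + x ord0 l.
Proof.
have H (a c w : R) : w != 0 -> w * (a / w + ((a + 1) / w - a / w) * c) = a + c by move=> ?; field.
by rewrite mxE /lo /hi -[(T l).+1]addn1 natrD H // gt_eqF.
Qed.

Let rhoA x l : rho (A x) l = x ord0 l.
Proof. by rewrite /rho AE addrC addKr. Qed.

Let thA x : th (A x) = lam (permx s0 x).
Proof.
rewrite /th /lam (reindex_inj (@perm_inj _ s0)) /=; apply: eq_big => [l|l lk].
  by rewrite /k (inj_eq perm_inj).
by rewrite rhoA mxE.
Qed.

(** Counted in zones, the point [X] has position [mn] in direction [k] and height [s1] above [tau];
    the stretching 2r - 1/2 turns these into [mid1] and [mid2]. *)
Let MidE x a : ~ cubeout x -> Mid x a = (if 2 * x ord0 k - 1 <= 0 then g else g')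
  (upd (A x) k (Num.min (1 - (1 - lo k) * `|2 * x ord0 k - 1|) (lo k + (hi k - lo k) * th (A x)))) a.
Proof.
move=> xo; have xI l : 0 < x ord0 l < 1 by apply: contrapT => /negP xl; apply: xo; exists l.
rewrite thA; set z := permx s0 x; set w := `|_|; set r := Num.min _ _; set X := upd _ _ _.
have z0 : z ord0 ord0 = x ord0 k by rewrite mxE.
have w0 : 0 <= w by exact: normr_ge0.
have w1 : w <= 1 by rewrite ler_norml; have := xI k; lra.
have l01 := lam01 z; have c1 := C1; have tK (t u' : R) : t + u' - t = u' by ring.
pose mn : R := Num.min (C * (1 - w)) (lam z).
have rE : L%:R * r = (T k)%:R + mn.
  have H (t W c : R) : W != 0 -> W * (1 - (1 - t / W) * c) = t + (W - t) * (1 - c).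
    by move=> ?; field.
  have H' (t W c : R) : W != 0 -> W * (t / W + ((t + 1) / W - t / W) * c) = t + c.
    by move=> ?; field.
  rewrite /r minr_pMr; last exact: ltW.
  rewrite /lo /hi -[in (T k).+1]addn1 natrD H ?gt_eqF // H' ?gt_eqF //.
  by rewrite -addr_minr.
have mn01 : 0 <= mn <= 1.
  rewrite /mn le_min ge_min; case/andP: l01 => -> ->; rewrite orbT !andbT.
  by rewrite mulr_ge0; lra.
have Xk : L%:R * X ord0 k = (T k)%:R + mn by rewrite updE.
have Xl l : l != k -> L%:R * X ord0 l = (T l)%:R + x ord0 l.
  by move=> lk; rewrite updN // AE.
have XT : incell T X.
  move=> l; rewrite -[(T l).+1]addn1 natrD; have [->|lk] := eqVneq l k; first by rewrite Xk; lra.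
  by rewrite Xl //; have := xI l; lra.
pose s1 : R := bprod z * bb (Num.min (2 * C * z ord0 ord0) (lam z)).
have s1E : (if 2 * x ord0 k - 1 <= 0 then g else g') X = Gt (yv ((tau%:R + s1) / L%:R) X).
  case: ifP => xk.
    have bE : bump T X = s1.
      rewrite /bump (bigD1 k) //= mulrC /s1; congr (_ * _).
        rewrite /bprod (reindex_inj (@perm_inj _ s0)) /=; apply: eq_big => [l|l lk].
          by rewrite /k (inj_eq perm_inj).
        by rewrite Xl // tK mxE.
      rewrite Xk tK /mn z0 /w ler0_norm //.
      by have -> : C * (1 - - (2 * x ord0 k - 1)) = 2 * C * x ord0 k by ring.
    by rewrite gE (sig_cell us XT) (negbTE Tns) addr0 bE.
  (* On the way down [g'] lacks the bump of [T]. The loop agrees because the minimum is then [lam],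
     and [bprod_lam] applies. *)
  have -> : s1 = 0.
    rewrite /s1 min_r ?bprod_lam // z0.
    apply: le_trans ((mulC_bounds C1 _).2 _); first by case/andP: l01.
    by move/negbT: xk; rewrite -ltNge; lra.
  by rewrite /g' /gs (sig_cell us XT) (negbTE Tns).
have s01 : 0 <= s1 <= 1.
  have /andP[a1 a2] := bb01 (Num.min (2 * C * z ord0 ord0) (lam z)).
  have a3 : 0 <= bprod z by apply: prodr_ge0 => l _; case/andP: (bb01 (z ord0 l)).
  have a4 : bprod z <= 1 by apply: prodr_ile1 => l _; exact: bb01.
  by rewrite /s1 mulr_ge0 // mulr_ile1.
have yT := incell_yv s01 XT; rewrite s1E; set y := yv _ _ in yT *.
pose cy e : R := 2 * (L%:R * y ord0 e - (b e)%:R) - 2^-1.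
have c0 : cy (E1 (inl ord0)) = mid2 C z.
  by rewrite E10 /cy yv0 (mulLV St) b0 tK.
have ck : cy (E1 (inr ord0)) = mid1 C z.
  by rewrite /cy /E1 Ek yvS bS Xk tK /mn /mid1 z0.
have cS l : cy (E1 (f0 l)) = (if l == ord0 then cy (E1 (inr ord0)) else 2 * z ord0 l - 2^-1).
  case: eqVneq => [->|l0']; first by rewrite f0_0.
  rewrite -s0P /cy yvS bS Xl; last by rewrite /k (inj_eq perm_inj).
  by rewrite tK mxE.
have vE : permx pi (consv (mid2 C z) (fun l => 2 * z ord0 (iy l) - 2^-1)) =
    \row_l (2 * (L%:R * y ord0 (E (inl l)) - (b (E (inl l)))%:R) - 2^-1).
  apply/rowP => l; rewrite [RHS]mxE -/(cy _) mxE.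
  have -> : E (inl l) = E1 (inl (pi l)) by rewrite /E1 tpermK.
  case: (unliftP ord0 (pi l)) => [l'|] ->; last by rewrite consv0 c0.
  by rewrite consvS -f0_iy cS.
have uE : consv (mid1 C z) (fun l => 2 * z ord0 (ix l) - 2^-1) =
    \row_l (2 * (L%:R * y ord0 (E (inr l)) - (b (E (inr l)))%:R) - 2^-1).
  apply/rowP => l; rewrite [RHS]mxE -/(cy _) -[E (inr l)]/(E1 (inr l)).
  case: (unliftP ord0 l) => [l'|] ->; last by rewrite consv0 ck.
  by rewrite consvS -f0_ix cS.
have ij := labelled_ij lE; have [iK jK] := (labelled_i lE, labelled_j lE).
rewrite /Mid /Wgen /sup /upart /vpart /u /v uE vE /single.
have [ai|ai] := eqVneq a i.
  rewrite ai (negbTE (introN eqP ij)) addrC addKr /Gt iK.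
  by rewrite (Ft_cell St bL lE yT).
have [aj|aj] := eqVneq a j.
  by rewrite aj addrK /Gt jK (Ft_cell St bL (labelled_sym lE) yT).
rewrite addrK; apply/esym/Gt_e0; case/(neg_cell St lE yT) => -[E0 _]; first by rewrite E0 eqxx in ai.
by rewrite E0 eqxx in aj.
Qed.

(** The case in which the height carries a label of the first sphere; the other one follows by
    exchanging [i] and [j]. *)
Lemma cls_hot_first : exists c : int, cls g = cls g' + wh (ioc i) (ioc j) *~ c.
Proof.
have [c Hc] := cls_Mid; exists c; rewrite -Hc; apply/eqP; rewrite addrC -subr_eq; apply/eqP.
have k0 := ler0n R (T k); have kL := TL k; rewrite -[(T k).+1]addn1 natrD in kL.
apply: (@cls_difference R p n g g' k lo hi (lo k) (hi k) th sg sg') => //.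
- rewrite /lo /hi; split; first by rewrite divr_ge0 // ltW.
    by rewrite ltr_pM2r ?invr_gt0 // ltr_nat.
  by rewrite ler_pdivrMr // mul1r.
- move=> l lk; rewrite /lo /hi; split; first by rewrite divr_ge0 // ltW.
    by rewrite ltr_pM2r ?invr_gt0 // ltr_nat.
  by rewrite ltr_pdivrMr // mul1r.
- by move=> x a xo _; exact: MidE.
- move=> x a [xo|]; last by rewrite -/(A x) thA => l0'; exact: Wgen_mid_e0.
  have [_ _ _ zW] : smap (@cubeout R d) (Wgen (mid1 C) (mid2 C) u v).
    by apply: smap_Wgen => //; exact: admissible_mid.
  by apply: zW; exact: cubeout_permx.
Qed.

End Hot.

(** * The sweep through all slabs *)

Section Sweep.
Context {R : realType} {q : nat}.
Local Notation p := (q.+2).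
Local Notation n := (q + q.+1)%N.
Local Notation d := (n.+2).
Local Notation D := (n.+3).
Variables (K N : nat) (h0 : nat -> 'rV[R]_D -> R) (hh : nat -> 'I_p -> 'rV[R]_D -> R) (Lm dl : R).
Local Notation M := (nlab (q := q) K).
Local Notation L := (N * M)%N.
Local Notation Gt := (@Gt R q n K N h0 hh Lm).
Local Notation gs := (@gs R q K N h0 hh Lm).
Local Notation io := (@ioc R q).
Hypothesis St : @stair R q n K N h0 hh Lm dl.
Implicit Types (T : {ffun 'I_d -> 'I_L}) (s : seq {ffun 'I_d -> 'I_L}) (a : Pi R p n).

Definition whspan a : Prop := exists c : nat -> nat -> int,
  a = \sum_(i < K) \sum_(j < K | (i < j)%N) wh (io i) (io j) *~ c i j.

Lemma whspan0 : whspan 0.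
Proof.
by exists (fun _ _ => 0); rewrite big1 // => i _; rewrite big1 // => j _; rewrite mulr0z.
Qed.

Lemma whspanD a a' : whspan a -> whspan a' -> whspan (a + a').
Proof.
move=> [c ->] [c' ->]; exists (fun i j => c i j + c' i j).
rewrite -big_split; apply: eq_bigr => i _; rewrite -big_split; apply: eq_bigr => j _.
by rewrite mulrzDr.
Qed.

Lemma whspan_wh i j (e : int) : i <> j -> (i < K)%N -> (j < K)%N ->
  whspan (wh (io i) (io j) *~ e).
Proof.
have H i' j' (e' : int) : (i' < j')%N -> (j' < K)%N -> whspan (wh (io i') (io j') *~ e').
  move=> ij jK; have iK := ltn_trans ij jK.
  exists (fun i1 j1 => if (i1 == i') && (j1 == j') then e' else 0).
  rewrite (bigD1 (Ordinal iK)) //= [X in _ + X]big1 ?addr0; last first.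
    move=> l; rewrite -val_eqE /= => /negbTE li; apply: big1 => l' _.
    by rewrite li mulr0z.
  rewrite (bigD1 (Ordinal jK)) //= [X in _ + X]big1 ?addr0 ?eqxx // => l /andP[_].
  by rewrite -val_eqE /= => /negbTE ->; rewrite ?andbF mulr0z.
move=> ij iK jK; have [lt|lt|//] := ltngtP i j; first exact: H.
by have [s Hs] := @wh_antisym R p q; rewrite Hs -mulrzA; exact: H.
Qed.

Lemma whspan_step tau T s : uniq (T :: s) ->
  whspan (cls (gs tau (T :: s))) -> whspan (cls (gs tau s)).
Proof.
move=> us; have [|nT] := pselect (hot tau T); last first.
  by rewrite (cls_hom (hom_gs_cold St us nT)).
move=> [i [j [b [E [lE b0 bS]]]]].
have H i' j' E' l : labelled K N i' j' b E' -> E' (inl l) = ord0 ->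
    whspan (cls (gs tau (T :: s))) -> whspan (cls (gs tau s)).
  move=> lE' El; have [c Hc] := cls_hot_first St lE' El us b0 bS.
  have Sc := whspan_wh (- c) (labelled_ij lE') (labelled_i lE') (labelled_j lE').
  by move=> /whspanD/(_ Sc); rewrite Hc mulrNz addrK.
have [[l|l] El] := labelled_surj St lE ord0; first exact: H lE El.
by apply: (H j i _ l (labelled_sym lE)).
Qed.

Lemma whspan_slab tau s : uniq s -> whspan (cls (gs tau s)) -> whspan (cls (gs tau [::])).
Proof.
elim: s => // T s IH us /(whspan_step us) H; apply: IH => //.
by case/andP: us.
Qed.

(** At height 1 the map is constant. Descending slab by slab, each slab is entered with all cells
    raised, and lowering them one at a time changes the class by multiples of Whitehead products. *)
Lemma whspan_Gt0 : whspan (cls (fun x => Gt (yv 0 x))).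
Proof.
have H t : whspan (cls (gs (L - t) [::])).
  elim: t => [|t IH]; last first.
    have [tL|tL] := ltnP t L; last first.
      by have -> : (L - t.+1 = L - t)%N by lia.
    have E : (L - t = (L - t.+1).+1)%N by lia.
    apply: (@whspan_slab _ (enum {: {ffun 'I_d -> 'I_L}})); first exact: enum_uniq.
    rewrite (cls_hom (hom_gs_full St _ (enum_uniq _) _)) -?E // => T.
    by rewrite mem_enum.
  rewrite subn0; have -> : gs L [::] = basemap; last by rewrite cls_base; exact: whspan0.
  apply/funext => x; apply/funext => j; apply: (Gt_out St); left; rewrite yv0 /sig big_nil addr0.
  by rewrite divff // gt_eqF // (Lr_gt0 St).
have := H L; rewrite subnn.
by congr (whspan (cls _)); apply/funext => x; rewrite /gs /sig big_nil addr0 mul0r.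
Qed.

End Sweep.

(** * Staircase approximation of nullhomotopies *)

Section StairExists.
Context {R : realType} {q n : nat}.
Local Notation p := (q.+2).
Local Notation d := (n.+2).
Local Notation D := (n.+3).
Local Notation V := 'rV[R]_p.+1.
Local Notation e0 := (sphere_pt : V).
Implicit Types (y z : 'rV[R]_D) (x : 'rV[R]_d).

(** If the perturbed tail vanishes, so does the penalty, and the original tail has sum of absolute
    values at most 2pe. The head of [v] then has size at least 2e, which an error of [e] cannot
    cancel. *)
Lemma near_neq0 (v : V) (c A e : R) (mx : 'I_p -> R) : 0 < e -> 2 * p.+1%:R * e <= nm v ->
  `|c - v ord0 ord0| <= e -> (forall l, `|mx l - v ord0 (lift ord0 l)| <= 2 * e) ->
  consv (c + A * \sum_l `|mx l|) mx != 0.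
Proof.
move=> e0' nv cv mv; apply/row_neq0P.
have [z|[l lz]] : (forall l, mx l = 0) \/ exists l, mx l <> 0.
  by have [?|/existsNP] := pselect (forall l, mx l = 0); [left|right].
  left; rewrite consv0 big1 ?mulr0 ?addr0 => [c0|l _]; last by rewrite z normr0.
  have : nmt v <= \sum_(l < p) (2 * e).
    by apply: ler_sum => l _; have := mv l; rewrite z sub0r normrN.
  rewrite sumr_const card_ord -mulr_natl; move: nv; rewrite /nm -addn1 natrD.
  move: cv; rewrite c0 sub0r normrN; move: (nmt v) `|v _ _| (p%:R : R) => S a P; nra.
by right; exists l; rewrite consvS.
Qed.

Lemma seq_lower (f : nat -> R) k : (forall j, 0 < f j) ->
  exists2 r, 0 < r <= 1 & forall j, (j < k)%N -> r <= f j.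
Proof.
move=> f0; have [|r r0 H] := @seq_min R (1 :: [seq f j | j <- iota 0 k]).
  by move=> x; rewrite inE => /orP[/eqP -> //|/mapP[j _ ->]].
exists r => [|j jk]; first by rewrite r0 H ?mem_head.
by apply: H; rewrite inE; apply/orP; right; apply: map_f; rewrite mem_iota.
Qed.

Lemma exists_stair k (a : Pi R p n) : pr (fun j => j <= k)%N a = a ->
  (forall j, pr (pred1 j) a = 0) ->
  exists N h0 hh Lm dl, @stair R q n k.+1 N h0 hh Lm dl /\
    a = cls (fun x => @Gt R q n k.+1 N h0 hh Lm (yv 0 x)).
Proof.
move=> ak a1; have sa := smap_rep a; have ? := @cts_cl R.
pose f x := coll (fun j => j <= k)%N (rep a x).
have sf : smap (@cubeout R d) f by exact: tmap_coll.
have fa : cls f = a by rewrite -pr_cls // cls_rep.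
have sfj j : smap (@cubeout R d) (fun x => coll (pred1 j) (f x)).
  exact: (tmap_coll (pred1 j) sf).
have /choice[H HP] : forall j, exists H, [/\ smap (@cylout R d) H,
    forall x i, H (0, x) i = coll (pred1 j) (f x) i & forall x i, H (1, x) i = e0].
  move=> j; have : hom (fun x => coll (pred1 j) (f x)) basemap.
    apply/clsP => //; first exact: smap_base.
    by rewrite -pr_cls // fa a1.
  by case=> H ?; exists H.
pose tl y : 'rV[R]_d := \row_l y ord0 (lift ord0 l).
(* The nullhomotopy of the projection to sphere [j] as a function of all coordinates, coordinate 0
   being time; for y0 <= 0 it is the original map. *)
pose F j y : V := H j (cl (y ord0 ord0), tl y) j.
have ctl : continuous tl by apply: cts_mkrow => l; cts.
have cF j : continuous (F j).
  have [[cH _ _ _] _ _] := HP j; apply: (cts_comp (cH j)); apply: cts_pair; cts.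
have nF j y : F j y != 0 by have [[_ nH _ _] _ _] := HP j; exact: nH.
have F_out j y : outY y -> F j y = e0.
  have [[_ _ _ zH] _ H1] := HP j; case=> [y0|[l yl]].
    by rewrite /F cl_high.
  by apply: zH; exists l; rewrite mxE.
have F0 j x : F j (yv 0 x) = f x j.
  have [_ H0 _] := HP j; rewrite /F yv0 cl_low // (_ : tl _ = x) ?H0 /coll /= ?eqxx //.
  by apply/rowP => l; rewrite mxE yvS.
(* Values depend only on the clamped point, so bounds on the compact cube hold everywhere. *)
have F_cl j y : F j y = F j (ccl y).
  have [[l yl]|yl] := pselect (exists l : 'I_d, ~~ inI (y ord0 (lift ord0 l))).
    rewrite !F_out //; right; exists l => //; rewrite mxE.
    by case/out_cases: yl => yl; [rewrite cl_low|rewrite cl_high]; rewrite // /inI ltxx ?andbF.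
  rewrite /F mxE (cl_id (cl01 _)); congr (H j (_, _) j); apply/rowP => l; rewrite !mxE cl_id //.
  have : inI (y ord0 (lift ord0 l)) by apply: contrapT => /negP ?; apply: yl; exists l.
  by rewrite /inI; lra.
have cn j : continuous (fun y => nm (F j y)).
  have ? := cF j; have ? := cts_nmt (cF j); rewrite /nm; cts.
have /choice[dj Hdj] : forall j, exists dj, 0 < dj /\ forall y, dj <= nm (F j y).
  move=> j; have [dj d0 Hd] := cube_min (cn j) (fun y => nm_gt0 (nF j y)).
  by exists dj; split=> // y; rewrite F_cl; apply: Hd; exact: cube_ccl.
have [d0 /andP[d00 d01] Hd0] := seq_lower k.+1 (fun j => (Hdj j).1).
(* The tolerance of [near_neq0], taken from a common lower bound [d0] for the norms of the k + 1
   nullhomotopies. *)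
pose e : R := d0 / (2 * p.+1%:R).
have P0 : 0 < 2 * p.+1%:R :> R by rewrite mulr_gt0 ?ltr0n.
have ep : 0 < e by rewrite divr_gt0.
have eE : 2 * p.+1%:R * e = d0 by rewrite /e mulrC divfK // gt_eqF.
have e1 : e <= 1.
  rewrite /e ler_pdivrMr // mul1r (le_trans d01) //.
  by have : 1 <= p.+1%:R :> R; [rewrite ler1n|lra].
have nme j y : (j < k.+1)%N -> 2 * p.+1%:R * e <= nm (F j y).
  by move=> jk; rewrite eE; apply: le_trans (Hd0 j jk) ((Hdj j).2 y).
have cFc j (c : 'I_p.+1) : continuous (fun y => F j y ord0 c).
  by have ? := cF j; cts.
have /choice[Nf HNf] : forall jc : 'I_k.+1 * 'I_p.+1, exists N0 : nat, forall N, (N0 <= N)%N ->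
    forall y z, cube y -> (forall l, `|y ord0 l - z ord0 l| <= N.+1%:R^-1) ->
    `|F jc.1 y ord0 jc.2 - F jc.1 z ord0 jc.2| <= e.
  by move=> [j c]; exact: (cube_unif (cFc j c) ep).
(* Fine enough that reading any coordinate of any [F j] through staircases changes it by at most
   [e]. *)
pose N := (\max_jc Nf jc).+1.
have close j (c : 'I_p.+1) l y : (j < k.+1)%N -> (l < nlab (q := q) k.+1)%N ->
    `|F j y ord0 c - F j (Phi (q := q) k.+1 N l y) ord0 c| <= e.
  move=> jk lM; rewrite F_cl; apply: (HNf (Ordinal jk, c) N.-1).
  - exact: (leq_bigmax (Ordinal jk, c)).
  - exact: cube_ccl.
  - by move=> i; rewrite !mxE; exact: phi_close.
pose zz (g : {ffun 'I_D -> 'I_N.+1}) : 'rV[R]_D := \row_i (N%:R^-1 * (g i : nat)%:R).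
have zzP z : @lattice R n N z -> exists g, z = zz g.
  move=> lz; have /choice[g Hg] : forall i, exists g : 'I_N.+1, z ord0 i = N%:R^-1 * (g : nat)%:R.
    by move=> i; have [t tN ->] := lz i; exists (Ordinal (tN : (t < N.+1)%N)).
  by exists [ffun i => g i]; apply/rowP => i; rewrite mxE ffunE.
(* There are finitely many lattice points, hence finitely many values to avoid. A shift [eta] off
   these values keeps all tail coordinates nonzero on the lattice, and being at most [e] it stays
   within the tolerance. *)
pose hv0 (t : 'I_k.+1 * {ffun 'I_D -> 'I_N.+1} * 'I_p) : R :=
  - F t.1.1 (zz t.1.2) ord0 (lift ord0 t.2).
have [eta /andP[eta0 etae] Heta] := avoid_seq (codom hv0) ep.
pose hh j (l : 'I_p) z : R := F j z ord0 (lift ord0 l) + eta.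
pose h0 j z : R := F j z ord0 ord0.
have [dl dl0 Hdl] : exists2 dl, 0 < dl & forall j l z, (j < k.+1)%N -> @lattice R n N z ->
    dl <= `|hh j l z|.
  have [|dl dl0 Hdl] := @seq_min R (codom (fun t => `|eta - hv0 t|)).
    move=> r /codomP[t ->]; rewrite normr_gt0 subr_eq0 eq_sym; apply: Heta.
    exact: codom_f.
  exists dl => // j l z jk /zzP[g ->]; apply: Hdl; apply/codomP.
  by exists (Ordinal jk, g, l); rewrite /hh /hv0 /= opprK addrC.
have /choice[Cj HC] : forall j, exists C, 0 < C /\ forall y, cube y -> - F j y ord0 ord0 <= C.
  move=> j; have cm : continuous (fun y => - F j y ord0 ord0) by have ? := cFc j ord0; cts.
  by have [C C0 HC] := cube_max cm; exists C.
(* Large enough that a tail coordinate of size [dl] outweighs the most negative head on the cube. *)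
pose Lm : R := (\sum_(j < k.+1) Cj j) / dl.
have Lm0 : 0 <= Lm by rewrite divr_ge0 ?(ltW dl0) // sumr_ge0 // => j _; exact/ltW/(HC j).1.
have mixE j l y : (j < k.+1)%N ->
    `|hv (q := q) k.+1 N hh j y l - F j y ord0 (lift ord0 l)| <= 2 * e.
  move=> jk; have lM : (lab (q := q) j l.+1 < nlab (q := q) k.+1)%N by exact: lab_ltM.
  have := close j (lift ord0 l) _ y jk lM; rewrite /hv /hh.
  set u := F j y _ _; set w := F j (Phi _ _ _ _) _ _; rewrite distrC => uw.
  rewrite addrAC; apply: (le_trans (ler_normD _ _)); rewrite (gtr0_norm eta0); lra.
have c0E j y : (j < k.+1)%N ->
    `|h0 j (Phi (q := q) k.+1 N (lab (q := q) j 0) y) - F j y ord0 ord0| <= e.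
  by move=> jk; rewrite distrC; apply: close => //; exact: lab_ltM.
have St : @stair R q n k.+1 N h0 hh Lm dl.
  split=> //.
  - by move=> j; exact: cFc.
  - by move=> j l; have ? := cFc j (lift ord0 l); rewrite /hh; cts.
  - move=> j z jk zc; rewrite /Lm divfK ?gt_eqF // /h0; have := (HC j).2 z zc.
    have : Cj j <= \sum_(j < k.+1) Cj j.
      by rewrite (bigD1 (Ordinal jk)) //= lerDl sumr_ge0 // => i _; exact/ltW/(HC i).1.
    by move: (\sum_(_ < _) _) => S; lra.
  - by move=> j y jk; apply: (near_neq0 _ ep (nme j y jk)); [exact: c0E|move=> l; exact: mixE].
  - by move=> j z jk zo; rewrite /h0 F_out // e00 ler01.
exists N, h0, hh, Lm, dl; split=> //; rewrite -fa; apply: cls_hom.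
apply: (hom_trans (hom_stc sf)).
pose mx j (r : R * 'rV[R]_d) l := (1 - cl r.1) * f r.2 j ord0 (lift ord0 l) +
  cl r.1 * hv (q := q) k.+1 N hh j (yv 0 r.2) l.
pose m0 j (r : R * 'rV[R]_d) := (1 - cl r.1) * f r.2 j ord0 ord0 +
  cl r.1 * h0 j (Phi (q := q) k.+1 N (lab (q := q) j 0) (yv 0 r.2)).
(* Mixes the map with its staircase version while the penalty grows from 0. Where the map is at the
   base point the head stays nonnegative because e <= 1. *)
pose P (r : R * 'rV[R]_d) j : V := if (j < k.+1)%N then
  consv (m0 j r + cl r.1 * Lm * \sum_l `|mx j r l|) (mx j r) else e0.
have mixn (s u v w : R) : 0 <= s <= 1 -> `|v - u| <= w -> `|(1 - s) * u + s * v - u| <= w.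
  move=> s01 uv; have -> : (1 - s) * u + s * v - u = s * (v - u) by ring.
  rewrite normrM ger0_norm; last by lra.
  by have := normr_ge0 (v - u); nra.
have nP r j : P r j != 0.
  rewrite /P; case: ltnP => jk; last exact: e0_neq0.
  apply: (near_neq0 (v := F j (yv 0 r.2)) _ ep (nme j _ jk)).
    by rewrite F0; apply: mixn; [exact: cl01|rewrite -F0; exact: c0E].
  by move=> l; rewrite F0; apply: mixn; [exact: cl01|rewrite -F0; exact: mixE].
have P_ge0 r j : f r.2 j = e0 -> 0 <= P r j ord0 ord0.
  move=> fe; rewrite /P; case: ltnP => jk; last by rewrite e00 ler01.
  rewrite consv0 addr_ge0 //; last first.
    apply: mulr_ge0; last by apply: sumr_ge0 => l _; exact: normr_ge0.
    by apply: mulr_ge0 => //; case/andP: (cl01 r.1).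
  rewrite /m0 fe e00; have := c0E j (yv 0 r.2) jk; rewrite F0 fe e00 ler_distl => /andP[h _].
  by have := cl01 r.1; move: (h0 j _) h => H0 h; nra.
exists (fun r j => stc (P r j)); split=> [|x j|x j].
- apply: smap_stc; have [cf nf df zf] := sf.
  have ? : continuous (fun r : R * 'rV[R]_d => yv 0 r.2) by apply: cts_yv; cts.
  split=> // [j|r i j ij|[r x] xo j].
  + rewrite /P; case: (j < k.+1)%N; last exact: ctsc.
    have cfr c : continuous (fun r : R * 'rV[R]_d => f r.2 j ord0 c).
      by have ? : continuous (fun r : R * 'rV[R]_d => f r.2 j) by
        [apply: (cts_comp (cf j)); cts]; cts.
    have cFP c l : continuous (fun r : R * 'rV[R]_d => F j (Phi (q := q) k.+1 N l (yv 0 r.2)) ord0 c).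
      by apply: (cts_comp (cFc j c)); apply: (cts_comp (@cts_Phi R q n k.+1 N l)).
    have cm l : continuous (fun r => mx j r l).
      apply: ctsD; apply: ctsM; [by cts|exact: cfr|by cts|].
      by apply: ctsD; [exact: cFP|exact: ctsc].
    have cm0 : continuous (m0 j).
      by apply: ctsD; apply: ctsM; [by cts|exact: cfr|by cts|exact: cFP].
    by apply: cts_consv => //; apply: ctsD => //; apply: ctsM; [cts|apply: cts_sum => l _; apply: ctsabs].
  + by case: (df r.2 i j ij) => E; [left|right]; exact: P_ge0.
  + by apply: P_ge0; exact: zf.
- rewrite /P; case: ltnP => jk; last first.
    by congr stc; rewrite /f /coll -ltnS ltnNge jk.
  congr stc; rewrite /m0 /= cl_low // !mul0r subr0 mul1r !addr0 -[RHS]consv_eta.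
  by congr consv; apply/funext => l; rewrite /mx /= cl_low // subr0 mul1r mul0r addr0.
- rewrite /P /Gt; case: ltnP => jk; last by rewrite stc_e0 // e00 ler01.
  congr stc; have mE l : mx j (1, x) l = hv (q := q) k.+1 N hh j (yv 0 x) l.
    by rewrite /mx /= cl_high // subrr mul0r add0r mul1r.
  rewrite /Ft /m0 /= cl_high // subrr mul0r add0r !mul1r; congr consv; last exact/funext.
  by congr (_ + _ * _); apply: eq_bigr => l _; rewrite mE.
Qed.

End StairExists.

Lemma wh_generate (R : realType) (q k : nat) (a : Pi R q.+2 (q + q.+1)) :
  pr (fun j => j <= k)%N a = a -> (forall j, pr (pred1 j) a = 0) ->
  exists c : nat -> nat -> int, a = \sum_(i < k.+1) \sum_(j < k.+1 | (i < j)%N)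
    wh (@ioc R q i) (@ioc R q j) *~ c i j.
Proof.
move=> ak a1; have [N [h0 [hh [Lm [dl [St ->]]]]]] := exists_stair ak a1.
exact: (whspan_Gt0 St).
Qed.

Lemma no_cross_small (R : realType) (q n k : nat) (a : Pi R q.+2 n) : (n.+3 < 2 * q.+2)%N ->
  pr (fun j => j <= k)%N a = a -> (forall j, pr (pred1 j) a = 0) -> a = 0.
Proof.
move=> nq ak a1; have [N [h0 [hh [Lm [dl [St ->]]]]]] := exists_stair ak a1.
exact: (cls_Gt_small St).
Qed.

(** * Maps into the wedge and families of maps *)

Section WedgePoints.
Context {R : realType} {m : nat}.
Local Notation V := 'rV[R]_m.+1.
Local Notation e0 := (sphere_pt : V).
Local Notation wedge := (wpt R m).
Implicit Types (v : V) (w : wedge) (u : nat -> V).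

Definition cmp w : nat -> V := fun j => if w is Some (i, v) then if j == i then v else e0 else e0.

Lemma cmp_wincl i v j : cmp (wincl i v) j = if j == i then v else e0.
Proof. by rewrite /wincl; case: eqP => [->|_] //; rewrite if_same. Qed.

Lemma sphere_neq0 v : sphere v -> v != 0.
Proof.
move=> sv; apply/eqP => v0; move: sv; rewrite /sphere /= v0 big1 => [/eqP|i _].
  by rewrite eq_sym oner_eq0.
by rewrite mxE expr0n.
Qed.

Lemma sphere_e0 : sphere e0.
Proof.
rewrite /sphere /= (bigD1 ord0) //= big1 => [|i i0]; first by rewrite mxE !eqxx expr1n addr0.
by rewrite mxE (negbTE i0) andbF expr0n.
Qed.

Definition sqn v : R := \sum_(i < m.+1) (v ord0 i) ^+ 2.
Definition nrm v : V := (Num.sqrt (sqn v))^-1 *: v.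

Lemma sqn_gt0 v : v != 0 -> 0 < sqn v.
Proof.
move=> v0; rewrite lt_neqAle sumr_ge0 ?andbT => [|i _]; last exact: sqr_ge0.
apply/eqP => /esym /psumr_eq0P H; move/eqP: v0; apply; apply/rowP => i; rewrite mxE.
by apply/eqP; rewrite -sqrf_eq0; apply/eqP; apply: H => // j _; exact: sqr_ge0.
Qed.

Lemma sphere_nrm v : v != 0 -> sphere (nrm v).
Proof.
move=> /sqn_gt0 v0; rewrite /sphere /= /nrm.
under eq_bigr do rewrite mxE exprMn.
by rewrite -mulr_sumr exprVn sqr_sqrtr ?ltW // mulVf // gt_eqF.
Qed.

Lemma nrm_id v : sphere v -> nrm v = v.
Proof. by rewrite /sphere /= /nrm /sqn => ->; rewrite sqrtr1 invr1 scale1r. Qed.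

Lemma cts_nrm (T : topologicalType) (f : T -> V) : (forall t, f t != 0) -> continuous f ->
  continuous (fun t => nrm (f t)).
Proof.
move=> f0 cf; apply: ctsVZ => //; apply: ctsV => [t|].
  by rewrite gt_eqF // sqrtr_gt0 sqn_gt0.
apply: (cts_comp (@sqrt_continuous R)); apply: cts_sum => i _.
by rewrite (_ : (fun t => _) = fun t => f t ord0 i * f t ord0 i) //; cts.
Qed.

Definition disjv u : Prop := forall i j, i != j -> u i = e0 \/ u j = e0.

(** Inverse of [cmp] on disjointly supported families: the component with index in [J] that differs
    from [e0], if there is one, is pushed radially onto its sphere. *)
Definition from (J : set nat) u : wedge :=
  if pselect (exists j, J j /\ u j <> e0) is left H
  then wincl (sval (cid H)) (nrm (u (sval (cid H)))) else b0.

Lemma from_some J u j : disjv u -> J j -> u j <> e0 -> from J u = wincl j (nrm (u j)).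
Proof.
move=> du Jj uj; rewrite /from; case: pselect => [H|[]]; last by exists j.
case: cid => i [Ji ui] /=; have [-> //|ij] := eqVneq i j.
by case: (du i j ij).
Qed.

Lemma from_none J u : (forall j, J j -> u j = e0) -> from J u = b0.
Proof. by move=> u0; rewrite /from; case: pselect => // -[j [Jj uj]]; case: uj; exact: u0. Qed.

Lemma fromP J u : disjv u -> (exists j, [/\ J j, u j <> e0 & from J u = wincl j (nrm (u j))]) \/
  ((forall j, J j -> u j = e0) /\ from J u = b0).
Proof.
move=> du; have [[j [Jj uj]]|nu] := pselect (exists j, J j /\ u j <> e0).
  by left; exists j; split=> //; exact: from_some.
have u0 j : J j -> u j = e0 by move=> Jj; apply: contrapT => uj; apply: nu; exists j.
by right; split=> //; exact: from_none.
Qed.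

Lemma wset_from J u : disjv u -> (forall j, u j != 0) -> wset J (from J u).
Proof.
move=> du nu; case: (fromP J du) => [[j [Jj _ ->]]|[_ ->]] //.
by rewrite /wincl; case: eqP => //= ?; split=> //; split=> //; exact: sphere_nrm.
Qed.

Lemma cmp_from (J : pred nat) u j : disjv u ->
  cmp (from [set i | J i] u) j = coll J (fun i => nrm (u i)) j.
Proof.
move=> du; rewrite /coll; case: (fromP [set i | J i] du) => [[i [Ji ui ->]]|[u0 ->]].
  rewrite cmp_wincl; have [->|ji] := eqVneq j i; first by rewrite Ji.
  by case: (du j i ji) => // ->; rewrite nrm_id ?if_same //; exact: sphere_e0.
by case: ifP => // Jj; rewrite u0 // nrm_id //; exact: sphere_e0.
Qed.

Lemma from_cmp J w : wset J w -> from J (cmp w) = w.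
Proof.
case: w => [[i v]|] /=; last by move=> _; apply: from_none.
move=> [Ji [sv /eqP ve]]; have di : disjv (cmp (Some (i, v))).
  move=> a b ab /=; have [ai|] := eqVneq a i; last by left.
  by right; rewrite ifF //; apply/negbTE; rewrite eq_sym -ai.
rewrite (from_some di Ji) /= eqxx; last exact/eqP.
by rewrite nrm_id // /wincl (negbTE ve).
Qed.

(** Requiring the j-th component to lie in an open set defines an open set of the wedge: on every
    other sphere the condition is constant, so only sphere [j] can be exceptional. *)
Lemma smap_cmp (T T' : topologicalType) (Z : set T) J D (f : T' -> wedge) (h : T -> T') :
  wcont J D f -> continuous h -> (forall t, D (h t)) -> (forall t, Z t -> f (h t) = b0) ->
  smap Z (fun t => cmp (f (h t))).
Proof.
move=> [fJ fU] ch Dh Zh; split=> [j|t j|t i j ij|t /Zh -> //].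
- apply/continuousP => O oO; pose U : set wedge := [set w | O (cmp w j)].
  have [|W [oW EW]] := fU U.
    split=> [i Ji|U0].
      have [->|ij] := eqVneq i j.
        exists O; split=> //; congr (_ `&` _); apply/funext => v.
        by rewrite /U /preimage /= cmp_wincl eqxx.
      exists [set _ | O e0]; split.
        by have [?|?] := pselect (O e0); [rewrite (_ : [set _ | _] = setT) ?predeqE //; exact: openT|
          rewrite (_ : [set _ | _] = set0) ?predeqE //; exact: open0].
      congr (_ `&` _); apply/funext => v.
      by rewrite /U /preimage /= cmp_wincl eq_sym (negbTE ij).
    apply: (@sub_finite_set _ _ [set j]); last exact: finite_set1.
    move=> i /= [_ H]; apply: contrapT => ij; apply: H => v _; rewrite /U /= cmp_wincl.
    by case: eqP => // E; case: ij.
  have -> : (fun t => cmp (f (h t)) j) @^-1` O = h @^-1` W.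
    apply/seteqP; split=> t /= H.
      by have : (D `&` f @^-1` U) (h t) by []; rewrite EW => -[].
    by have : (D `&` W) (h t) by []; rewrite -EW => -[].
  by move/continuousP: ch; apply.
- have := fJ _ (Dh t); case: (f (h t)) => [[i v]|] /=; last by move=> _; exact: e0_neq0.
  by move=> [_ [sv _]]; case: ifP => _; [exact: sphere_neq0|exact: e0_neq0].
- case: (f (h t)) => [[k v]|] /=; last by left.
  have [ik|] := eqVneq i k; last by left.
  by right; rewrite ifF //; apply/negbTE; rewrite eq_sym -ik.
Qed.

(** Near a point that is sent off [b0] the same component stays away from [e0]. Near a point sent to
    [b0] only the finitely many spheres not contained in [U] impose a condition, so finitely many
    neighbourhoods are intersected. *)
Lemma wcont_from (T : topologicalType) (Z D : set T) J (F : T -> nat -> V) : smap Z F ->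
  wcont J D (fun t => from J (F t)).
Proof.
move=> [cF nF dF _]; have dF' t : disjv (F t) by move=> i j; exact: dF.
split=> [t _|U [UJ Ufin]]; first by apply: wset_from.
exists [set t | U (from J (F t))]; split=> //; rewrite openE => t /= Ut.
have cn j : continuous (fun s => nrm (F s j)) by apply: cts_nrm.
have nearU j (W : set V) : W (nrm (F t j)) -> open W -> \forall s \near t, W (nrm (F s j)).
  by move=> Wt oW; apply: (cn j t); apply: open_nbhs_nbhs.
have inU j W s : J j -> sphere `&` (wincl j @^-1` U) = sphere `&` W -> W (nrm (F s j)) ->
    U (wincl j (nrm (F s j))).
  move=> Jj EW Ws; have : (sphere `&` W) (nrm (F s j)) by split=> //; exact: sphere_nrm.
  by rewrite -EW => -[].
have inW j W : J j -> sphere `&` (wincl j @^-1` U) = sphere `&` W -> U (wincl j (nrm (F t j))) ->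
    W (nrm (F t j)).
  move=> Jj EW Us; have : (sphere `&` (wincl j @^-1` U)) (nrm (F t j)) by split=> //; exact: sphere_nrm.
  by rewrite EW => -[].
case: (fromP J (dF' t)) => [[j [Jj Fj E]]|[F0 E]].
  have [W [oW EW]] := UJ j Jj; rewrite E in Ut.
  have N1 := nearU j W (inW j W Jj EW Ut) oW.
  have N2 : \forall s \near t, F s j <> e0.
    apply: (cF j t [set v | v <> e0]); apply: open_nbhs_nbhs; split=> //.
    rewrite (_ : [set v | _] = ~` [set e0]) //; apply: closed_openC.
    by apply: accessible_closed_set1; apply: hausdorff_accessible; exact: norm_hausdorff.
  apply: filterS2 N1 N2 => s Ws Fs /=; rewrite (from_some (dF' s) Jj Fs).
  exact: inU EW Ws.
rewrite E in Ut; have fin := Ufin Ut.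
set B := [set j | _] in fin; have nB j : B j -> \forall s \near t, U (wincl j (nrm (F s j))).
  move=> [Jj _]; have [W [oW EW]] := UJ j Jj.
  have Wt : W (nrm (F t j)).
    apply: inW => //; rewrite (F0 j Jj) nrm_id; last exact: sphere_e0.
    by rewrite /wincl eqxx.
  by apply: filterS (nearU j W Wt oW) => s; exact: inU.
have : \forall s \near t, forall j, B j -> U (wincl j (nrm (F s j))).
  have [L HL] := (finite_seqP B).1 fin; rewrite HL in nB *.
  elim: L nB {HL} => [|i L IH] nB; first by apply: filterE => s j.
  have H1 := nB i (mem_head _ _).
  have H2 := IH (fun j jL => nB j (mem_behead (s := i :: L) jL)).
  by apply: filterS2 H1 H2 => s a b j; rewrite /= inE => /orP[/eqP ->|/b].
apply: filterS => s Us /=; case: (fromP J (dF' s)) => [[j [Jj Fj ->]]|[_ ->]] //.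
have [Bj|nBj] := pselect (B j); first exact: Us.
have : forall v, sphere v -> U (wincl j v) by apply: contrapT => H; apply: nBj.
by apply; exact: sphere_nrm.
Qed.

End WedgePoints.

Section CubeMaps.
Context {R : realType} {m n : nat}.
Local Notation V := 'rV[R]_m.+1.
Local Notation e0 := (sphere_pt : V).
Local Notation smapn := (smap (@cubeout R n)).
Local Notation wmap := ('rV[R]_n -> wpt R m).
Implicit Types (x : 'rV[R]_n) (F : 'rV[R]_n -> nat -> V) (f g : wmap) (J : pred nat).

Lemma cts_ccl : continuous (@ccl R n).
Proof. by have ? := @cts_cl R; apply: cts_mkrow => i; cts. Qed.

Lemma ccl_id x : cube x -> ccl x = x.
Proof. by move=> xc; apply/rowP => i; rewrite mxE cl_id. Qed.

Lemma bdry_ccl x : cubeout x -> bdry (ccl x).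
Proof.
move=> [i xi]; split; first exact: cube_ccl.
exists i; rewrite mxE; move: xi; rewrite negb_and -!leNgt => /orP[] xi.
  by left; exact: cl_low.
by right; exact: cl_high.
Qed.

Lemma cubeout_bdry x : bdry x -> cubeout x.
Proof. by move=> [_ [i [] xi]]; exists i; rewrite xi ltxx ?andbF. Qed.

Lemma smap_ccl F x j : smapn F -> F (ccl x) j = F x j.
Proof.
move=> [_ _ _ zF]; have [xo|xo] := pselect (cubeout x).
  by rewrite !zF //; apply: cubeout_bdry; exact: bdry_ccl.
rewrite ccl_id // => i; have : 0 < x ord0 i < 1 by apply: contrapT => /negP xi; apply: xo; exists i.
by case/andP => /ltW -> /ltW ->.
Qed.

Definition toF f : 'rV[R]_n -> nat -> V := fun x => cmp (f (ccl x)).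

Lemma smap_toF (J : set nat) f : nmap J f -> smapn (toF f).
Proof.
move=> [cf bf]; apply: (smap_cmp cf cts_ccl); first exact: cube_ccl.
by move=> x /bdry_ccl /bf.
Qed.

Lemma htpy_hom (J : set nat) f g : htpy J f g -> hom (toF f) (toF g).
Proof.
move=> [H [cH [H01 Hb]]]; have ? := @cts_cl R; have ? := @cts_ccl.
exists (fun p => cmp (H (cl p.1, ccl p.2))); split=> [|x j|x j].
- apply: (smap_cmp cH (h := fun p : R * 'rV[R]_n => (cl p.1, ccl p.2))).
  + by apply: cts_pair; cts.
  + by move=> p; split; [exact: cl01|exact: cube_ccl].
  + by move=> [s x] /bdry_ccl xb; apply: Hb => //; exact: cl01.
- by rewrite /= cl_low // (H01 _ (cube_ccl x)).1.
- by rewrite /= cl_high // (H01 _ (cube_ccl x)).2.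
Qed.

Lemma hom_htpy (J : set nat) f g : (forall x, cube x -> wset J (f x)) ->
  (forall x, cube x -> wset J (g x)) -> hom (toF f) (toF g) -> htpy J f g.
Proof.
move=> fJ gJ [K [sK K0 K1]]; exists (fun p => from J (K p)); split; first exact: wcont_from sK.
have fromE h x : cube x -> wset J (h x) -> from J (toF h x) = h x.
  by move=> xc hx; rewrite /toF ccl_id // from_cmp.
have [_ _ _ zK] := sK; split=> [x xc|t x _ xb].
  by split; [rewrite -(fromE f x xc (fJ x xc))|rewrite -(fromE g x xc (gJ x xc))]; congr (from J _); apply/funext => j; rewrite ?K0 ?K1.
by apply: from_none => j _; apply: zK; exact: cubeout_bdry.
Qed.

Lemma nmap_from (J : set nat) F : smapn F -> nmap J (fun x => from J (F x)).
Proof.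
move=> sF; split; first exact: wcont_from sF.
by have [_ _ _ zF] := sF; move=> x xb; apply: from_none => j _; apply: zF; exact: cubeout_bdry.
Qed.

(** The radial push performed by [from] is undone by rescaling every vector with a positive factor
    that fixes [e0]. *)
Lemma hom_toF_from J F : smapn F ->
  hom (toF (fun x => from [set j | J j] (F x))) (fun x => coll J (F x)).
Proof.
move=> sF; have [cF nF dF zF] := sF; have ? := @cts_cl R.
have E x j : toF (fun x => from [set j | J j] (F x)) x j = coll J (fun i => nrm (F x i)) j.
  rewrite /toF cmp_from; last by move=> a b; exact: dF.
  by rewrite /coll; case: (J j) => //; rewrite smap_ccl.
pose c (r : R) (v : V) := (1 - cl r) * (Num.sqrt (sqn v))^-1 + cl r.
have c0 r v : v != 0 -> c r v != 0.
  move=> /sqn_gt0 v0; have : 0 < (Num.sqrt (sqn v))^-1 by rewrite invr_gt0 sqrtr_gt0.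
  rewrite /c; move: (_^-1) => s s0; have := cl01 r => r01; rewrite gt_eqF //; nra.
have ce r : c r e0 *: e0 = e0.
  have E1 : sqn e0 = 1 by exact: (@sphere_e0 R m).
  by rewrite /c E1 sqrtr1 invr1 mulr1 subrK scale1r.
exists (fun p => coll J (fun i => c p.1 (F p.2 i) *: F p.2 i)); split=> [|x j|x j].
- apply: (tmap_coll J (K := fun (p : R * 'rV[R]_n) i => c p.1 (F p.2 i) *: F p.2 i)).
  split=> [j|[r x] j|[r x] i j ij|[r x] /= xo j].
  + have cj : continuous (fun p : R * 'rV[R]_n => F p.2 j) by apply: (cts_comp (cF j)); cts.
    apply: ctsVZ => //; apply: ctsD; last by cts.
    apply: ctsM; first by cts.
    apply: ctsV => [p|]; first by rewrite gt_eqF // sqrtr_gt0 sqn_gt0.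
    apply: (cts_comp (@sqrt_continuous R)); apply: cts_sum => i _.
    by rewrite (_ : (fun p => _) = fun p : R * 'rV[R]_n => F p.2 j ord0 i * F p.2 j ord0 i) //; cts.
  + by rewrite scaler_eq0 negb_or /= c0 ?nF.
  + by case: (dF x i j ij) => /= ->; [left|right].
  + by rewrite zF.
- by rewrite E /coll /= /c cl_low // subr0 mul1r addr0.
- by rewrite /coll /= /c cl_high // subrr mul0r add0r scale1r.
Qed.

Lemma toF_bcol k f x j : toF (bcol k \o f) x j = coll (fun j => j <= k)%N (toF f x) j.
Proof.
rewrite /toF /coll /=; case: (f _) => [[i v]|] /=; last by rewrite if_same.
by case: ifP => ik /=; have [->|_] := eqVneq j i; rewrite ?ik ?if_same.
Qed.

End CubeMaps.

Section Concat.
Context {R : realType} {m n : nat}.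
Implicit Types (f g : 'rV[R]_n.+1 -> wpt R m).

Lemma cube_upd (x : 'rV[R]_n.+1) (r : R) : cube x -> 0 <= r <= 1 ->
  cube (\row_i (if i == ord0 then r else x ord0 i)).
Proof. by move=> xc r01 i; rewrite mxE; case: ifP. Qed.

Lemma wset_concat (J : set nat) f g : (forall x, cube x -> wset J (f x)) ->
  (forall x, cube x -> wset J (g x)) -> forall x, cube x -> wset J (concat f g x).
Proof.
move=> fJ gJ x xc; have := xc ord0 => x01; rewrite /concat.
by case: lerP => x0; [apply: fJ|apply: gJ]; apply: cube_upd => //; lra.
Qed.

Lemma toF_concat f g x j : (forall x, bdry x -> f x = b0) -> (forall x, bdry x -> g x = b0) ->
  toF (concat f g) x j = conc ord0 (toF f) (toF g) x j.
Proof.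
move=> fb gb; rewrite /conc /sup /toF /concat mxE.
have E (r s : R) : cl r = s -> (\row_i (if i == ord0 then s else ccl x ord0 i)) = ccl (upd x ord0 r).
  by move=> <-; apply/rowP => i; rewrite !mxE; case: ifP.
have out r : ~~ (0 < r < 1) -> bdry (ccl (upd x ord0 r)).
  by move=> r0; apply: bdry_ccl; exact: cubeout_upd.
set t := x ord0 ord0; case: lerP => t0.
  have t1 : t <= 2^-1 by move: t0; case: (clP t) => *; lra.
  rewrite gb; last by apply: out; out01.
  rewrite /= addrK (E (2 * t)) //; case: (clP t) => [?|? ?|?]; last by lra.
    by rewrite mulr0 cl_low //; lra.
  by rewrite cl_id //; lra.
have t1 : 2^-1 < t by move: t0; case: (clP t) => *; lra.
rewrite [f _]fb; last by apply: out; out01.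
have bK (v : 'rV[R]_m.+1) : cmp b0 j + v - sphere_pt = v by rewrite addrC addKr.
rewrite bK (E (2 * t - 1)) //; case: (clP t) => [?|? ?|?]; first by lra.
  by rewrite cl_id //; lra.
by rewrite cl_high //; lra.
Qed.

End Concat.

Lemma pr_toF (R : realType) (m n : nat) (J : pred nat) (f : 'rV[R]_n.+2 -> wpt R m) :
  nmap [set j | J j] f -> pr J (cls (toF f)) = cls (toF f).
Proof.
move=> nf; have sf := smap_toF nf; rewrite pr_cls //.
apply: cls_eq => [|x j]; first exact: tmap_coll sf.
rewrite /coll; case: ifP => // Jj; have [[fJ _] _] := nf.
have := fJ _ (cube_ccl x); rewrite /toF; case: (f _) => [[i v]|] //= [Ji _].
by case: eqVneq => // E; rewrite E Ji in Jj.
Qed.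

(** * The splitting on classes and its translation into maps *)

Lemma split_epi (R : realType) (q n : nat) : (n.+3 <= 2 * q.+2)%N ->
  exists sec : (nat -> Pi R q.+2 n) -> Pi R q.+2 n,
    (forall g g', sec (fun k => g k + g' k) = sec g + sec g') /\
    forall g k, (0 < k)%N ->
      (forall k, (0 < k)%N -> pr (fun j => 0 < j <= k)%N (g k) = g k) ->
      (forall k, (0 < k)%N -> pr (fun j => 0 < j <= k)%N (g k.+1) = g k) ->
      pr (fun j => 0 < j <= k)%N (sec g) = g k.
Proof.
rewrite leq_eqVlt => /orP[/eqP E|nq].
  have {E} -> : n = (q + q.+1)%N by lia.
  have Wp th (a b : Pi R q.+2 q) : tmap th -> pmap th (wh a b) = wh (pmap th a) (pmap th b).
    exact: pmap_wh.
  exists (section (@whDr R q.+2 q) (@wh0l R q.+2 q) Wp (@wh_generate R q)); split.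
    by move=> g g'; exact: sectionD.
  by move=> g k; exact: pr_section.
(* Below the top degree there are no cross effects, so the zero pairing already satisfies the
   generation hypothesis. *)
pose W (a b : Pi R q.+2 q) : Pi R q.+2 n := 0.
have WD a b b' : W a (b + b') = W a b + W a b' by rewrite addr0.
have W0 b : W 0 b = 0 by [].
have Wp th a b : tmap th -> pmap th (W a b) = W (pmap th a) (pmap th b).
  by move=> tth; rewrite /W pmap0.
have Wg k (a : Pi R q.+2 n) : pr (fun j => j <= k)%N a = a -> (forall j, pr (pred1 j) a = 0) ->
    exists c : nat -> nat -> int, a = \sum_(i < k.+1) \sum_(j < k.+1 | (i < j)%N)
      W (@ioc R q i) (@ioc R q j) *~ c i j.
  move=> ak a1; exists (fun _ _ => 0); rewrite (no_cross_small nq ak a1).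
  by rewrite big1 // => i _; rewrite big1 // => j _; rewrite mulr0z.
exists (section WD W0 Wp Wg); split; first by move=> g g'; exact: sectionD.
by move=> g k; exact: pr_section.
Qed.

Theorem theorem1p2 (R : realType) (m n : nat) :
  (2 <= m)%N -> (2 <= n)%N -> (n <= 2 * m - 1)%N ->
  exists sigma : (nat -> 'rV[R]_n.-1.+1 -> wpt R m) -> ('rV[R]_n.-1.+1 -> wpt R m),
    (* sigma maps Cech elements to elements of pi_n(E_m) *)
    (forall g, cech_elt g -> nmap Eidx (sigma g)) /\
    (* sigma is well defined on homotopy classes *)
    (forall g g', cech_elt g -> cech_elt g' ->
       (forall k, (1 <= k)%N -> htpy (Xidx k) (g k) (g' k)) ->
       htpy Eidx (sigma g) (sigma g')) /\
    (* sigma is a homomorphism (the Cech group operation is componentwise) *)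
    (forall g g', cech_elt g -> cech_elt g' ->
       htpy Eidx (sigma (fun k => concat (g k) (g' k))) (concat (sigma g) (sigma g'))) /\
    (* Psi_n o sigma = id *)
    (forall g, cech_elt g -> forall k, (1 <= k)%N ->
       htpy (Xidx k) (bcol k \o sigma g) (g k)).
Proof.
case: m => [|[|q]] // _; case: n => [|[|n]] // _ nm; rewrite [n.+2.-1.+1]/=.
have [|sec [secD secP]] := @split_epi R q n; first by lia.
(* Only the classes of the [g k] enter, so homotopic Cech elements yield literally the same map
   [sigma g]. Index 0 is filled with 0 because Cech elements start at k = 1. *)
pose cl_ (g : nat -> 'rV[R]_n.+2 -> wpt R q.+2) k : Pi R q.+2 n :=
  if (0 < k)%N then cls (toF (g k)) else 0.
pose sigma g x : wpt R q.+2 := from Eidx (rep (sec (cl_ g)) x).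
have nsig g : nmap Eidx (sigma g) by apply: nmap_from; exact: smap_rep.
have wsig g x : cube x -> wset Eidx (sigma g x) by have [[+ _] _] := nsig g; apply.
have csig g : cls (toF (sigma g)) = pr (fun j => 0 < j)%N (sec (cl_ g)).
  by rewrite (cls_hom (hom_toF_from (fun j => 0 < j)%N (smap_rep _))).
have sX g k : cech_elt g -> (0 < k)%N -> smap (@cubeout R n.+2) (toF (g k)).
  by move=> [gX _] k0; exact: smap_toF (gX k k0).
exists sigma; split; first by [].
split.
  move=> g g' cg cg' gg'; apply: hom_htpy; [exact: wsig|exact: wsig|].
  have -> : sigma g = sigma g'; last by apply: hom_refl; exact: smap_toF (nsig g').
  suff E : cl_ g = cl_ g' by rewrite /sigma E.
  apply/funext => k; rewrite /cl_; case: ifP => // k0.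
  by apply: cls_hom; apply: htpy_hom; exact: gg'.
split.
  move=> g g' cg cg'; have [cgX cgX'] := (cg.1, cg'.1).
  apply: hom_htpy; [exact: wsig|by apply: wset_concat; exact: wsig|].
  have bs h x : bdry x -> sigma h x = b0 by case: (nsig h) => _; apply.
  have E : toF (concat (sigma g) (sigma g')) = conc ord0 (toF (sigma g)) (toF (sigma g')).
    by apply/funext => x; apply/funext => j; rewrite toF_concat //; exact: bs.
  rewrite E; have [s1 s2] := (smap_toF (nsig g), smap_toF (nsig g')).
  apply/clsP; [exact: smap_toF (nsig _)|exact: smap_conc|].
  rewrite cls_conc // !csig -prD -secD; congr (pr _ (sec _)); apply/funext => k.
  rewrite /cl_; case: ifP => k0; last by rewrite addr0.
  rewrite -(cls_conc ord0); [|exact: sX|exact: sX]; congr cls.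
  apply/funext => x; apply/funext => j; apply: toF_concat.
    by case: (cgX k k0).
  by case: (cgX' k k0).
move=> g cg k k0; have [gX gS] := cg.
have wX x : cube x -> wset (Xidx k) (g k x) by case: (gX k k0) => -[+ _] _; apply.
have wbc x : cube x -> wset (Xidx k) ((bcol k \o sigma g) x).
  move=> xc; have := wsig g x xc; rewrite /=; case: (sigma g x) => [[i v]|] //= [Ji [sv ve]].
  by case: ifP => //= ik; split=> //; rewrite /Xidx /= ik andbT.
apply: hom_htpy => //.
have bE (h : 'rV[R]_n.+2 -> wpt R q.+2) l : toF (bcol l \o h) = fun x => coll (fun j => j <= l)%N (toF h x).
  by apply/funext => x; apply/funext => j; exact: toF_bcol.
have ssig := smap_toF (nsig g).
rewrite bE; apply/clsP; [exact: tmap_coll ssig|exact: sX|].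
rewrite -pr_cls // csig pr_pr (@eq_pr _ _ _ _ (fun j => 0 < j <= k)%N); last first.
  by move=> j; rewrite andbC.
have clE l : (0 < l)%N -> cl_ g l = cls (toF (g l)) by rewrite /cl_ => ->.
rewrite secP // ?clE // => l l0; rewrite !clE //.
  by apply: (@pr_toF R q.+2 n (fun j => 0 < j <= l)%N); exact: gX.
rewrite -(cls_hom (htpy_hom (gS l l0))) bE -pr_cls; last exact: sX.
rewrite -[in LHS](@pr_toF R q.+2 n (fun j => 0 < j <= l.+1)%N) ?pr_pr; last exact: gX.
rewrite -[in RHS](@pr_toF R q.+2 n (fun j => 0 < j <= l.+1)%N) ?pr_pr; last exact: gX.
by apply: eq_pr => j; apply/idP/idP; lia.
Qed.
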